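(* The set of Dixmier-measurable operators in $\mathcal L_{1,\infty}$ strictly contains the set of $\mathcal{PT}$-measurable operators in $\mathcal L_{1,\infty}$; that is, every $\mathcal{PT}$-measurable operator is Dixmier-measurable, and there exists a Dixmier-measurable operator in $\mathcal L_{1,\infty}$ (which can even be chosen positive) that is not $\mathcal{PT}$-measurable.
   Context: $\mu(n,A)$ denotes singular values, $\mu(t,A)=\mu(n,A)$ for $t\in[n,n+1)$; $\mathcal L_{1,\infty}=\{A\text{ compact}:\sup_n(n+1)\mu(n,A)<\infty\}$. A trace is a unitarily invariant linear functional on $\mathcal L_{1,\infty}$; $\mathcal{PT}$ is the set of positive (nonnegative on positive operators) normalised (value $1$ on $A\ge0$ with $\mu(n,A)=1/(n+1)$) traces. A Dixmier trace is the linear extension of $\mathrm{Tr}_\omega(A)=\omega\big(t\mapsto\frac1{\log(1+t)}\int_0^t\mu(s,A)ds\big)$, $0\le A\in\mathcal L_{1,\infty}$, for a dilation invariant extended limit $\omega$ on $L_\infty(0,\infty)$; Dixmier traces belong to $\mathcal{PT}$. For a set $\mathcal A$ of traces, $A\in\mathcal L_{1,\infty}$ is $\mathcal A$-measurable if all $\tau\in\mathcal A$ take the same value on $A$; Dixmier-measurable means measurable w.r.t. the set of all Dixmier traces. *)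

(* Defs.v *)
(* Hilbert space H = l^2(N) over C = R[i]. *)
From HB Require Import structures.
From mathcomp Require Import all_boot all_order all_algebra.
From mathcomp Require Import all_classical all_reals all_analysis.
From mathcomp Require Import complex.
Set Implicit Arguments. Unset Strict Implicit. Unset Printing Implicit Defensive.
Import Order.TTheory GRing.Theory Num.Theory.
Local Open Scope classical_set_scope.
Local Open Scope ring_scope.

(* ---------- vectors of l^2(N) ---------- *)
Definition vec (R : realType) := nat -> R[i].
Definition op (R : realType) := vec R -> vec R.

(* |z|^2 for a complex number z *)
Definition csq {R : realType} (z : R[i]) : R := (complex.Re z) ^+ 2 + (complex.Im z) ^+ 2.

(* x is square summable *)
Definition l2 {R : realType} (x : vec R) : Prop :=
  exists M : R, forall n, \sum_(k < n) csq (x k) <= M.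

(* sum of a real series (limit of its partial sums) *)
Definition rsum {R : realType} (u : nat -> R) : R := limn (fun n => \sum_(k < n) u k).

(* the l^2 norm *)
Definition vnorm {R : realType} (x : vec R) : R :=
  Num.sqrt (rsum (fun k => csq (x k))).

(* the inner product <x, y> = sum_k x_k conj(y_k) *)
Definition cinner {R : realType} (x y : vec R) : R[i] :=
  Complex (rsum (fun k => complex.Re (x k * (y k)^*)))
          (rsum (fun k => complex.Im (x k * (y k)^*))).

(* ---------- bounded operators on l^2(N) ----------
   An operator is represented by a function on all sequences which is
   zero outside l^2 (canonical representative), linear and bounded on l^2. *)
Definition bounded_op {R : realType} (A : op R) : Prop :=
  [/\ (forall x, ~ l2 x -> A x = (fun _ => 0)),
      (forall x, l2 x -> l2 (A x)),
      (forall (a : R[i]) x y, l2 x -> l2 y ->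
          A (fun k => a * x k + y k) = (fun k => a * A x k + A y k)) &
      exists M : R, forall x, l2 x -> vnorm (A x) <= M * vnorm x].

(* operator norm *)
Definition opnorm {R : realType} (A : op R) : R :=
  sup [set vnorm (A x) | x in [set x | l2 x /\ vnorm x <= 1]].

(* linear combinations and composition of operators *)
Definition opcomb {R : realType} (a : R[i]) (A B : op R) : op R :=
  fun x k => a * A x k + B x k.
Definition opsub {R : realType} (A B : op R) : op R :=
  fun x k => A x k - B x k.

(* rank F <= n : the range of F lies in the span of n vectors *)
Definition rank_le {R : realType} (F : op R) (n : nat) : Prop :=
  exists v : 'I_n -> vec R, forall x, l2 x ->
    exists c : 'I_n -> R[i], F x = (fun k => \sum_(i < n) c i * v i k).

(* singular values mu(n, A) = inf { ||A - F|| : rank F <= n } *)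
Definition smu {R : realType} (n : nat) (A : op R) : R :=
  inf [set opnorm (opsub A F) | F in [set F | bounded_op F /\ rank_le F n]].

(* mu(t, A) = mu(n, A) for t in [n, n+1) *)
Definition smu_t {R : realType} (t : R) (A : op R) : R := smu (Num.truncn t) A.

(* compact: the image of the unit ball is totally bounded *)
Definition compact_op {R : realType} (A : op R) : Prop :=
  forall e : R, 0 < e -> exists (m : nat) (y : 'I_m -> vec R),
    forall x, l2 x -> vnorm x <= 1 ->
      exists i, vnorm (fun k => A x k - y i k) < e.

(* the weak trace ideal L_{1,oo} *)
Definition L1inf {R : realType} (A : op R) : Prop :=
  [/\ bounded_op A, compact_op A &
      exists M : R, forall n : nat, n.+1%:R * smu n A <= M].

(* positive operators *)
Definition pos_op {R : realType} (A : op R) : Prop :=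
  bounded_op A /\ forall x, l2 x -> 0 <= cinner (A x) x.

(* U unitary with inverse V *)
Definition unitary_pair {R : realType} (U V : op R) : Prop :=
  [/\ bounded_op U, bounded_op V,
      (forall x, l2 x -> U (V x) = x /\ V (U x) = x) &
      (forall x, l2 x -> vnorm (U x) = vnorm x)].

(* ---------- traces ---------- *)
Definition is_trace {R : realType} (tau : op R -> R[i]) : Prop :=
  (forall a A B, L1inf A -> L1inf B -> tau (opcomb a A B) = a * tau A + tau B) /\
  (forall U V A, unitary_pair U V -> L1inf A -> tau (U \o A \o V) = tau A).

(* positive normalised traces *)
Definition PT {R : realType} (tau : op R -> R[i]) : Prop :=
  [/\ is_trace tau,
      (forall A, L1inf A -> pos_op A -> 0 <= tau A) &
      (forall A, L1inf A -> pos_op A -> (forall n : nat, smu n A = n.+1%:R^-1) ->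
           tau A = 1)].

(* A is measurable with respect to a set of traces *)
Definition measurable_wrt {R : realType} (S : (op R -> R[i]) -> Prop) (A : op R) :=
  forall tau1 tau2, S tau1 -> S tau2 -> tau1 A = tau2 A.

(* ---------- extended limits on L_oo(0,oo) ---------- *)
Definition Linf {R : realType} (f : R -> R) : Prop :=
  measurable_fun `](0:R), +oo[%classic f /\
  exists M : R, \forall t \ae (@lebesgue_measure R), `](0:R), +oo[%classic t -> `|f t| <= M.

(* a positive normalised linear functional on L_oo(0,oo) vanishing on functions
   supported in a bounded interval, i.e. omega f <= ess limsup_{t->oo} f t *)
Definition ext_lim {R : realType} (om : (R -> R) -> R) : Prop :=
  [/\ (forall (a : R) f g, Linf f -> Linf g ->
         om (fun t => a * f t + g t) = a * om f + om g),
      (forall f, Linf f ->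
         (\forall t \ae (@lebesgue_measure R), `](0:R), +oo[%classic t -> 0 <= f t) ->
         0 <= om f),
      om (fun _ => 1) = 1 &
      (forall f (T : R), Linf f ->
         (\forall t \ae (@lebesgue_measure R), `]T, +oo[%classic t -> f t = 0) ->
         om f = 0)].

Definition dilation_inv {R : realType} (om : (R -> R) -> R) : Prop :=
  forall (s : R) f, 0 < s -> Linf f -> om (fun t => f (t / s)) = om f.

(* t |-> 1/log(1+t) \int_0^t mu(s, A) ds *)
Definition dix_fun {R : realType} (A : op R) (t : R) : R :=
  (ln (1 + t))^-1 * \int[(@lebesgue_measure R)]_(s in `[(0:R), t]%classic) smu_t s A.

(* Dixmier traces: linear extensions to L_{1,oo} of Tr_omega *)
Definition Dixmier {R : realType} (tau : op R -> R[i]) : Prop :=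
  exists om, [/\ ext_lim om, dilation_inv om,
    (forall a A B, L1inf A -> L1inf B -> tau (opcomb a A B) = a * tau A + tau B) &
    (forall A, L1inf A -> pos_op A -> tau A = (om (dix_fun A))%:C%C)].

(* Main.v *)
(** For [T] in the weak trace ideal choose, for every [n], an orthonormal family of
    [O(2 ^ n)] vectors off which [T] and its adjoint have norm [O(2 ^ - n)], and let
    [t n] be the sum of [<T e, e>] over that family.  By
    [Tr (T P) - Tr (T Q) = Tr ((1 - Q) T P) - Tr (T (1 - P) Q)] the sequence [t] is
    independent of the choices up to a bounded error, hence additive and unitarily
    invariant up to a bounded error, and it has bounded increments.  Therefore any
    extended limit of [(t (a m + m) - t (a m)) / (m ln 2)] is a trace, whatever the
    windows [a m, a m + m] are.  For [T >= 0], almost maximisers of the quadratic form,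
    taken successively on orthogonal complements, are almost eigenvectors, which gives
    [t n = sum_{k < 2 ^ n - 1} mu(k, T) + O(1)]; so these traces are positive and
    normalised.

    The separating operator is diagonal with [mu(k) = x_n / 2 ^ n] for
    [2 ^ n <= k + 1 < 2 ^ (n + 1)], where [x_n = 2] on the intervals
    [2 ^ m <= n < 2 ^ m + m] and [x_n = 1] elsewhere.  These intervals have density
    zero, so the Dixmier averages converge to [1 / ln 2]; the windows [a m = 2 ^ m] give
    a trace with value [2 / ln 2], the windows [a m = 0] one with value [1 / ln 2].

    Conversely a Dixmier trace belongs to [PT] as soon as it is unitarily invariant, and
    on positive operators it is, as it only depends on singular values.  The positive
    operators span the ideal: if [F_n] are compressions of [T] to the dyadic families,
    [F_{n+1} - F_n] is dominated by [O(2 ^ - n)] times a projection of rank [O(2 ^ n)],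
    and the sum [B] of these majorants makes [Re T + B], [Im T + B] and [B] positive. *)
From HB Require Import structures.
Require Import Defs.
From mathcomp Require Import all_boot all_order all_algebra.
From mathcomp Require Import all_classical all_reals all_analysis.
From mathcomp Require Import complex ring lra zify.
Set Implicit Arguments. Unset Strict Implicit. Unset Printing Implicit Defensive.
From mathcomp Require Import measurable_realfun.
Import Order.TTheory GRing.Theory Num.Theory numFieldNormedType.Exports.
Local Open Scope classical_set_scope.
Local Open Scope ring_scope.

(** Nothing is diagonalised. Suprema and infima need not be attained, so every construction
    tolerates an error, and the scaling makes errors harmless: level [n] involves [O(2 ^ n)] vectors
    and norms [O(2 ^ - n)], whose product is [O(1)], and a window of length [m] divides an [O(1)]
    error by [m]. Smallness is demanded of the adjoint too, because the comparison of two families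
    meets [(1 - Q) T] as well as [T (1 - P)]. The windows separate the two classes because a Dixmier
    average at level [n] weighs all levels below [n], whereas a window of length [m] starting at
    level [2 ^ m] sees only a proportion [m / 2 ^ m] of them. A perturbation may fill such windows
    and still have density zero. It must not break the monotonicity of the singular values: a factor
    [2] is exactly what one dyadic step can absorb. The [ln 2] converts levels into logarithms. *)

Section Modulus.
Variable R : realType.
Implicit Types z w : R[i].

(** The norm of [R[i]] takes values in [R[i]]; a modulus in [R] keeps all estimates in the ordered
    field. *)
Definition cabs z : R := Num.sqrt (csq z).

Lemma csq_ge0 z : 0 <= csq z.
Proof. by rewrite addr_ge0 ?sqr_ge0. Qed.

Lemma cabs_ge0 z : 0 <= cabs z.
Proof. exact: sqrtr_ge0. Qed.

Lemma sqr_cabs z : cabs z ^+ 2 = csq z.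
Proof. by rewrite sqr_sqrtr ?csq_ge0. Qed.

Lemma cabsE z : (cabs z)%:C%C = `|z|.
Proof. by rewrite normc_def. Qed.

Lemma cabs_conj z : cabs z^* = cabs z.
Proof. by case: z => a b; rewrite /cabs /csq /= sqrrN. Qed.

Lemma mul_conj z : z * z^* = (csq z)%:C%C.
Proof. by rewrite -normCK -cabsE -sqr_cabs rmorphXn. Qed.

Lemma cabsM z w : cabs (z * w) = cabs z * cabs w.
Proof. by have := normrM z w; rewrite -!cabsE -rmorphM => -[]. Qed.

Lemma cabsD z w : cabs (z + w) <= cabs z + cabs w.
Proof. by rewrite -lecR rmorphD /= !cabsE ler_normD. Qed.

Lemma cabsN z : cabs (- z) = cabs z.
Proof. by case: z => a b; rewrite /cabs /csq /= !sqrrN. Qed.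

Lemma cabsB z w : cabs (z - w) <= cabs z + cabs w.
Proof. by rewrite -(cabsN w) cabsD. Qed.

Lemma cabs0 : cabs 0 = 0.
Proof. by rewrite /cabs /csq /= expr0n addr0 sqrtr0. Qed.

Lemma cabs_eq0 z : (cabs z == 0) = (z == 0).
Proof. by rewrite -(inj_eq (@complexI R)) cabsE normr_eq0. Qed.

Lemma cabs_real (r : R) : cabs r%:C%C = `|r|.
Proof. by rewrite /cabs /csq /= expr0n addr0 sqrtr_sqr. Qed.

Lemma cabs_i : cabs ('i%C : R[i]) = 1.
Proof. by rewrite /cabs /csq /= expr0n add0r expr1n sqrtr1. Qed.

Lemma cabs_sum (I : Type) (s : seq I) (P : pred I) (F : I -> R[i]) :
  cabs (\sum_(i <- s | P i) F i) <= \sum_(i <- s | P i) cabs (F i).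
Proof.
elim/big_rec2: _ => [|i x y _ h]; first by rewrite cabs0.
by apply: le_trans (cabsD _ _) _; rewrite lerD2l.
Qed.

Lemma Re_le_cabs z : complex.Re z <= cabs z.
Proof.
apply: le_trans (ler_norm _) _; rewrite -sqrtr_sqr ler_wsqrtr //.
by rewrite lerDl sqr_ge0.
Qed.

Lemma ReN_le_cabs z : - complex.Re z <= cabs z.
Proof. by rewrite -cabsN; case: z => a b; exact: (Re_le_cabs (- (a +i* b)%C)). Qed.

Lemma Im_le_cabs z : complex.Im z <= cabs z.
Proof.
apply: le_trans (ler_norm _) _; rewrite -sqrtr_sqr ler_wsqrtr //.
by rewrite lerDr sqr_ge0.
Qed.

Lemma csqM z w : csq (z * w) = csq z * csq w.
Proof. by rewrite -!sqr_cabs cabsM exprMn. Qed.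

Lemma csqD z w : csq (z + w) <= 2 * (csq z + csq w).
Proof.
rewrite -!sqr_cabs; have := cabsD z w; have := cabs_ge0 (z + w).
have := cabs_ge0 z; have := cabs_ge0 w.
move: (cabs _) (cabs z) (cabs w) => c a b b0 a0 c0 cab.
have h : c ^+ 2 <= (a + b) ^+ 2 by rewrite lerXn2r ?nnegrE ?addr_ge0.
by have := sqr_ge0 (a - b); lra.
Qed.

Lemma csq0 : csq (0 : R[i]) = 0.
Proof. by rewrite /csq /= expr0n addr0. Qed.

Lemma csq_eq0 z : (csq z == 0) = (z == 0).
Proof. by rewrite -sqr_cabs sqrf_eq0 cabs_eq0. Qed.

End Modulus.

(** * Convergent real series *)

Section RealSeries.
Variable R : realType.
Implicit Types u v : nat -> R.

Definition summable u := cvgn (fun n => \sum_(k < n) u k).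

Lemma partial_sumE u : (fun n => \sum_(k < n) u k) = series u.
Proof. by apply/funext => n; rewrite seriesEord. Qed.

Lemma summable_ge0 u (M : R) : (forall k, 0 <= u k) ->
  (forall n, \sum_(k < n) u k <= M) -> summable u.
Proof.
move=> u0 uM; apply: nondecreasing_is_cvgn.
  by rewrite partial_sumE; apply/nondecreasing_series.
by exists M => _ [n _ <-].
Qed.

Lemma summable_le u v : (forall k, `|u k| <= v k) -> summable v -> summable u.
Proof.
rewrite /summable !partial_sumE => uv cv; apply: normed_cvg.
by apply: series_le_cvg cv => n //=; apply: le_trans (uv n).
Qed.

Lemma summableD u v : summable u -> summable v -> summable (fun k => u k + v k).
Proof.
move=> cu cv; rewrite /summable (_ : (fun _ => _) =
  (fun n => \sum_(k < n) u k) + (fun n => \sum_(k < n) v k)).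
  exact: is_cvgD.
by apply/funext => n; rewrite big_split.
Qed.

Lemma rsumD u v : summable u -> summable v ->
  rsum (fun k => u k + v k) = rsum u + rsum v.
Proof.
move=> cu cv; rewrite /rsum (_ : (fun _ => _) =
  (fun n => \sum_(k < n) u k) + (fun n => \sum_(k < n) v k)).
  exact: limD.
by apply/funext => n; rewrite big_split.
Qed.

Lemma summableZ (a : R) u : summable u -> summable (fun k => a * u k).
Proof.
rewrite /summable => cu; rewrite (_ : (fun _ => _) = a *: (fun n => \sum_(k < n) u k)).
  exact: is_cvgZl_tmp.
by apply/funext => n /=; rewrite -mulr_sumr.
Qed.

Lemma rsumZ (a : R) u : summable u -> rsum (fun k => a * u k) = a * rsum u.
Proof.
rewrite /rsum /summable => cu.
rewrite (_ : (fun _ => _) = (cst a) \* (fun n => \sum_(k < n) u k)).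
  rewrite limM //; last exact: is_cvg_cst.
  by rewrite lim_cst.
by apply/funext => n /=; rewrite -mulr_sumr.
Qed.

Lemma rsum_ge u (n : nat) : (forall k, 0 <= u k) -> summable u ->
  \sum_(k < n) u k <= rsum u.
Proof.
move=> u0; rewrite /rsum /summable partial_sumE => cu.
rewrite -[leLHS]/((fun n => \sum_(k < n) u k) n) partial_sumE.
by apply: nondecreasing_cvgn_le => //; apply/nondecreasing_series.
Qed.

Lemma rsum_le u (M : R) : summable u -> (forall n, \sum_(k < n) u k <= M) ->
  rsum u <= M.
Proof. by move=> cu uM; apply: limr_le => //; apply: nearW. Qed.

End RealSeries.

(** * Square summable sequences as an inner product space *)

Section Hilbert.
Variable R : realType.
Local Notation C := R[i].

Lemma l2_summable (x : vec R) : l2 x -> summable (fun k => csq (x k)).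
Proof. by move=> [M xM]; apply: summable_ge0 xM => k; apply: csq_ge0. Qed.

Definition l2pred : {pred nat -> C} := fun x => `[< l2 x >].

Lemma l2_closed : submod_closed l2pred.
Proof.
split; first by apply/asboolP; exists 0 => n; rewrite big1 // => k _; rewrite csq0.
move=> a x y /asboolP [M xM] /asboolP [N yN]; apply/asboolP.
exists (2 * (csq a * M + N)) => n.
apply: (@le_trans _ _ (\sum_(k < n) 2 * (csq a * csq (x k) + csq (y k)))).
  by apply: ler_sum => k _; apply: le_trans (csqD _ _) _; rewrite csqM.
rewrite -mulr_sumr ler_pM2l // big_split /= -mulr_sumr lerD ?yN //.
by apply: ler_wpM2l; rewrite ?csq_ge0 ?xM.
Qed.

HB.instance Definition _ := GRing.isSubmodClosed.Build _ _ l2pred l2_closed.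

(** A subtype rather than a predicate: it inherits the module structure of sequences, and operators
    on it carry no side condition [l2]. *)
Record hil := Hil { hval :> nat -> C; hvalP : hval \in l2pred }.

HB.instance Definition _ := [isSub for hval].
HB.instance Definition _ := [Choice of hil by <:].
HB.instance Definition _ := [SubChoice_isSubLmodule of hil by <:].

Definition mkhil (x : vec R) (lx : l2 x) : hil := @Hil x (introT (asboolP _) lx).

Lemma hil_l2 (x : hil) : l2 x.
Proof. exact/asboolP/hvalP. Qed.

Lemma hilP (x y : hil) : (forall k, x k = y k) -> x = y.
Proof. by move=> xy; apply/val_inj/funext. Qed.

Implicit Types x y z : hil.

Lemma hilDE x y k : (x + y) k = x k + y k. Proof. by []. Qed.
Lemma hilZE (a : C) x k : (a *: x) k = a * x k. Proof. by []. Qed.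
Lemma hilNE x k : (- x) k = - x k. Proof. by []. Qed.
Lemma hil0E k : (0 : hil) k = 0. Proof. by []. Qed.

Definition dot x y : C := cinner x y.
Definition nrm x : R := vnorm x.

Lemma dotE x y : cinner x y = dot x y. Proof. by []. Qed.
Lemma nrmE x : vnorm x = nrm x. Proof. by []. Qed.

Lemma dot_summable x y :
  summable (fun k => complex.Re (x k * (y k)^*)) /\
  summable (fun k => complex.Im (x k * (y k)^*)).
Proof.
have s := summableD (l2_summable (hil_l2 x)) (l2_summable (hil_l2 y)).
have b k : cabs (x k * (y k)^*) <= csq (x k) + csq (y k).
  rewrite cabsM cabs_conj -!sqr_cabs.
  have := sqr_ge0 (cabs (x k) - cabs (y k)).
  have := sqr_ge0 (cabs (x k)); have := sqr_ge0 (cabs (y k)); nra.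
split; apply: summable_le s => k; apply: le_trans (b k).
- case: (ler0P (complex.Re _)) => _; last exact: Re_le_cabs.
  rewrite -cabsN; apply: le_trans (Re_le_cabs _).
  by case: (_ * _).
- case: (ler0P (complex.Im _)) => _; last exact: Im_le_cabs.
  rewrite -cabsN; apply: le_trans (Im_le_cabs _).
  by case: (_ * _).
Qed.

Lemma dotPl (a : C) x y z : dot (a *: x + y) z = a * dot x z + dot y z.
Proof.
have [xR xI] := dot_summable x z; have [yR yI] := dot_summable y z.
have lin (c d : R) u v w : summable u -> summable v -> summable w ->
    rsum (fun k => c * u k + d * v k + w k) = c * rsum u + d * rsum v + rsum w.
  move=> su sv sw; have cu : summable (fun k => c * u k) by exact: summableZ.
  have dv : summable (fun k => d * v k) by exact: summableZ.
  by rewrite (rsumD (summableD cu dv) sw) (rsumD cu dv) !rsumZ.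
have e : hval (a *: x + y) = (fun k => a * x k + y k) by [].
rewrite /dot /cinner e {e}; case: a => a b; apply/eqP; rewrite eq_complex /=.
apply/andP; split; apply/eqP.
  rewrite -mulNr -lin //; congr rsum; apply/funext => k.
  by move: (x k) (y k) (z k) => [x1 x2] [y1 y2] [z1 z2] /=; ring.
rewrite -lin //; congr rsum; apply/funext => k.
by move: (x k) (y k) (z k) => [x1 x2] [y1 y2] [z1 z2] /=; ring.
Qed.

Lemma dotC x y : dot y x = (dot x y)^*.
Proof.
have [xR xI] := dot_summable x y.
rewrite /dot /cinner; apply/eqP; rewrite eq_complex /=.
rewrite -mulN1r -rsumZ //.
apply/andP; split; apply/eqP; congr rsum; apply/funext => k.
  by move: (x k) (y k) => [x1 x2] [y1 y2] /=; ring.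
by move: (x k) (y k) => [x1 x2] [y1 y2] /=; ring.
Qed.

Lemma dotDl x y z : dot (x + y) z = dot x z + dot y z.
Proof. by rewrite -[x in LHS]scale1r dotPl mul1r. Qed.

Lemma dot0l x : dot 0 x = 0.
Proof. by apply: (addrI (dot 0 x)); rewrite -dotDl !addr0. Qed.

Lemma dotZl a x z : dot (a *: x) z = a * dot x z.
Proof. by rewrite -[a *: x]addr0 dotPl dot0l addr0. Qed.

Lemma dotDr x y z : dot x (y + z) = dot x y + dot x z.
Proof. by rewrite dotC dotDl rmorphD /= -!dotC. Qed.

Lemma dotZr a x z : dot x (a *: z) = a^* * dot x z.
Proof. by rewrite dotC dotZl rmorphM /= -!dotC. Qed.

Lemma dot0r x : dot x 0 = 0.
Proof. by rewrite dotC dot0l rmorph0. Qed.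

Lemma dotNl x y : dot (- x) y = - dot x y.
Proof. by rewrite -scaleN1r dotZl mulN1r. Qed.

Lemma dotBl x y z : dot (x - y) z = dot x z - dot y z.
Proof. by rewrite dotDl dotNl. Qed.

Lemma dot_suml (I : Type) (s : seq I) (P : pred I) (F : I -> hil) y :
  dot (\sum_(i <- s | P i) F i) y = \sum_(i <- s | P i) dot (F i) y.
Proof. by apply: (big_morph (dot^~ y)) => [u v|]; rewrite ?dotDl ?dot0l. Qed.

Lemma dot_sumr (I : Type) (s : seq I) (P : pred I) (F : I -> hil) y :
  dot y (\sum_(i <- s | P i) F i) = \sum_(i <- s | P i) dot y (F i).
Proof. by apply: (big_morph (dot y)) => [u v|]; rewrite ?dotDr ?dot0r. Qed.

Lemma nrm_ge0 x : 0 <= nrm x.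
Proof. exact: sqrtr_ge0. Qed.

Lemma sqr_nrm x : nrm x ^+ 2 = rsum (fun k => csq (x k)).
Proof.
rewrite sqr_sqrtr //; have s := l2_summable (hil_l2 x).
apply: le_trans (rsum_ge 0 _ s); first by rewrite big_ord0.
by move=> k; apply: csq_ge0.
Qed.

Lemma dotxx x : dot x x = (nrm x ^+ 2)%:C%C.
Proof.
rewrite sqr_nrm /dot /cinner; apply/eqP; rewrite eq_complex /=.
apply/andP; split; apply/eqP; first congr rsum.
  by apply/funext => k; rewrite mul_conj.
transitivity (rsum (fun k => 0 * csq (x k))).
  by congr rsum; apply/funext => k; rewrite mul_conj mul0r.
by rewrite rsumZ ?mul0r //; exact/l2_summable/hil_l2.
Qed.

Lemma csq_le_nrm x (n : nat) : \sum_(k < n) csq (x k) <= nrm x ^+ 2.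
Proof.
rewrite sqr_nrm; apply: rsum_ge; first by move=> k; apply: csq_ge0.
exact/l2_summable/hil_l2.
Qed.

Lemma nrm_eq0 x : (nrm x == 0) = (x == 0).
Proof.
apply/eqP/eqP => [x0|->]; last first.
  by apply/eqP; rewrite -sqrf_eq0 -(inj_eq (@complexI R)) -dotxx dot0l.
apply: hilP => k; apply/eqP; rewrite -csq_eq0 eq_le csq_ge0 andbT.
have := csq_le_nrm x k.+1; rewrite x0 expr0n big_ord_recr /=.
by apply: le_trans; rewrite lerDr sumr_ge0 // => i _; apply: csq_ge0.
Qed.

Lemma nrm0 : nrm 0 = 0.
Proof. by apply/eqP; rewrite nrm_eq0. Qed.

Lemma nrm_gt0 x : (0 < nrm x) = (x != 0).
Proof. by rewrite lt_def nrm_ge0 nrm_eq0 andbT. Qed.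

Lemma nrmZ a x : nrm (a *: x) = cabs a * nrm x.
Proof.
apply/eqP; rewrite -(@eqrXn2 _ 2) ?mulr_ge0 ?nrm_ge0 ?cabs_ge0 //.
rewrite -(inj_eq (@complexI R)) -dotxx dotZl dotZr mulrA mul_conj dotxx.
by rewrite -rmorphM exprMn sqr_cabs.
Qed.

Lemma nrmN x : nrm (- x) = nrm x.
Proof. by rewrite -scaleN1r nrmZ cabsN /cabs /csq /= expr1n expr0n addr0 sqrtr1 mul1r. Qed.

End Hilbert.
Global Opaque dot nrm.

(* Discriminant of [t |-> q (y - t z^* x) (y - t z^* x)] for [z = q x y]. *)
Lemma cauchy_schwarz_form (R : realType) (V : lmodType R[i]) (q : V -> V -> R[i])
    (x y : V) :
  (forall a u v w, q (a *: u + v) w = a * q u w + q v w) ->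
  (forall u v, q v u = (q u v)^*) ->
  (forall a, 0 <= q (a *: x + y) (a *: x + y)) -> 0 <= q x x ->
  csq (q x y) <= complex.Re (q x x) * complex.Re (q y y).
Proof.
move=> ql qC q0 qx0.
have qr a u v w : q u (a *: v + w) = a^* * q u v + q u w.
  by rewrite qC ql rmorphD rmorphM /= -!qC.
have /complex_realP [X eX] : q x x \is Num.real by rewrite ger0_real.
have /complex_realP [Y eY] : q y y \is Num.real.
  by have := q0 0; rewrite scale0r add0r => /ger0_real.
have P (t : R) : 0 <= t ^+ 2 * csq (q x y) * X - 2 * t * csq (q x y) + Y.
  have := q0 (- t%:C%C * (q x y)^*); rewrite ql !qr eX eY.
  have -> : q y x = (q x y)^* by rewrite qC.
  set z := q x y; set w := (X in 0 <= X).
  suff -> : w = (t ^+ 2 * csq z * X - 2 * t * csq z + Y)%:C%C by rewrite ler0c.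
  rewrite {}/w.
  case: z => a b; apply/eqP; rewrite eq_complex /= /csq /=.
  by apply/andP; split; apply/eqP; ring.
rewrite eX eY /=; have X0 : 0 <= X by rewrite -ler0c -eX.
have c0 := csq_ge0 (q x y).
(* For [X = 0] the polynomial is affine in [t], and the chosen [t] makes it negative unless its
   slope vanishes. Otherwise its minimum is at [t = X^-1]. *)
have [X00|Xn0] := eqVneq X 0.
  rewrite X00 mul0r leNgt; apply/negP => cp.
  have := P ((Y + 1) / csq (q x y)); rewrite X00 mulr0 add0r -mulrA.
  rewrite divfK ?gt_eqF //.
  have : 0 <= Y by have := P 0; rewrite X00; lra.
  lra.
have := P X^-1; have Xp : 0 < X by rewrite lt_def Xn0.
rewrite (_ : _ + Y = Y - csq (q x y) / X); last by field.
by rewrite subr_ge0 ler_pdivrMr // mulrC.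
Qed.

(** * Norm inequalities *)

Section HilbertNorm.
Variable R : realType.
Implicit Types x y z : hil R.

Lemma dot_CS x y : cabs (dot x y) <= nrm x * nrm y.
Proof.
rewrite -(@ler_pXn2r _ 2) ?nnegrE ?mulr_ge0 ?cabs_ge0 ?nrm_ge0 //.
rewrite sqr_cabs exprMn.
have := @cauchy_schwarz_form R _ (@dot R) x y (@dotPl R) (@dotC R).
rewrite !dotxx /=; apply=> [a|]; last by rewrite ler0c sqr_ge0.
by rewrite dotxx ler0c sqr_ge0.
Qed.

Lemma nrmD x y : nrm (x + y) <= nrm x + nrm y.
Proof.
rewrite -(@ler_pXn2r _ 2) ?nnegrE ?addr_ge0 ?nrm_ge0 //.
have /(congr1 (@complex.Re R)) := dotxx (x + y).
rewrite dotDl !dotDr !dotxx /= => <-.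
have h1 := le_trans (Re_le_cabs _) (dot_CS x y).
have h2 := le_trans (Re_le_cabs _) (dot_CS y x).
move: h1 h2; move: (dot x y) (dot y x) => [a b] [c d] /=; lra.
Qed.

Lemma nrmB x y : nrm (x - y) <= nrm x + nrm y.
Proof. by rewrite -(nrmN y) nrmD. Qed.

Lemma nrm_sum (I : Type) (s : seq I) (P : pred I) (F : I -> hil R) :
  nrm (\sum_(i <- s | P i) F i) <= \sum_(i <- s | P i) nrm (F i).
Proof.
elim/big_rec2: _ => [|i a b _ h]; first by rewrite nrm0.
by apply: le_trans (nrmD _ _) _; rewrite lerD2l.
Qed.

Lemma nrm_pythagoras x y : dot x y = 0 -> nrm (x + y) ^+ 2 = nrm x ^+ 2 + nrm y ^+ 2.
Proof.
move=> xy; apply: (@complexI R).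
rewrite -dotxx dotDl !dotDr (dotC x y) xy rmorph0 addr0 add0r.
by rewrite !dotxx -rmorphD.
Qed.

Lemma nrm_le_dot x (c : R) : 0 <= c -> (forall y, cabs (dot x y) <= c * nrm y) -> nrm x <= c.
Proof.
move=> c0 /(_ x); rewrite dotxx cabs_real ger0_norm ?sqr_ge0 // expr2.
have [->|xn0] := eqVneq x 0; first by rewrite nrm0.
by rewrite ler_pM2r // nrm_gt0.
Qed.

End HilbertNorm.

(** * Finite orthonormal families, projections and traces over them *)

Section Orthonormal.
Variable R : realType.
Local Notation C := R[i].
Local Notation H := (hil R).
Implicit Types (x y : H) (es fs vs : seq H).

(** Since the list is [uniq], the Kronecker symbol can be the equality of the vectors themselves,
    without indices. *)
Definition onf es := uniq es /\ {in es &, forall e f, dot e f = (e == f)%:R}.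
Definition perp es x := forall e, e \in es -> dot x e = 0.
Definition proj es x : H := \sum_(e <- es) dot x e *: e.

Lemma onf_nrm es e : onf es -> e \in es -> nrm e = 1.
Proof.
move=> [_ o] ee; apply/eqP; rewrite -(@eqrXn2 _ 2) ?nrm_ge0 // expr1n.
by rewrite -(inj_eq (@complexI R)) -dotxx o // eqxx.
Qed.

Lemma perp_cat es fs x : perp (es ++ fs) x <-> perp es x /\ perp fs x.
Proof.
split=> [p|[pe pf] e]; last by rewrite mem_cat => /orP[/pe|/pf].
by split=> e ee; apply: p; rewrite mem_cat ee ?orbT.
Qed.

Lemma perpP es a x y : perp es x -> perp es y -> perp es (a *: x + y).
Proof. by move=> px py e ee; rewrite dotPl px // py // mulr0 addr0. Qed.

Lemma projP es a x y : proj es (a *: x + y) = a *: proj es x + proj es y.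
Proof.
rewrite /proj scaler_sumr -big_split; apply: eq_bigr => e _.
by rewrite dotPl scalerDl scalerA.
Qed.

Lemma dot_proj es x e : onf es -> e \in es -> dot (proj es x) e = dot x e.
Proof.
move=> [u o] ee; rewrite /proj dot_suml (bigD1_seq e) //= dotZl (o e e) // eqxx mulr1.
rewrite big_seq_cond big1 ?addr0 // => f /andP[fe ne].
by rewrite dotZl (o f e) // (negbTE ne) mulr0.
Qed.

Lemma perp_subproj es x : onf es -> perp es (x - proj es x).
Proof. by move=> o e ee; rewrite dotBl dot_proj // subrr. Qed.

Lemma proj_perp es x : perp es x -> proj es x = 0.
Proof. by move=> p; rewrite /proj big_seq big1 // => e /p ->; rewrite scale0r. Qed.

Lemma dot_proj_perp es x y : perp es y -> dot (proj es x) y = 0.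
Proof.
move=> p; rewrite /proj dot_suml big_seq big1 // => e ee.
by rewrite dotZl (dotC y e) p // rmorph0 mulr0.
Qed.

Lemma projC es x y : dot (proj es x) y = dot x (proj es y).
Proof.
rewrite /proj dot_suml dot_sumr; apply: eq_bigr => e _.
by rewrite dotZl dotZr -dotC mulrC.
Qed.

Lemma proj_id es x : onf es -> proj es (proj es x) = proj es x.
Proof.
move=> o; rewrite {1}/proj [RHS]/proj; apply: eq_big_seq => e ee.
by rewrite dot_proj.
Qed.

Lemma nrm_proj_eq es x : onf es ->
  nrm x ^+ 2 = nrm (proj es x) ^+ 2 + nrm (x - proj es x) ^+ 2.
Proof.
move=> o; rewrite -nrm_pythagoras; first by rewrite addrC subrK.
exact/dot_proj_perp/perp_subproj.
Qed.

Lemma nrm_proj es x : onf es -> nrm (proj es x) <= nrm x.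
Proof.
move=> o; rewrite -(@ler_pXn2r _ 2) ?nnegrE ?nrm_ge0 //.
by rewrite (nrm_proj_eq x o) lerDl sqr_ge0.
Qed.

Lemma nrm_subproj es x : onf es -> nrm (x - proj es x) <= nrm x.
Proof.
move=> o; rewrite -(@ler_pXn2r _ 2) ?nnegrE ?nrm_ge0 //.
by rewrite (nrm_proj_eq x o) lerDr sqr_ge0.
Qed.

Lemma dot_proj_self es x : onf es -> dot (proj es x) x = (nrm (proj es x) ^+ 2)%:C%C.
Proof. by move=> o; rewrite -dotxx -projC proj_id. Qed.

Lemma onf_nil : onf [::].
Proof. by []. Qed.

Lemma onf_cons es e : onf es -> perp es e -> nrm e = 1 -> onf (e :: es).
Proof.
move=> [u o] p ne.
have ee : e \notin es.
  apply/negP => /p; rewrite dotxx ne expr1n => /eqP.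
  by rewrite (inj_eq (@complexI R) 1 0) oner_eq0.
split=> [|f g]; first by rewrite /= ee.
have d1 : dot e e = 1 by rewrite dotxx ne expr1n.
rewrite !inE => /orP[/eqP->|fe] /orP[/eqP->|ge].
- by rewrite eqxx.
- by rewrite p //; case: eqP ee => // ->; rewrite ge.
- by rewrite dotC p // rmorph0; case: eqP ee => // <-; rewrite fe.
- exact: o.
Qed.

(** Spans are not formed: the last clause is the way of saying that [es] spans at least [vs]. A
    vector already in the span is dropped, so the size can only shrink. *)
Lemma gram_schmidt vs : exists es, [/\ onf es, (size es <= size vs)%N &
  forall x, perp es x -> perp vs x].
Proof.
elim: vs => [|v vs [es [oe s p]]]; first by exists [::]; split.
set r := v - proj es v.
have pr x : perp es x -> dot x r = 0 -> perp (v :: vs) x.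
  move=> px xr e; rewrite inE => /orP[/eqP->|/(p _ px) //].
  have -> : dot x v = dot x r + dot x (proj es v) by rewrite -dotDr subrK.
  by rewrite xr (dotC (proj es v)) dot_proj_perp ?rmorph0 ?addr0.
have [r0|rn0] := eqVneq r 0.
  exists es; split=> //; first exact: leqW.
  by move=> x px; apply: pr => //; rewrite r0 dot0r.
have nr : nrm r != 0 by rewrite nrm_eq0.
exists ((nrm r)^-1%:C%C *: r :: es); split=> //.
- apply: onf_cons => //; last first.
    by rewrite nrmZ cabs_real normfV ger0_norm ?nrm_ge0 // mulVf.
  by move=> e ee; rewrite dotZl perp_subproj ?mulr0.
- move=> x px; apply: pr; first by move=> e ee; apply: px; rewrite inE ee orbT.
  have := px _ (mem_head _ _); rewrite dotZr => /eqP; rewrite mulf_eq0 => /orP[|/eqP //].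
  by rewrite conjC_eq0 (inj_eq (@complexI R) _ 0) invr_eq0 (negbTE nr).
Qed.

Definition lin (T : H -> H) := forall a x y, T (a *: x + y) = a *: T x + T y.

Section Lin.
Variables (T : H -> H) (lT : lin T).

Lemma lin0 : T 0 = 0.
Proof.
have := lT 1 0 0; rewrite scaler0 addr0 scale1r => /eqP.
by rewrite addrC -subr_eq subrr eq_sym => /eqP.
Qed.

Lemma linZ a x : T (a *: x) = a *: T x.
Proof. by have := lT a x 0; rewrite addr0 lin0 addr0. Qed.

Lemma linD x y : T (x + y) = T x + T y.
Proof. by have := lT 1 x y; rewrite !scale1r. Qed.

Lemma linN x : T (- x) = - T x.
Proof. by rewrite -scaleN1r linZ scaleN1r. Qed.

Lemma linB x y : T (x - y) = T x - T y.
Proof. by rewrite linD linN. Qed.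

Lemma lin_sum (I : Type) (s : seq I) (P : pred I) (F : I -> H) :
  T (\sum_(i <- s | P i) F i) = \sum_(i <- s | P i) T (F i).
Proof. by apply: (big_morph T) => [u v|]; rewrite ?linD ?lin0. Qed.
End Lin.

(** The second bound is the norm of the adjoint on [x], written through [dot] so that it makes sense
    before adjoints exist. *)
Definition small2 es (d : R) (T : H -> H) := forall x, perp es x ->
  nrm (T x) <= d * nrm x /\ forall y, cabs (dot (T y) x) <= d * nrm y * nrm x.

Definition tr (T : H -> H) es : C := \sum_(e <- es) dot (T e) e.

Lemma cabs_sum_le (s : seq H) (F : H -> C) (d : R) :
  (forall e, e \in s -> cabs (F e) <= d) -> cabs (\sum_(e <- s) F e) <= d * (size s)%:R.
Proof.
move=> Fd; apply: le_trans (cabs_sum _ _ _) _; rewrite big_seq.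
apply: (@le_trans _ _ (\sum_(e <- s | e \in s) d)); first exact: ler_sum.
by rewrite -big_seq big_const_seq count_predT iter_addr addr0 mulr_natr.
Qed.

(* [Tr(TP) - Tr(TQ) = Tr((1 - Q)TP) - Tr(T(1 - P)Q)] for the projections P and Q. *)
Lemma tr_compare T es fs d : lin T -> 0 <= d -> onf es -> onf fs ->
  small2 es d T -> small2 fs d T ->
  cabs (tr T es - tr T fs) <= d * (size es + size fs)%:R.
Proof.
move=> lT d0 oe of_ se sf.
have -> : tr T es - tr T fs = \sum_(e <- es) dot (T e) (e - proj fs e)
    - \sum_(f <- fs) dot (T (f - proj es f)) f.
  have -> : tr T es = \sum_(e <- es) dot (T e) (e - proj fs e)
      + \sum_(e <- es) dot (T e) (proj fs e).
    by rewrite -big_split; apply: eq_bigr => e _; rewrite /= -dotDr subrK.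
  have -> : tr T fs = \sum_(f <- fs) dot (T (f - proj es f)) f
      + \sum_(f <- fs) dot (T (proj es f)) f.
    by rewrite -big_split; apply: eq_bigr => f _; rewrite /= -dotDl -linD // subrK.
  (* What remains is [Tr(TPQ)] on one side and [Tr(QTP)] on the other; cyclicity is an exchange of
     two finite sums. *)
  rewrite (_ : \sum_(f <- fs) dot (T (proj es f)) f = \sum_(e <- es) dot (T e) (proj fs e)).
    by rewrite opprD addrACA subrr addr0.
  transitivity (\sum_(f <- fs) \sum_(e <- es) dot f e * dot (T e) f).
    apply: eq_bigr => f _; rewrite lin_sum // dot_suml.
    by apply: eq_bigr => e _; rewrite linZ // dotZl.
  rewrite exchange_big; apply: eq_bigr => e _; rewrite dot_sumr.
  by apply: eq_bigr => f _; rewrite dotZr -dotC.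
apply: le_trans (cabsB _ _) _; rewrite natrD mulrDr lerD //.
- apply: cabs_sum_le => e ee; have [_ /(_ e) h] := sf _ (perp_subproj e of_).
  apply: le_trans h _; rewrite (onf_nrm oe ee) mulr1 ler_piMr //.
  by apply: le_trans (nrm_subproj _ of_) _; rewrite (onf_nrm oe ee).
- apply: cabs_sum_le => f ff; have [h _] := se _ (perp_subproj f oe).
  apply: le_trans (dot_CS _ _) _; rewrite (onf_nrm of_ ff) mulr1.
  apply: le_trans h _; rewrite ler_piMr //.
  by apply: le_trans (nrm_subproj _ oe) _; rewrite (onf_nrm of_ ff).
Qed.

End Orthonormal.

(** * Bounded operators and their singular values *)

Section Operators.
Variable R : realType.
Local Notation C := R[i].
Local Notation H := (hil R).
Implicit Types (x y : H) (T S : H -> H).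

Definition blin T := lin T /\ exists M, forall x, nrm (T x) <= M * nrm x.

(** Extension by zero outside [l2] is the canonical representative that [bounded_op] asks for, so
    equality of operators reduces to equality on [hil]. *)
Definition mkop T : op R :=
  fun x : vec R => if pselect (l2 x) is left h then hval (T (mkhil h)) else fun _ => 0.

Lemma mkop_hil T x : mkop T x = T x.
Proof.
rewrite /mkop; case: pselect => [h|/(_ (hil_l2 x)) //].
by congr (hval (T _)); apply: val_inj.
Qed.

Lemma l2_hil (x : vec R) : l2 x -> exists y : H, x = y.
Proof. by move=> h; exists (mkhil h). Qed.

Lemma blin_bound T : blin T -> exists M, 0 <= M /\ forall x, nrm (T x) <= M * nrm x.
Proof.
move=> [_ [M TM]]; exists (Num.max M 0); split; first by rewrite le_max lexx orbT.
by move=> x; apply: le_trans (TM x) _; rewrite ler_wpM2r ?nrm_ge0 // le_max lexx.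
Qed.

Lemma bounded_mkop T : blin T -> bounded_op (mkop T).
Proof.
move=> [lT [M TM]]; split.
- by move=> x nx; rewrite /mkop; case: pselect.
- by move=> x /l2_hil[y ->]; rewrite mkop_hil; exact: hil_l2.
- move=> a x y /l2_hil[{}x ->] /l2_hil[{}y ->].
  have -> : (fun k => a * x k + y k) = hval (a *: x + y) by [].
  by rewrite !mkop_hil lT.
- by exists M => x /l2_hil[{}x ->]; rewrite mkop_hil !nrmE.
Qed.

Lemma bounded_opP (A : op R) : bounded_op A -> exists2 T, blin T & A = mkop T.
Proof.
move=> [A0 Al Alin [M AM]].
pose T (x : H) : H := mkhil (Al x (hil_l2 x)).
have TE x : hval (T x) = A x by [].
exists T; last first.
  apply/funext => x; rewrite /mkop; case: pselect => [h|/A0 //].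
  by rewrite TE.
split; last by exists M => x; rewrite -!nrmE TE; apply: AM; exact: hil_l2.
move=> a x y; apply: val_inj; exact: (Alin a x y (hil_l2 x) (hil_l2 y)).
Qed.

Lemma mkop_inj T S : mkop T = mkop S -> T = S.
Proof.
by move=> e; apply/funext => x; apply: val_inj; rewrite /= -!mkop_hil e.
Qed.

Lemma opcomb_mkop a T S : opcomb a (mkop T) (mkop S) = mkop (fun x => a *: T x + S x).
Proof.
apply/funext => x; rewrite /opcomb /mkop; case: pselect => // h.
by apply/funext => k; rewrite mulr0 addr0.
Qed.

Lemma opsub_mkop T S : opsub (mkop T) (mkop S) = mkop (fun x => T x - S x).
Proof.
apply/funext => x; rewrite /opsub /mkop; case: pselect => // h.
by apply/funext => k; rewrite subr0.
Qed.

Lemma comp_mkop T S : lin T -> mkop T \o mkop S = mkop (T \o S).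
Proof.
move=> lT; apply/funext => x /=; rewrite [mkop S x]/mkop [RHS]/mkop.
case: pselect => h; first by rewrite mkop_hil.
by have -> : (fun _ : nat => (0 : C)) = hval (0 : H) by []; rewrite mkop_hil lin0.
Qed.

Lemma lin_comb a T S : lin T -> lin S -> lin (fun x => a *: T x + S x).
Proof.
move=> lT lS b x y; rewrite lT lS !scalerDr !scalerA addrACA.
by rewrite [a * b]mulrC.
Qed.

Lemma blin_comb a T S : blin T -> blin S -> blin (fun x => a *: T x + S x).
Proof.
move=> [lT [M TM]] [lS [N SN]]; split; first exact: lin_comb.
exists (cabs a * M + N) => x; apply: le_trans (nrmD _ _) _.
by rewrite mulrDl nrmZ lerD // -mulrA ler_wpM2l ?cabs_ge0.
Qed.

Lemma blin_sub T S : blin T -> blin S -> blin (fun x => T x - S x).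
Proof.
move=> bT bS; rewrite (_ : (fun x => _) = (fun x => (-1) *: S x + T x)).
  exact: blin_comb.
by apply/funext => x; rewrite scaleN1r addrC.
Qed.

Lemma blin_comp T S : blin T -> blin S -> blin (T \o S).
Proof.
move=> bT [lS [N SN]]; have [M [M0 TM]] := blin_bound bT; have [lT _] := bT.
split; first by move=> a x y /=; rewrite lS lT.
by exists (M * N) => x /=; apply: le_trans (TM _) _; rewrite -mulrA ler_wpM2l.
Qed.

Lemma blin_proj es : onf es -> blin (@proj R es).
Proof.
move=> o; split; first by move=> a x y; exact: projP.
by exists 1 => x; rewrite mul1r nrm_proj.
Qed.

Lemma blin0 : blin (fun=> 0).
Proof.
split; first by move=> a x y; rewrite scaler0 addr0.
by exists 0 => x; rewrite nrm0 mul0r.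
Qed.

Lemma opnorm_le T d : 0 <= d -> (forall x, nrm (T x) <= d * nrm x) -> opnorm (mkop T) <= d.
Proof.
move=> d0 Td; apply: ge_sup.
  exists (vnorm (mkop T (0 : H))), (0 : H) => //; split; first exact: hil_l2.
  by rewrite nrmE nrm0.
move=> _ [x [/l2_hil[{}x ->] x1] <-]; rewrite mkop_hil nrmE.
by apply: le_trans (Td x) _; rewrite ler_piMr.
Qed.

Lemma opnormP T x : blin T -> nrm (T x) <= opnorm (mkop T) * nrm x.
Proof.
move=> bT; have [M [M0 TM]] := blin_bound bT; have [lT _] := bT.
have [->|xn0] := eqVneq x 0; first by rewrite lin0 // nrm0 mulr0.
have nx : 0 < nrm x by rewrite nrm_gt0.
rewrite -ler_pdivrMr //; apply: ub_le_sup.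
  exists M => _ [y [/l2_hil[{}y ->] y1] <-]; rewrite mkop_hil nrmE.
  by apply: le_trans (TM y) _; rewrite ler_piMr.
have ny : cabs (nrm x)^-1%:C%C = (nrm x)^-1.
  by rewrite cabs_real ger0_norm // invr_ge0 ltW.
exists ((nrm x)^-1%:C%C *: x : H).
  split; first exact: hil_l2.
  by rewrite nrmE nrmZ ny mulVf ?gt_eqF.
by rewrite mkop_hil nrmE linZ // nrmZ ny mulrC.
Qed.

Lemma opnorm_ge0 T : blin T -> 0 <= opnorm (mkop T).
Proof.
move=> bT; have [M [M0 TM]] := blin_bound bT; apply: ub_le_sup.
  exists M => _ [y [/l2_hil[{}y ->] y1] <-]; rewrite mkop_hil nrmE.
  by apply: le_trans (TM y) _; rewrite ler_piMr.
exists (0 : H); first by split; [exact: hil_l2|rewrite nrmE nrm0].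
by rewrite mkop_hil nrmE lin0 ?nrm0 //; case: bT.
Qed.

Lemma rank_le0 n : rank_le (mkop (fun=> 0)) n.
Proof.
exists (fun=> (0 : H)) => _ /l2_hil[x ->]; exists (fun=> 0); rewrite mkop_hil.
by apply/funext => k; rewrite big1 // => i _; rewrite mul0r.
Qed.

Lemma smu_set_ge0 n T (r : R) : blin T ->
  [set opnorm (opsub (mkop T) F) | F in [set F | bounded_op F /\ rank_le F n]] r -> 0 <= r.
Proof.
move=> bT [_ [/bounded_opP[S bS ->] _] <-]; rewrite opsub_mkop.
by apply: opnorm_ge0; exact: blin_sub.
Qed.

Lemma smu_le n T S d : blin T -> blin S -> rank_le (mkop S) n -> 0 <= d ->
  (forall x, nrm (T x - S x) <= d * nrm x) -> smu n (mkop T) <= d.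
Proof.
move=> bT bS rS d0 TS.
apply: (@le_trans _ _ (opnorm (mkop (fun x => T x - S x)))); last exact: opnorm_le.
apply: ge_inf; first by exists 0 => r; exact: smu_set_ge0.
exists (mkop S); last by rewrite opsub_mkop.
by split=> //; exact: bounded_mkop.
Qed.

Lemma smu_set_neq0 n T : 
  [set opnorm (opsub (mkop T) F) | F in [set F | bounded_op F /\ rank_le F n]] !=set0.
Proof.
exists (opnorm (opsub (mkop T) (mkop (fun=> 0)))), (mkop (fun=> 0)) => //.
by split; [exact/bounded_mkop/blin0|exact: rank_le0].
Qed.

Lemma smu_ge0 n T : blin T -> 0 <= smu n (mkop T).
Proof. by move=> bT; apply: lb_le_inf => [|r]; [exact: smu_set_neq0|exact: smu_set_ge0]. Qed.

Lemma smu_lt n T d : blin T -> smu n (mkop T) < d -> exists S,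
  [/\ blin S, rank_le (mkop S) n & forall x, nrm (T x - S x) <= d * nrm x].
Proof.
move=> bT /inf_lt => /(_ (smu_set_neq0 n T)) [_ [_ [/bounded_opP[S bS ->] rS] <-]].
rewrite opsub_mkop => lt_d.
exists S; split=> // x; apply: le_trans (opnormP x (blin_sub bT bS)) _.
by rewrite ler_wpM2r ?nrm_ge0 // ltW.
Qed.

Lemma rank_le_comp_proj T es n : lin T -> (size es <= n)%N -> rank_le (mkop (T \o proj es)) n.
Proof.
move=> lT sn; exists (fun i => T (nth 0 es i)) => _ /l2_hil[x ->].
exists (fun i => dot x (nth 0 es i)); rewrite mkop_hil /= lin_sum //.
(* A family shorter than [n] is padded by the default value [0] of [nth]. *)
have -> : \sum_(e <- es) T (dot x e *: e) =
    \sum_(i < n) dot x (nth 0 es i) *: T (nth 0 es i).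
  rewrite (big_nth 0) big_mkord (big_ord_widen n (fun i => T (dot x (nth 0 es i) *: nth 0 es i))) //.
  rewrite big_mkcond; apply: eq_bigr => i _; case: ltnP => h; first by rewrite linZ.
  by rewrite nth_default // dot0r scale0r.
by apply/funext => k; elim/big_rec2: _ => // i y z _ <-.
Qed.

(** The competitor of rank at most [n] is [T P] for the projection [P] on [es], since
    [T - T P = T (1 - P)]. *)
Lemma smu_le_perp n T es d : blin T -> onf es -> (size es <= n)%N -> 0 <= d ->
  (forall x, perp es x -> nrm (T x) <= d * nrm x) -> smu n (mkop T) <= d.
Proof.
move=> bT oe sn d0 Td; have [lT _] := bT.
apply: (@smu_le n T (T \o proj es)) => //.
- by apply: blin_comp => //; exact: blin_proj.
- exact: rank_le_comp_proj.
- move=> x /=; rewrite -linB //; apply: le_trans (Td _ (perp_subproj x oe)) _.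
  by rewrite ler_wpM2l // nrm_subproj.
Qed.

(** The [n + 1] rows of coefficients live in dimension [n], so their matrix has a nonzero left
    kernel vector. *)
Lemma rank_le_dependent S n (u : 'I_n.+1 -> H) : rank_le (mkop S) n ->
  exists2 a : 'rV[C]_n.+1, a != 0 & \sum_i a 0 i *: S (u i) = 0.
Proof.
move=> [v Sv].
have /choice [c Sc] : forall i, exists c : 'I_n -> C,
    hval (S (u i)) = (fun k => \sum_(j < n) c j * v j k).
  by move=> i; have [c] := Sv _ (hil_l2 (u i)); rewrite mkop_hil; exists c.
pose M := \matrix_(i < n.+1, j < n) c i j.
have kM : kermx M != 0.
  rewrite -mxrank_eq0 mxrank_ker subn_eq0 -ltnNge.
  exact: leq_ltn_trans (rank_leq_col M) (ltnSn n).
exists (nz_row (kermx M)); first by rewrite nz_row_eq0.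
have aM : nz_row (kermx M) *m M = 0 by apply/sub_kermxP; exact: nz_row_sub.
move: (nz_row _) aM => a aM; apply: hilP => k; rewrite hil0E.
transitivity (\sum_i a 0 i * S (u i) k).
  by elim/big_rec2: _ => // i y z _ <-.
under eq_bigr do rewrite Sc mulr_sumr.
rewrite exchange_big big1 //= => j _.
under eq_bigr do rewrite mulrA; rewrite -mulr_suml.
have /matrixP/(_ 0 j) := aM; rewrite !mxE => e.
rewrite [X in X * _](_ : _ = 0) ?mul0r // -[RHS]e.
by apply: eq_bigr => i _; rewrite !mxE.
Qed.

Lemma dot_comb_nth es n (a : 'I_n -> C) (j : 'I_n) : onf es -> size es = n ->
  dot (\sum_i a i *: nth 0 es i) (nth 0 es j) = a j.
Proof.
move=> [u o] sn; rewrite dot_suml (bigD1 j) //= dotZl o ?mem_nth ?sn //.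
rewrite eqxx mulr1 big1 ?addr0 // => i ij.
rewrite dotZl o ?mem_nth ?sn // nth_uniq ?sn //.
by rewrite (inj_eq val_inj) (negbTE ij) mulr0.
Qed.

Lemma proj_comb_nth es n (a : 'I_n -> C) : onf es -> size es = n ->
  proj es (\sum_i a i *: nth 0 es i) = \sum_i a i *: nth 0 es i.
Proof.
move=> o sn; rewrite {1}/proj (big_nth 0) big_mkord sn; apply: eq_bigr => i _.
by rewrite dot_comb_nth.
Qed.

(** Half of the min-max principle: an operator of rank [n] annihilates a nonzero vector in the
    [n + 1] dimensional span of [es], where [T] is bounded below. *)
Lemma smu_ge n T es d : blin T -> onf es -> size es = n.+1 ->
  (forall x, proj es x = x -> d * nrm x <= nrm (T x)) -> d <= smu n (mkop T).
Proof.
move=> bT oe sn Td; rewrite leNgt; apply/negP => lt_d.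
(* The midpoint of [smu n] and [d] leaves strict room on both sides, for the existence of [S] and
   for the final contradiction. *)
have [S [bS rS TS]] := smu_lt bT (midf_lt lt_d).1; have [lS _] := bS.
have [a an0 Sa] := rank_le_dependent (fun i : 'I_n.+1 => nth 0 es i) rS.
set x := \sum_i a 0 i *: nth 0 es i.
have xn0 : 0 < nrm x.
  rewrite nrm_gt0; apply: contra_neq an0 => x0; apply/rowP => j; rewrite mxE.
  by rewrite -(dot_comb_nth (fun i => a 0 i) j oe sn) -/x x0 dot0l.
have Sx : S x = 0.
  by rewrite lin_sum // -[RHS]Sa; apply: eq_bigr => i _; rewrite linZ.
have := TS x; rewrite Sx subr0 leNgt => /negP; apply.
apply: lt_le_trans (Td x (proj_comb_nth _ oe sn)).
by rewrite ltr_pM2r // (midf_lt lt_d).2.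
Qed.

(* The spanning vectors in [rank_le] need not be square summable, so an
   orthonormal family is grown inside the range of [S] until it spans it. *)
Lemma rank_le_onf S n : lin S -> rank_le (mkop S) n -> exists es, [/\ onf es,
  (size es <= n)%N & forall x, perp es x -> forall y, dot (S y) x = 0].
Proof.
move=> lS rS.
have step m : (exists es, [/\ onf es, size es = m & forall e, e \in es -> exists u, e = S u])
    \/ (exists es, [/\ onf es, (size es < m)%N &
                      forall x, perp es x -> forall y, dot (S y) x = 0]).
  elim: m => [|m [[es [oe sm eS]]|[es [oe sm pe]]]].
  - by left; exists [::]; split.
  - have [[y ny]|ny] := pselect (exists y, S y - proj es (S y) != 0); last first.
      right; exists es; split=> //; first by rewrite sm.
      move=> x px y; have -> : S y = proj es (S y); last exact: dot_proj_perp.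
      by apply/eqP; rewrite -subr_eq0; apply/negPn/negP => h; apply: ny; exists y.
    left; set r := _ - _ in ny.
    have [w rw] : exists w, r = S w.
      have /choice [u eu] : forall e, exists u, e \in es -> e = S u.
        move=> e; have [/eS[u ->]|ne] := boolP (e \in es); first by exists u.
        by exists 0.
      exists (y - \sum_(e <- es) dot (S y) e *: u e).
      rewrite linB // lin_sum //; congr (_ - _); apply: eq_big_seq => e ee.
      by rewrite linZ // -eu.
    have nr : nrm r != 0 by rewrite nrm_eq0.
    exists ((nrm r)^-1%:C%C *: r :: es); split=> /=; last 1 first.
    + move=> e; rewrite inE => /orP[/eqP->|/eS //].
      by exists ((nrm r)^-1%:C%C *: w); rewrite linZ // -rw.
    + apply: onf_cons => //; last first.
        by rewrite nrmZ cabs_real normfV ger0_norm ?nrm_ge0 // mulVf.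
      by move=> e ee; rewrite dotZl perp_subproj ?mulr0.
    + by rewrite sm.
  - by right; exists es; split=> //; exact: leqW.
(* The first case is impossible: [n + 1] orthonormal vectors of the form [S u] would be linearly
   dependent. *)
have [[es [oe sn eS]]|[es [oe sn pe]]] := step n.+1; last by exists es; split.
have /choice [u eu] : forall i : 'I_n.+1, exists u, nth 0 es i = S u.
  by move=> i; apply/eS/mem_nth; rewrite sn.
have [a an0 Sa] := rank_le_dependent u rS; case/negP: an0; apply/eqP/rowP => j.
rewrite mxE -(dot_comb_nth (fun i => a 0 i) j oe sn).
by under eq_bigr do rewrite eu; rewrite Sa dot0l.
Qed.

End Operators.

(** * The standard basis and infinite dimension *)

Section StandardBasis.
Variable R : realType.
Local Notation C := R[i].
Local Notation H := (hil R).

Lemma sum_delta (V : nmodType) (u : nat -> V) (k n : nat) :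
  \sum_(j < n) (if j == k :> nat then u j else 0) = if (k < n)%N then u k else 0.
Proof.
case: ltnP => h.
  rewrite (bigD1 (Ordinal h)) //= eqxx big1 ?addr0 // => i.
  by rewrite -(inj_eq val_inj) /= => /negbTE ->.
by rewrite big1 // => i _; rewrite ltn_eqF // (leq_trans (ltn_ord i)).
Qed.

Lemma rsum_delta (u : nat -> R) (k : nat) :
  rsum (fun j => if j == k then u j else 0) = u k.
Proof.
apply: cvg_lim => //; apply: (@cvg_near_cst _ R).
exists k.+1 => // n /= kn; rewrite sum_delta.
by rewrite /= in kn; rewrite kn.
Qed.

Lemma l2_delta (k : nat) : l2 (fun j => (j == k)%:R : C).
Proof.
exists 1 => n; rewrite (_ : \sum_(_ < _) _ = \sum_(j < n) (if j == k :> nat then 1 else 0)).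
  by rewrite (sum_delta (fun=> 1)); case: ifP.
by apply: eq_bigr => j _; case: eqP; rewrite /csq /= ?expr1n ?expr0n addr0.
Qed.

Definition delta k : H := mkhil (l2_delta k).

Lemma dot_delta (x : H) k : dot x (delta k) = x k.
Proof.
rewrite -dotE /cinner.
have e j : x j * ((delta k) j)^* = if j == k then x j else 0.
  by rewrite /= rmorph_nat; case: eqP; rewrite ?mulr1 ?mulr0.
apply/eqP; rewrite eq_complex; apply/andP; split; apply/eqP.
  rewrite -[RHS](rsum_delta (fun j => complex.Re (x j)) k) /=; congr rsum.
  by apply/funext => j; rewrite e; case: eqP.
rewrite -[RHS](rsum_delta (fun j => complex.Im (x j)) k) /=; congr rsum.
by apply/funext => j; rewrite e; case: eqP.
Qed.

Definition deltas n := [seq delta k | k <- iota 0 n].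

Lemma deltaE k j : delta k j = (j == k)%:R.
Proof. by []. Qed.

Lemma delta_inj : injective delta.
Proof.
move=> k j /(congr1 (fun x : H => x k)); rewrite !deltaE eqxx.
by case: eqP => // _ /eqP; rewrite oner_eq0.
Qed.

Lemma onf_deltas n : onf (deltas n).
Proof.
split; first by rewrite map_inj_uniq ?iota_uniq //; exact: delta_inj.
move=> _ _ /mapP[k _ ->] /mapP[j _ ->]; rewrite dot_delta deltaE.
by rewrite (inj_eq delta_inj) eq_sym.
Qed.

Lemma nrm_delta k : nrm (delta k) = 1.
Proof.
apply: (onf_nrm (onf_deltas k.+1)).
by apply/mapP; exists k => //; rewrite mem_iota ltnSn.
Qed.

Lemma size_deltas n : size (deltas n) = n.
Proof. by rewrite size_map size_iota. Qed.

Lemma proj_deltas n (x : H) : proj (deltas n) x = \sum_(k < n) x k *: delta k.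
Proof.
rewrite /proj big_map -{1}[n]subn0 -/(index_iota 0 n) big_mkord.
by apply: eq_bigr => k _; rewrite dot_delta.
Qed.

Lemma nrm_comb_delta n (c : nat -> C) :
  nrm (\sum_(k < n) c k *: delta k) ^+ 2 = \sum_(k < n) csq (c k).
Proof.
apply: (@complexI R); rewrite -dotxx dot_suml rmorph_sum; apply: eq_bigr => k _ /=.
rewrite dotZl dotC dot_delta -mul_conj; congr (_ * _^* ).
transitivity (\sum_(j < n) (if j == k then c j else 0)).
  elim/big_rec2: _ => // i y z _ <-; rewrite hilDE hilZE deltaE; congr (_ + _).
  by rewrite eq_sym -(inj_eq val_inj); case: eqP; rewrite ?mulr1 ?mulr0.
by rewrite (sum_delta c) ltn_ord.
Qed.

(** By Pythagoras the squared distance is the tail of the series of the [csq (x k)]. *)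
Lemma proj_deltas_cvg (x : H) (e : R) : 0 < e ->
  exists n, nrm (x - proj (deltas n) x) <= e.
Proof.
move=> e0; have s := l2_summable (hil_l2 x).
have [n hn] : exists n, nrm x ^+ 2 - e ^+ 2 < \sum_(k < n) csq (x k).
  apply/not_existsP => h.
  have : rsum (fun k => csq (x k)) <= nrm x ^+ 2 - e ^+ 2.
    by apply: rsum_le => // n; rewrite leNgt; apply/negP/h.
  by rewrite -sqr_nrm lerDl oppr_ge0 leNgt exprn_gt0.
exists n; rewrite -(@ler_pXn2r _ 2) ?nnegrE ?nrm_ge0 ?(ltW e0) //.
have := nrm_proj_eq x (onf_deltas n).
rewrite {1}proj_deltas nrm_comb_delta; move: hn; lra.
Qed.

(** Infinite dimension: the projection has rank at most [size es], hence a nonzero kernel vector in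
    the span of [size es + 1] basis vectors. *)
Lemma exists_perp (es : seq H) : onf es -> exists2 x, nrm x = 1 & perp es x.
Proof.
move=> oe; have l1 : lin (id : H -> H) by [].
have rp := rank_le_comp_proj l1 (leqnn (size es)).
have [a an0 Sa] := rank_le_dependent (fun i : 'I_(size es).+1 => delta i) rp.
set x : H := \sum_(i < (size es).+1) a 0 i *: delta i.
have px : proj es x = 0.
  rewrite (lin_sum (T := @proj R es)); last by move=> b y z; exact: projP.
  by rewrite -[RHS]Sa; apply: eq_bigr => i _; rewrite linZ // => b y z; exact: projP.
have xn0 : nrm x != 0.
  rewrite nrm_eq0; apply: contra_neq an0 => x0.
  have xE : x = \sum_i a 0 i *: nth 0 (deltas (size es).+1) i.
    by apply: eq_bigr => i _; rewrite (nth_map 0%N) ?size_iota // nth_iota.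
  apply/rowP => j; rewrite mxE.
  rewrite -(dot_comb_nth (fun i => a 0 i) j (onf_deltas _) (size_deltas _)).
  by rewrite -xE x0 dot0l.
exists ((nrm x)^-1%:C%C *: x).
  by rewrite nrmZ cabs_real normfV ger0_norm ?nrm_ge0 // mulVf.
by move=> e ee; rewrite dotZl -(dot_proj x oe ee) px dot0l mulr0.
Qed.

End StandardBasis.

(** * Adjoints *)

Section Adjoint.
Variable R : realType.
Local Notation C := R[i].
Local Notation H := (hil R).
Implicit Types (x y : H) (T : H -> H).

(** For the truncation [z] with coefficients [c k], [nrm z ^ 2 = dot y (T z) <= nrm y * M * nrm z],
    so [nrm z <= nrm y * M] at every length. *)
Lemma adj_l2 T y : blin T -> l2 (fun k => dot y (T (delta R k))).
Proof.
move=> bT; have [M [M0 TM]] := blin_bound bT; have [lT _] := bT.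
exists ((nrm y * M) ^+ 2) => n.
pose c k := dot y (T (delta R k)); rewrite -/c; set s := \sum_(_ < _) _.
pose z : H := \sum_(k < n) c k *: delta R k.
have s0 : 0 <= s by apply: sumr_ge0 => k _; exact: csq_ge0.
have zs : nrm z ^+ 2 = s by rewrite nrm_comb_delta.
have e : dot y (T z) = s%:C%C.
  rewrite lin_sum // dot_sumr rmorph_sum; apply: eq_bigr => k _ /=.
  by rewrite linZ // dotZr mulrC mul_conj.
have : s <= nrm y * M * nrm z.
  have := dot_CS y (T z); rewrite e cabs_real ger0_norm // => h.
  by apply: le_trans h _; rewrite -mulrA ler_wpM2l ?nrm_ge0.
rewrite -{1}zs expr2; have [z0|zn0] := eqVneq z 0.
  by move=> _; rewrite -zs z0 nrm0 expr0n sqr_ge0.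
rewrite ler_pM2r ?nrm_gt0 // => h.
by rewrite -zs lerXn2r ?nnegrE ?mulr_ge0 ?nrm_ge0.
Qed.

(** The defining identity, tested on basis vectors, forces the coordinates; the value [0] for maps
    that are not [blin] only makes [adj] total. *)
Definition adj T y : H :=
  if pselect (blin T) is left h then mkhil (@adj_l2 T y h) else 0.

(** Both sides agree on finitely supported vectors and are continuous in [x]. The constant [K] is a
    joint Lipschitz bound, increased by [1] to allow division. *)
Lemma dot_adj T x y : blin T -> dot (T x) y = dot x (adj T y).
Proof.
move=> bT; have [M [M0 TM]] := blin_bound bT; have [lT _] := bT.
have adjE k : adj T y k = dot y (T (delta R k)) by rewrite /adj; case: pselect.
apply/eqP; rewrite -subr_eq0 -cabs_eq0 eq_le cabs_ge0 andbT.
apply/ler_addgt0Pr => e e0; rewrite add0r.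
pose K := M * nrm y + nrm (adj T y) + 1.
have K0 : 0 < K by rewrite ltr_wpDl // addr_ge0 ?mulr_ge0 ?nrm_ge0.
have [n hn] := @proj_deltas_cvg R x (e / K) (divr_gt0 e0 K0).
set p := proj _ _ in hn.
have ep : dot (T p) y = dot p (adj T y).
  rewrite /p proj_deltas lin_sum // !dot_suml; apply: eq_bigr => k _.
  by rewrite linZ // !dotZl (dotC (adj T y)) dot_delta adjE -dotC.
have -> : dot (T x) y - dot x (adj T y) = dot (T (x - p)) y - dot (x - p) (adj T y).
  by rewrite linB // !dotBl ep opprB addrA subrK.
apply: le_trans (cabsB _ _) _.
apply: (@le_trans _ _ (K * nrm (x - p))); last first.
  by rewrite mulrC -ler_pdivlMr.
rewrite !mulrDl mul1r -addrA lerD //.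
  apply: le_trans (dot_CS _ _) _; rewrite mulrAC ler_wpM2r ?nrm_ge0 //.
rewrite -[leLHS]addr0 lerD ?nrm_ge0 //.
by apply: le_trans (dot_CS _ _) _; rewrite mulrC.
Qed.

Lemma blin_adj T : blin T -> blin (adj T).
Proof.
move=> bT; have [M [M0 TM]] := blin_bound bT.
split.
  move=> a x y; apply: hilP => k; rewrite hilDE hilZE /adj.
  by case: pselect => //= _; rewrite dotPl.
exists M => y; apply: nrm_le_dot; first by rewrite mulr_ge0 ?nrm_ge0.
move=> x; rewrite dotC cabs_conj -dot_adj //.
apply: le_trans (dot_CS _ _) _; rewrite -mulrA [nrm y * _]mulrC mulrA.
by rewrite ler_wpM2r ?nrm_ge0.
Qed.

(** The family dominates a basis of the range and its image under the adjoint: if [x] is orthogonal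
    to both, [T x] is orthogonal to the range, hence to itself. The two halves give the factor
    [2]. *)
Lemma rank_le_ker T n : blin T -> rank_le (mkop T) n -> exists es, [/\ onf es,
  (size es <= 2 * n)%N & forall x, perp es x -> T x = 0 /\ forall y, dot (T y) x = 0].
Proof.
move=> bT rT; have [lT _] := bT.
have [es [oe sn pe]] := rank_le_onf lT rT.
have [fs [of_ sf pf]] := gram_schmidt (es ++ map (adj T) es).
exists fs; split=> //.
  by apply: leq_trans sf _; rewrite size_cat size_map addnn -mul2n leq_mul2l.
move=> x /pf /perp_cat [px pTx]; split; last exact: pe.
apply/eqP; rewrite -nrm_eq0 -sqrf_eq0 -(inj_eq (@complexI R)) -dotxx pe //.
by move=> e ee; rewrite dot_adj // pTx // map_f.
Qed.

End Adjoint.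

(** * The weak trace ideal in dyadic form *)

Section WeakTraceIdeal.
Variable R : realType.
Local Notation C := R[i].
Local Notation H := (hil R).
Implicit Types (x y : H) (T S : H -> H).

Lemma real_net (K e : R) : 0 < e -> exists s : seq R,
  forall r, `|r| <= K -> exists2 t, t \in s & `|r - t| < e.
Proof.
move=> e0.
exists [seq - K + i%:R * e | i <- iota 0 (Num.truncn (2 * K / e)).+1] => r rK.
have r0 : 0 <= (r + K) / e by rewrite divr_ge0 ?(ltW e0) //; move: rK; rewrite ler_norml; lra.
exists (- K + (Num.truncn ((r + K) / e))%:R * e).
  apply/mapP; exists (Num.truncn ((r + K) / e)) => //.
  rewrite mem_iota /= add0n ltnS; apply: le_truncn.
  by rewrite ler_pM2r ?invr_gt0 //; move: rK; rewrite ler_norml; lra.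
have /andP[h1 h2] := truncn_itv r0.
move: h1 h2; rewrite ler_pdivlMr // ltr_pdivrMr // -natr1.
by move=> h1 h2; rewrite ltr_norml; apply/andP; split; lra.
Qed.

Lemma complex_net (K e : R) : 0 < e -> exists s : seq C,
  forall z, cabs z <= K -> exists2 t, t \in s & cabs (z - t) < e.
Proof.
move=> e0; have [s hs] := @real_net K (e / 2) (divr_gt0 e0 (ltr0Sn _ 1)).
exists [seq Complex a b | a <- s, b <- s] => -[a b] zK.
have aK : `|a| <= K.
  apply: le_trans zK; rewrite -sqrtr_sqr ler_wsqrtr //=.
  by rewrite lerDl sqr_ge0.
have bK : `|b| <= K.
  apply: le_trans zK; rewrite -sqrtr_sqr ler_wsqrtr //=.
  by rewrite lerDr sqr_ge0.
have [a' a's ha] := hs _ aK; have [b' b's hb] := hs _ bK.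
exists (Complex a' b'); first by apply/allpairsP; exists (a', b').
have -> : (a +i* b)%C - (a' +i* b')%C = (a - a')%:C%C + 'i%C * (b - b')%:C%C :> C.
  by apply/eqP; rewrite eq_complex /=; apply/andP; split; apply/eqP; ring.
apply: le_lt_trans (cabsD _ _) _; rewrite cabsM !cabs_real.
rewrite cabs_i.
by rewrite mul1r [ltRHS]splitr ltrD.
Qed.

(** Each coefficient is bounded by [K] and is approximated on a grid; halving the tolerance at each
    vector keeps the total error below [e]. *)
Lemma proj_net (es : seq H) (K e : R) : 0 < e -> onf es -> exists ys : seq H,
  forall x, nrm x <= K -> exists2 y, y \in ys & nrm (proj es x - y) < e.
Proof.
move=> e0 oe; have {oe} : forall f, f \in es -> nrm f = 1 by move=> f; exact: onf_nrm.
elim: es e e0 => [|v es IH] e e0 n1.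
  exists [:: 0] => x _; exists 0; first exact: mem_head.
  by rewrite /proj big_nil subr0 nrm0.
have [|ys hys] := IH _ (divr_gt0 e0 (ltr0Sn _ 1) : 0 < e / 2).
  by move=> f fe; apply: n1; rewrite inE fe orbT.
have nv : nrm v = 1 by apply: n1; exact: mem_head.
have [s hs] := @complex_net K (e / 2) (divr_gt0 e0 (ltr0Sn _ 1)).
exists [seq c *: v + y | c <- s, y <- ys] => x xK.
have [y yy hy] := hys x xK.
have [|c cs hc] := hs (dot x v).
  by apply: le_trans (dot_CS _ _) _; rewrite nv mulr1.
exists (c *: v + y); first by apply/allpairsP; exists (c, y).
have -> : proj (v :: es) x - (c *: v + y) = (dot x v - c) *: v + (proj es x - y).
  by rewrite /proj big_cons scalerBl opprD addrACA.
apply: le_lt_trans (nrmD _ _) _; rewrite nrmZ nv mulr1.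
by rewrite [ltRHS]splitr ltrD.
Qed.

(* The two-sided dyadic form of membership in the ideal, see [L1inf_dyadic] and
   [dyadic_L1inf]; compactness comes for free. *)
Definition dyadic_family K n T es :=
  [/\ onf es, (size es <= K * 2 ^ n)%N & small2 es (K%:R / 2 ^+ n) T].

Definition dyadic K T := forall n, exists es, dyadic_family K n T es.

(** Testing the adjoint half of [small2] on [w = (1 - P) T x] itself gives
    [nrm w ^ 2 <= d * nrm x * nrm w]. *)
Lemma nrm_subproj_small es d T x : 0 <= d -> onf es -> small2 es d T ->
  nrm (T x - proj es (T x)) <= d * nrm x.
Proof.
move=> d0 oe sT; set w := _ - _; have pw : perp es w by exact: perp_subproj.
have [_ /(_ x)] := sT w pw.
have -> : dot (T x) w = (nrm w ^+ 2)%:C%C.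
  rewrite -dotxx /w dotBl -/w [dot (proj _ _) w]dot_proj_perp ?subr0 //.
rewrite cabs_real ger0_norm ?sqr_ge0 // expr2.
have [->|wn0] := eqVneq w 0; first by rewrite nrm0 mulr_ge0 ?nrm_ge0.
by rewrite ler_pM2r // nrm_gt0.
Qed.

(** [T] is within [K / 2 ^ n] of [P T], which maps the unit ball into a bounded set of finite
    dimension. *)
Lemma compact_dyadic K T : blin T -> dyadic K T -> compact_op (mkop T).
Proof.
move=> bT dT e e0; have [M [M0 TM]] := blin_bound bT.
have [n hn] : exists n, K%:R / 2 ^+ n < e / 2.
  exists (Num.truncn (K%:R / (e / 2))).+1; rewrite ltr_pdivrMr ?exprn_gt0 //.
  rewrite mulrC -ltr_pdivrMr ?divr_gt0 //.
  apply: lt_trans (truncnS_gt _) _; rewrite -natrX ltr_nat.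
  exact: ltn_expl.
have [es [oe _ se]] := dT n.
have [ys hys] := @proj_net es M (e / 2) (divr_gt0 e0 (ltr0Sn _ 1)) oe.
exists (size ys), (fun i => hval (nth 0 ys i)) => _ /l2_hil[x ->]; rewrite nrmE => x1.
have [|y /(nthP 0)[i si <-] hy] := hys (T x).
  by apply: le_trans (TM x) _; rewrite ler_piMr.
exists (Ordinal si) => /=; rewrite mkop_hil.
have -> : (fun k => T x k - nth 0 ys i k) = hval (T x - nth 0 ys i) by [].
rewrite nrmE -(subrK (proj es (T x)) (T x)) -addrA.
apply: le_lt_trans (nrmD _ _) _; rewrite [ltRHS]splitr; apply: ltrD => //.
  apply: le_lt_trans hn; have d0 : 0 <= K%:R / 2 ^+ n :> R by rewrite divr_ge0 ?exprn_ge0.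
  apply: le_trans (nrm_subproj_small x d0 oe se) _.
  by rewrite ler_piMr.
Qed.

Lemma dyadic_L1inf K T : blin T -> dyadic K T -> L1inf (mkop T).
Proof.
move=> bT dT; split; [exact: bounded_mkop|exact: compact_dyadic dT|].
have [M [M0 TM]] := blin_bound bT.
(* The first summand serves [n < K], where [smu n <= M]; the second serves
   [K * 2 ^ j <= n < K * 2 ^ j.+1], with the bound [K * 2 ^ j.+1 * (K / 2 ^ j)]. *)
exists (K%:R * M + 2 * K%:R ^+ 2) => n.
have [nK|Kn] := ltnP n K.
  apply: (@le_trans _ _ (K%:R * M)); last by rewrite lerDl mulr_ge0 ?sqr_ge0.
  apply: ler_pM; rewrite ?ler_nat ?smu_ge0 //.
  apply: (@smu_le _ n T (fun=> 0)) => //; [exact: blin0|exact: rank_le0|].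
  by move=> x; rewrite subr0.
apply: (@le_trans _ _ (2 * K%:R ^+ 2)); last by rewrite lerDr mulr_ge0.
(* The level [j] below comes from a division by [K]; for [K = 0] the family is empty and [T]
   vanishes. *)
have [K0|Kp] := posnP K.
  have [es [oe se sm]] := dT 0%N.
  rewrite (@le_anti _ _ (smu n (mkop T)) 0) ?mulr0 ?mulr_ge0 ?sqr_ge0 //.
  rewrite smu_ge0 // andbT; apply: (smu_le_perp bT oe) => //.
    by apply: leq_trans se _; rewrite K0.
  by move=> x /sm [h _]; move: h; rewrite K0 mul0r.
pose j := trunc_log 2 (n %/ K).
have nKp : (0 < n %/ K)%N by rewrite divn_gt0.
have /andP[j1 j2] : (2 ^ j <= n %/ K < 2 ^ j.+1)%N by exact: trunc_log_bounds.
have [es [oe se sm]] := dT j.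
have s1 : smu n (mkop T) <= K%:R / 2 ^+ j.
  apply: (smu_le_perp bT oe); last by move=> x /sm [].
    by apply: leq_trans se _; rewrite mulnC -leq_divRL.
  by rewrite divr_ge0 ?exprn_ge0.
apply: (@le_trans _ _ ((K * 2 ^ j.+1)%:R * (K%:R / 2 ^+ j))).
  by apply: ler_pM; rewrite ?smu_ge0 // ler_nat mulnC -ltn_divLR.
rewrite natrM natrX exprS le_eqVlt; apply/orP; left; apply/eqP.
by field; rewrite expf_neq0.
Qed.

Lemma L1inf_dyadic (A : op R) : L1inf A ->
  exists T, [/\ blin T, A = mkop T & exists K, dyadic K T].
Proof.
move=> [/bounded_opP[T bT ->] _ [M TM]]; exists T; split=> //.
have M0 : 0 <= M by apply: le_trans (TM 0%N); rewrite mulr_ge0 ?smu_ge0.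
(* At least [2] because [rank_le_ker] doubles the rank; [M + 1] gives the strict bound on [smu] from
   which an approximant is extracted. *)
exists (maxn 2 (Num.truncn (M + 1)).+1) => n; set K := maxn _ _.
have MK : M + 1 <= K%:R by apply: le_trans (ltW (truncnS_gt _)) _; rewrite ler_nat leq_maxr.
have K2 : (2 <= K)%N by rewrite leq_maxl.
have lt : smu (2 ^ n) (mkop T) < K%:R / 2 ^+ n.
  rewrite ltr_pdivlMr ?exprn_gt0 //; apply: lt_le_trans MK.
  have := TM (2 ^ n)%N; rewrite -natr1 natrX mulrDl mul1r mulrC.
  have := smu_ge0 (2 ^ n) bT; lra.
have [S [bS rS TS]] := smu_lt bT lt.
have [es [oe se ker]] := rank_le_ker bS rS.
exists es; split=> //; first by apply: leq_trans se _; rewrite leq_mul2r K2 orbT.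
move=> x /ker[Sx Sy]; split; first by have := TS x; rewrite Sx subr0.
move=> y; have -> : dot (T y) x = dot (T y - S y) x by rewrite dotBl Sy subr0.
by apply: le_trans (dot_CS _ _) _; rewrite ler_wpM2r ?nrm_ge0.
Qed.

End WeakTraceIdeal.

(** * Partial traces up to a bounded error *)

Section PartialTraces.
Variable R : realType.
Local Notation C := R[i].
Local Notation H := (hil R).
Implicit Types (x y : H) (T S : H -> H) (t s : nat -> C).

Lemma small2_le es d d' T : d <= d' -> small2 es d T -> small2 es d' T.
Proof.
move=> dd sT x /sT [h1 h2]; split.
  by apply: le_trans h1 _; rewrite ler_wpM2r ?nrm_ge0.
move=> y; apply: le_trans (h2 y) _.
by rewrite ler_wpM2r ?nrm_ge0 // ler_wpM2r ?nrm_ge0.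
Qed.

Lemma dyadic_family_le K K' n T es : (K <= K')%N ->
  dyadic_family K n T es -> dyadic_family K' n T es.
Proof.
move=> KK [oe se sm]; split=> //; first by apply: leq_trans se _; rewrite leq_mul2r KK orbT.
by apply: small2_le sm; rewrite ler_pM2r ?invr_gt0 ?exprn_gt0 // ler_nat.
Qed.

(** Brings families of consecutive levels to the same level, which yields the bounded increments. *)
Lemma dyadic_family_pred K n T es :
  dyadic_family K n.+1 T es -> dyadic_family (2 * K) n T es.
Proof.
move=> [oe se sm]; split=> //; first by rewrite (mulnC 2) -mulnA -expnS.
apply: small2_le sm; rewrite exprS invfM mulrCA natrM.
have : 0 <= K%:R / 2 ^+ n :> R by rewrite divr_ge0 ?exprn_ge0.
by rewrite -[2 * _ / _]mulrA; move: (_ / _) => z; lra.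
Qed.

(** At most [2 * K * 2 ^ n] vectors, each contributing at most [K / 2 ^ n]. *)
Lemma dyadic_tr_compare K n T es fs : lin T ->
  dyadic_family K n T es -> dyadic_family K n T fs ->
  cabs (tr T es - tr T fs) <= 2 * K%:R ^+ 2.
Proof.
move=> lT [oe se sme] [of_ sf smf].
have d0 : 0 <= K%:R / 2 ^+ n :> R by rewrite divr_ge0 ?exprn_ge0.
apply: le_trans (tr_compare lT d0 oe of_ sme smf) _.
apply: (@le_trans _ _ (K%:R / 2 ^+ n * (2 * (K * 2 ^ n))%:R)).
  by rewrite ler_wpM2l // ler_nat mul2n -addnn leq_add.
rewrite !natrM natrX le_eqVlt; apply/orP; left; apply/eqP.
by field; rewrite expf_neq0.
Qed.

(** A relation, since the families are not canonical: they may change freely with [n], and one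
    constant controls both the family and the error. *)
Definition partial_trace T t := exists K, forall n, exists es,
  dyadic_family K n T es /\ cabs (t n - tr T es) <= K%:R.

Lemma partial_trace_exists K T : dyadic K T -> exists t, partial_trace T t.
Proof.
move=> /choice [es he]; exists (fun n => tr T (es n)), K => n; exists (es n).
by split=> //; rewrite subrr cabs0.
Qed.

Lemma partial_trace_dyadic T t : partial_trace T t -> exists K, dyadic K T.
Proof. by move=> [K h]; exists K => n; have [es []] := h n; exists es. Qed.

Lemma partial_trace_unique T t s : lin T -> partial_trace T t -> partial_trace T s ->
  exists M, forall n, cabs (t n - s n) <= M.
Proof.
move=> lT [K ht] [L hs]; exists (K%:R + 2 * (K + L)%:R ^+ 2 + L%:R) => n.
have [es [de te]] := ht n; have [fs [df sf]] := hs n.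
have h := dyadic_tr_compare lT (dyadic_family_le (leq_addr L K) de)
            (dyadic_family_le (leq_addl K L) df).
have -> : t n - s n = (t n - tr T es) + (tr T es - tr T fs) - (s n - tr T fs) by ring.
apply: le_trans (cabsB _ _) _; apply: lerD => //.
by apply: le_trans (cabsD _ _) _; apply: lerD.
Qed.

Lemma partial_trace_step T t : lin T -> partial_trace T t ->
  exists M, forall n, cabs (t n.+1 - t n) <= M.
Proof.
move=> lT [K ht]; exists (K%:R + 2 * (2 * K)%:R ^+ 2 + K%:R) => n.
have [es [de te]] := ht n.+1; have [fs [df sf]] := ht n.
have h := dyadic_tr_compare lT (dyadic_family_pred de)
            (dyadic_family_le (leq_pmull K (isT : (0 < 2)%N)) df).
have -> : t n.+1 - t n = (t n.+1 - tr T es) + (tr T es - tr T fs) - (t n - tr T fs) by ring.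
apply: le_trans (cabsB _ _) _; apply: lerD => //.
by apply: le_trans (cabsD _ _) _; apply: lerD.
Qed.

(** Gram-Schmidt on the union of two families gives one that serves [T] and [S] at once, on which
    traces add exactly; moving to it from the original families costs a bounded error. *)
Lemma partial_trace_comb a T S t s : lin T -> lin S ->
  partial_trace T t -> partial_trace S s ->
  partial_trace (fun x => a *: T x + S x) (fun n => a * t n + s n).
Proof.
move=> lT lS [K0 ht] [L0 hs]; pose K := (2 * (K0 + L0))%N.
(* [K] pays for the distance of [t] or [s] to its trace, [2 * K ^ 2] for the change of family; the
   factor collects the coefficients [a] and [1] of the two operators. *)
pose B : R := (cabs a + 1) * (K%:R + 2 * K%:R ^+ 2).
have a0 := cabs_ge0 a.
have KB : K%:R <= B.
  rewrite /B mulrDr -[leLHS]addr0 lerD ?mulr_ge0 ?sqr_ge0 ?addr_ge0 //.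
  by rewrite ler_peMl // lerDr.
have B0 : 0 <= B by apply: le_trans KB.
pose N := (Num.truncn B).+1.
have BN : B <= N%:R by exact/ltW/truncnS_gt.
have KN : (K <= N)%N by rewrite -(ler_nat R); apply: le_trans BN.
exists N => n; have [es [de te]] := ht n; have [fs [df sf]] := hs n.
have [gs [og sg pg]] := gram_schmidt (es ++ fs).
have sKg : (size gs <= K * 2 ^ n)%N.
  apply: leq_trans sg _; rewrite size_cat /K mul2n -addnn mulnDl.
  have [_ se _] := de; have [_ sff _] := df.
  apply: leq_add; [apply: leq_trans se _|apply: leq_trans sff _];
    by rewrite leq_mul2r ?leq_addr ?leq_addl orbT.
have K0K : (K0 <= K)%N by rewrite /K; lia.
have L0K : (L0 <= K)%N by rewrite /K; lia.
have dgT : dyadic_family K n T gs.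
  split=> // x /pg /perp_cat [px _].
  by have [_ _ /(_ x px)] := dyadic_family_le K0K de.
have dgS : dyadic_family K n S gs.
  split=> // x /pg /perp_cat [_ px].
  by have [_ _ /(_ x px)] := dyadic_family_le L0K df.
have n0 : 0 < 2 ^+ n :> R by rewrite exprn_gt0.
have dB : cabs a * (K%:R / 2 ^+ n) + K%:R / 2 ^+ n <= N%:R / 2 ^+ n.
  rewrite mulrA -mulrDl ler_pM2r ?invr_gt0 //; apply: le_trans BN.
  rewrite /B [leRHS]mulrDr mulrDl mul1r lerDl mulr_ge0 ?addr_ge0 //.
exists gs; split.
  split=> //; first by apply: leq_trans sKg _; rewrite leq_mul2r KN orbT.
  apply: (small2_le dB) => x px.
  have [_ _ /(_ x px) [T1 T2]] := dgT; have [_ _ /(_ x px) [S1 S2]] := dgS; split.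
    rewrite mulrDl -mulrA; apply: le_trans (nrmD _ _) _.
    by rewrite nrmZ lerD // ler_wpM2l.
  move=> y; rewrite dotPl !mulrDl -!mulrA; apply: le_trans (cabsD _ _) _.
  by rewrite cabsM !mulrA lerD // -!mulrA ler_wpM2l // !mulrA.
have -> : tr (fun x => a *: T x + S x) gs = a * tr T gs + tr S gs.
  by rewrite /tr mulr_sumr -big_split; apply: eq_bigr => e _; rewrite dotPl.
have -> : a * t n + s n - (a * tr T gs + tr S gs) =
    a * ((t n - tr T es) + (tr T es - tr T gs)) + ((s n - tr S fs) + (tr S fs - tr S gs)).
  by ring.
apply: le_trans BN; apply: le_trans (cabsD _ _) _; rewrite cabsM /B mulrDl mul1r.
have cT := dyadic_tr_compare lT (dyadic_family_le K0K de) dgT.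
have cS := dyadic_tr_compare lS (dyadic_family_le L0K df) dgS.
have K0KR : K0%:R <= K%:R :> R by rewrite ler_nat.
have L0KR : L0%:R <= K%:R :> R by rewrite ler_nat.
apply: lerD.
  rewrite ler_wpM2l //; apply: le_trans (cabsD _ _) _.
  by apply: lerD => //; exact: le_trans te _.
apply: le_trans (cabsD _ _) _.
by apply: lerD => //; exact: le_trans sf _.
Qed.

Definition hunitary (U V : H -> H) :=
  [/\ lin U, lin V, cancel U V /\ cancel V U & forall x y, dot (U x) (U y) = dot x y].

(** Polarisation: the norm determines real parts, and ['i *: x] in place of [x] yields the imaginary
    parts. *)
Lemma dot_isometry (U : H -> H) : lin U -> (forall x, nrm (U x) = nrm x) ->
  forall x y, dot (U x) (U y) = dot x y.
Proof.
move=> lU nU.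
have re x y : complex.Re (dot (U x) (U y)) = complex.Re (dot x y).
  have e u v : 2 * complex.Re (dot u v) = nrm (u + v) ^+ 2 - nrm u ^+ 2 - nrm v ^+ 2 :> R.
    have /(congr1 (@complex.Re R)) := dotxx (u + v).
    rewrite dotDl !dotDr !dotxx (dotC u v) /= => <-.
    by case: (dot u v) => p q /=; ring.
  apply: (mulfI (_ : 2 != 0 :> R)); first by rewrite pnatr_eq0.
  by rewrite !e -linD // !nU.
move=> x y; apply/eqP; rewrite eq_complex re eqxx /=.
have := re ('i%C *: x) y; rewrite linZ // !dotZl.
case: (dot x y) (dot (U x) (U y)) => [p q] [p' q'] /=.
by rewrite !mul0r !mul1r !sub0r => /oppr_inj ->.
Qed.

Lemma unitary_pairP (U V : op R) : unitary_pair U V ->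
  exists u v, [/\ U = mkop u, V = mkop v, blin u, blin v & hunitary u v].
Proof.
move=> [/bounded_opP[u bu ->] /bounded_opP[v bv ->] UV nU].
exists u, v; split=> //; have [lu _] := bu; have [lv _] := bv; split=> //.
  split=> x; apply: val_inj; rewrite /= -!mkop_hil;
    by have [] := UV x (hil_l2 x).
by apply: dot_isometry => // x; have := nU x (hil_l2 x); rewrite mkop_hil !nrmE.
Qed.

Lemma unitary_nrm U V x : hunitary U V -> nrm (U x) = nrm x.
Proof.
move=> [_ _ _ dU]; apply/eqP; rewrite -(@eqrXn2 _ 2) ?nrm_ge0 //.
by rewrite -(inj_eq (@complexI R)) -!dotxx dU.
Qed.

Lemma unitary_adj U V x y : hunitary U V -> dot (U x) y = dot x (V y).
Proof. by move=> [_ _ [_ VK] dU]; rewrite -[y in LHS]VK dU. Qed.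

(** The families transported by [U] have exactly the same traces, so [t] itself is kept. *)
Lemma partial_trace_unitary U V T t : hunitary U V -> lin T ->
  partial_trace T t -> partial_trace (U \o T \o V) t.
Proof.
move=> hU lT [K ht]; have [lU lV [UK VK] dU] := hU.
exists K => n; have [es [[oe se sm] te]] := ht n.
have trE : tr (U \o T \o V) (map U es) = tr T es.
  by rewrite /tr big_map; apply: eq_bigr => e _ /=; rewrite UK dU.
exists (map U es); rewrite trE; split=> //; split; rewrite ?size_map //.
  have [u o] := oe; split; first by rewrite map_inj_uniq //; exact: can_inj UK.
  move=> _ _ /mapP[e ee ->] /mapP[f fe ->].
  by rewrite dU o // (inj_eq (can_inj UK)).
move=> x px.
have nV z : nrm (V z) = nrm z by rewrite -(unitary_nrm _ hU) VK.
have pV : perp es (V x).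
  by move=> e ee; rewrite -dU VK px // map_f.
have [h1 h2] := sm _ pV; split; first by rewrite /= (unitary_nrm _ hU) -(nV x).
by move=> y; rewrite /= (unitary_adj _ _ hU) -(nV x) -(nV y).
Qed.

End PartialTraces.

(** * Positive operators and almost eigenvectors *)

Section PositiveOperators.
Variable R : realType.
Local Notation C := R[i].
Local Notation H := (hil R).
Implicit Types (x y : H) (T : H -> H) (es : seq H).

Definition hpos T := blin T /\ forall x, 0 <= dot (T x) x.

Lemma pos_opP (A : op R) : pos_op A -> exists2 T, hpos T & A = mkop T.
Proof.
move=> [/bounded_opP[T bT ->] p]; exists T => //; split=> // x.
by have := p x (hil_l2 x); rewrite mkop_hil dotE.
Qed.

Lemma pos_mkop T : hpos T -> pos_op (mkop T).
Proof.
move=> [bT p]; split; first exact: bounded_mkop.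
by move=> _ /l2_hil[x ->]; rewrite mkop_hil dotE.
Qed.

Lemma hpos_mkop T : pos_op (mkop T) -> hpos T.
Proof. by move=> /pos_opP[S hS /mkop_inj ->]. Qed.

Lemma hpos_real T x : hpos T -> dot (T x) x = (complex.Re (dot (T x) x))%:C%C.
Proof. by move=> [_ /(_ x) /ger0_real /RRe_real]. Qed.

Lemma hpos_Re T x : hpos T -> 0 <= complex.Re (dot (T x) x).
Proof. by move=> pT; rewrite -ler0c -hpos_real //; case: pT. Qed.

(** A complex quadratic form with real values is hermitian: its values at [x + y] and ['i *: x + y]
    give the two components of the identity. *)
Lemma hpos_sym T x y : hpos T -> dot (T y) x = (dot (T x) y)^*.
Proof.
move=> pT; have [[lT _] _] := pT.
have im z : complex.Im (dot (T z) z) = 0 by rewrite hpos_real.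
have := im (x + y); rewrite linD // dotDl !dotDr.
have := im ('i%C *: x + y); rewrite lT !dotPl !dotDr !dotZr.
move: (im x) (im y).
move: (dot (T x) x) (dot (T x) y) (dot (T y) x) (dot (T y) y).
move=> [a1 a2] [b1 b2] [c1 c2] [d1 d2] /= h1 h2 h3 h4.
apply/eqP; rewrite eq_complex /=; apply/andP; split; apply/eqP; lra.
Qed.

Lemma hpos_CS T x y : hpos T ->
  csq (dot (T x) y) <= complex.Re (dot (T x) x) * complex.Re (dot (T y) y).
Proof.
move=> pT; have [[lT _] p0] := pT.
apply: (@cauchy_schwarz_form R H (fun x y => dot (T x) y)) => //.
  by move=> a u v w; rewrite lT dotPl.
by move=> u v; rewrite hpos_sym.
Qed.

Section Greedy.
Variables (T : H -> H) (pT : hpos T) (M : R).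
Hypothesis TM : forall x, nrm (T x) <= M * nrm x.
Variables (eta eps : R) (eta0 : 0 < eta) (eps0 : 0 < eps).
Hypothesis eps_le : eps <= eta.
Hypothesis epsM : eps * M <= eta ^+ 2.

Let lT : lin T. Proof. by case: pT => -[]. Qed.

Definition quad_values es :=
  [set complex.Re (dot (T x) x) | x in [set x | nrm x = 1 /\ perp es x]].
Definition lam es : R := sup (quad_values es).

(** The head is the vector chosen last. The supremum [lam] need not be attained, hence the loss
    [eps]; [eta] is the resulting off-diagonal size, and [eps * M <= eta ^ 2] is what Cauchy-Schwarz
    asks for. *)
Fixpoint greedy es : Prop :=
  if es is e :: es' then
    [/\ greedy es', nrm e = 1, perp es' e & lam es' - eps <= complex.Re (dot (T e) e)]
  else True.

Lemma quad_leM x : complex.Re (dot (T x) x) <= M * nrm x ^+ 2.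
Proof.
apply: le_trans (Re_le_cabs _) _; apply: le_trans (dot_CS _ _) _.
by rewrite expr2 mulrA ler_wpM2r ?nrm_ge0.
Qed.

Lemma quad_values_ub es : has_ubound (quad_values es).
Proof.
exists M => _ [x [n1 _] <-]; apply: le_trans (quad_leM x) _.
by rewrite n1 expr1n mulr1.
Qed.

Lemma quad_values_neq0 es : onf es -> quad_values es !=set0.
Proof.
by move=> /exists_perp[x n1 px]; exists (complex.Re (dot (T x) x)), x.
Qed.

Lemma lam_ge0 es : onf es -> 0 <= lam es.
Proof.
move=> oe; have [r [x hx _]] := quad_values_neq0 oe.
apply: le_trans (hpos_Re x pT) _; apply: ub_le_sup; first exact: quad_values_ub.
by exists x.
Qed.

Lemma lam_leM es : onf es -> lam es <= M.
Proof.
move=> oe; apply: ge_sup; first exact: quad_values_neq0.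
move=> _ [x [n1 _] <-]; apply: le_trans (quad_leM x) _.
by rewrite n1 expr1n mulr1.
Qed.

Lemma quad_le_lam es x : perp es x -> complex.Re (dot (T x) x) <= lam es * nrm x ^+ 2.
Proof.
move=> px; have [x0|xn0] := eqVneq x 0.
  by rewrite x0 lin0 // dot0l nrm0 expr0n mulr0.
have nx : 0 < nrm x by rewrite nrm_gt0.
rewrite -ler_pdivrMr ?exprn_gt0 //; apply: ub_le_sup; first exact: quad_values_ub.
exists ((nrm x)^-1%:C%C *: x).
  split; first by rewrite nrmZ cabs_real ger0_norm ?mulVf ?gt_eqF // invr_ge0 ltW.
  by move=> e ee; rewrite dotZl px // mulr0.
rewrite linZ // dotZl dotZr mulrA mul_conj.
by case: (dot _ _) => a b; rewrite /csq /=; field; rewrite gt_eqF.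
Qed.

Lemma greedy_onf es : greedy es -> onf es.
Proof.
elim: es => [|e es IH] /=; first by move=> _; exact: onf_nil.
by move=> [ges n1 pe _]; apply: onf_cons => //; exact: IH.
Qed.

Lemma lam_cons e es : greedy (e :: es) -> lam (e :: es) <= lam es.
Proof.
move=> g; apply: ge_sup; first exact/quad_values_neq0/greedy_onf.
move=> _ [x [n1 px] <-]; apply: ub_le_sup; first exact: quad_values_ub.
by exists x => //; split=> // f fe; apply: px; rewrite inE fe orbT.
Qed.

(* Cauchy-Schwarz for the form [lam - T], nonnegative on the complement of [es]: an
   almost maximiser is an almost eigenvector. *)
Lemma greedy_off_head e es y : greedy (e :: es) -> perp (e :: es) y ->
  cabs (dot (T e) y) <= eta * nrm y.
Proof.
move=> g py; have [ges n1 pe le] := g.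
have oe := greedy_onf ges.
have pey : perp es y by move=> f fe; apply: py; rewrite inE fe orbT.
have dey : dot e y = 0 by rewrite dotC py ?mem_head // rmorph0.
pose q u v := (lam es)%:C%C * dot u v - dot (T u) v.
have qE z : q z z = (lam es * nrm z ^+ 2 - complex.Re (dot (T z) z))%:C%C.
  by rewrite /q dotxx hpos_real // -rmorphM -rmorphB.
have : csq (q e y) <= complex.Re (q e e) * complex.Re (q y y).
  apply: (@cauchy_schwarz_form R H q) => //.
  - by move=> a u v w; rewrite /q lT !dotPl; ring.
  - move=> u v; rewrite /q rmorphB rmorphM /= -dotC hpos_sym //.
    by congr (_ * _ - _); exact/esym/conjc_real.
  - by move=> a; rewrite qE ler0c subr_ge0; apply: quad_le_lam; exact: perpP.
  - by rewrite qE ler0c subr_ge0; apply: quad_le_lam.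
rewrite !qE n1 expr1n mulr1 /q dey mulr0 sub0r /= -sqr_cabs cabsN => h.
rewrite -(@ler_pXn2r _ 2) ?nnegrE ?cabs_ge0 ?mulr_ge0 ?nrm_ge0 ?(ltW eta0) //.
apply: le_trans h _; rewrite exprMn.
apply: (@le_trans _ _ (eps * (M * nrm y ^+ 2))); last by rewrite mulrA ler_wpM2r ?sqr_ge0.
apply: ler_pM.
- by rewrite subr_ge0 -[leRHS]mulr1 -(expr1n _ 2) -n1; apply: quad_le_lam.
- by rewrite subr_ge0; apply: quad_le_lam.
- by rewrite lerBlDr addrC -lerBlDr.
- rewrite lerBlDr -[leLHS]addr0 lerD ?hpos_Re //.
  by rewrite ler_wpM2r ?sqr_ge0 ?lam_leM.
Qed.

Lemma greedy_off es e y : greedy es -> e \in es -> perp es y ->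
  cabs (dot (T e) y) <= eta * nrm y.
Proof.
elim: es => // f es IH g; rewrite inE => /orP[/eqP-> | ee] py.
  exact: greedy_off_head g py.
apply: IH => //; first by case: g.
by move=> h he; apply: py; rewrite inE he orbT.
Qed.

Lemma greedy_off2 es e f : greedy es -> e \in es -> f \in es -> e != f ->
  cabs (dot (T e) f) <= eta.
Proof.
elim: es => // g es IH gg; have [ges n1 pg _] := gg.
rewrite !inE => /orP[/eqP-> | ee] /orP[/eqP-> | fe] ef.
- by rewrite eqxx in ef.
- by rewrite hpos_sym // cabs_conj -[eta]mulr1 -n1; apply: greedy_off fe pg.
- by rewrite -[eta]mulr1 -n1; apply: greedy_off ee pg.
- exact: IH.
Qed.

(** [lam] decreases as the list grows, so the newest supremum, up to [eps], also bounds the earlier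
    diagonal entries from below. *)
Lemma greedy_diag e es f : greedy (e :: es) -> f \in e :: es ->
  lam es - eps <= complex.Re (dot (T f) f).
Proof.
elim: es e f => [|e' es IH] e f g; first by rewrite inE => /eqP ->; case: g.
rewrite inE => /orP[/eqP-> | fe]; first by case: g.
have [g' _ _ _] := g; apply: le_trans (IH e' f g' fe).
by rewrite lerD2r lam_cons.
Qed.

Lemma greedy_exists n : exists2 es, greedy es & size es = n.
Proof.
elim: n => [|n [es g sn]]; first by exists [::].
have oe := greedy_onf g.
have hs : has_sup (quad_values es).
  by split; [exact: quad_values_neq0|exact: quad_values_ub].
have [_ [x [n1 px] <-] hx] := sup_adherent eps0 hs.
by exists (x :: es); rewrite /= ?sn //; split=> //; exact: ltW.
Qed.

(** Off the span of [es], Cauchy-Schwarz for the form of [T] bounds [T y] through [lam es]; along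
    each vector of [es] the component is off-diagonal, at most [eta * nrm y]. *)
Lemma greedy_upper es y : greedy es -> perp es y ->
  nrm (T y) <= (lam es + (size es)%:R * eta) * nrm y.
Proof.
move=> g py; have oe := greedy_onf g; set w := T y - proj es (T y).
have pw : perp es w by exact: perp_subproj.
have wE : nrm w <= lam es * nrm y.
  have dw : dot (T y) w = (nrm w ^+ 2)%:C%C.
    by rewrite -dotxx {2}/w dotBl dot_proj_perp ?subr0.
  have := hpos_CS y w pT; rewrite -sqr_cabs dw cabs_real ger0_norm ?sqr_ge0 // => h.
  have {}h : (nrm w ^+ 2) ^+ 2 <= (lam es * nrm y * nrm w) ^+ 2.
    apply: le_trans h _; rewrite (_ : _ ^+ 2 = (lam es * nrm y ^+ 2) * (lam es * nrm w ^+ 2)).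
      by apply: ler_pM; rewrite ?hpos_Re ?quad_le_lam.
    by ring.
  move: h; rewrite ler_pXn2r ?nnegrE ?sqr_ge0 ?mulr_ge0 ?nrm_ge0 ?lam_ge0 //.
  rewrite expr2; have [->|wn0] := eqVneq w 0; last by rewrite ler_pM2r ?nrm_gt0.
  by rewrite nrm0 !mulr0 mulr_ge0 ?nrm_ge0 ?lam_ge0.
rewrite -(subrK (proj es (T y)) (T y)) -/w mulrDl.
apply: le_trans (nrmD _ _) _; apply: lerD => //.
apply: le_trans (nrm_sum _ _ _) _; rewrite big_seq.
apply: (@le_trans _ _ (\sum_(e <- es | e \in es) eta * nrm y)).
  apply: ler_sum => e ee; rewrite nrmZ (onf_nrm oe ee) mulr1.
  by rewrite hpos_sym // cabs_conj; apply: greedy_off py.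
by rewrite -big_seq big_const_seq count_predT iter_addr addr0 -[leLHS]mulr_natl mulrA.
Qed.

Lemma nrm_proj_sum es x : onf es -> nrm (proj es x) ^+ 2 = \sum_(e <- es) csq (dot x e).
Proof.
move=> oe; apply: (@complexI R); rewrite -dot_proj_self // /proj dot_suml rmorph_sum.
by apply: eq_bigr => e _ /=; rewrite dotZl (dotC x e) mul_conj.
Qed.

(** On the span, the matrix of [T] has diagonal entries at least [lam es - eps] and fewer than
    [(size es).+1 ^ 2] off-diagonal ones, each at most [eta]. *)
Lemma greedy_lower e es x : greedy (e :: es) -> proj (e :: es) x = x ->
  (lam es - eps - (size es).+1%:R ^+ 2 * eta) * nrm x <= nrm (T x).
Proof.
move=> g px; set fs := e :: es in g px *; have of_ := greedy_onf g.
have cx f : f \in fs -> cabs (dot x f) <= nrm x.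
  by move=> ff; apply: le_trans (dot_CS _ _) _; rewrite (onf_nrm of_ ff) mulr1.
have [->|xn0] := eqVneq x 0; first by rewrite nrm0 mulr0 nrm_ge0.
rewrite -(@ler_pM2r _ (nrm x)) ?nrm_gt0 //.
apply: le_trans (le_trans (Re_le_cabs _) (dot_CS (T x) x)).
(* A lower bound for each entry of the double sum; subtracting the [eta] term on the diagonal too
   makes the count a plain square. *)
pose b f h := (if f == h then csq (dot x f) * (lam es - eps) else 0) - eta * nrm x ^+ 2.
have dE : dot (T x) x = \sum_(f <- fs) \sum_(h <- fs)
    dot x f * (dot x h)^* * dot (T f) h.
  rewrite -{1 2}px {1}/proj lin_sum // dot_suml; apply: eq_bigr => f _.
  rewrite dot_sumr; apply: eq_bigr => h _; rewrite linZ // dotZl dotZr; ring.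
have bz f h : f \in fs -> h \in fs ->
    b f h <= complex.Re (dot x f * (dot x h)^* * dot (T f) h).
  move=> ff hf; rewrite /b; case: eqP => [<-|/eqP fh].
    rewrite mul_conj hpos_real // -rmorphM /=.
    rewrite lerBlDr -[leLHS]addr0; apply: lerD; last first.
      by rewrite mulr_ge0 ?sqr_ge0 // ltW.
    by rewrite ler_wpM2l ?csq_ge0 // (greedy_diag g).
  rewrite sub0r lerNl; apply: le_trans (ReN_le_cabs _) _.
  rewrite !cabsM cabs_conj mulrC; apply: ler_pM; rewrite ?mulr_ge0 ?cabs_ge0 //.
    exact: greedy_off2 g ff hf fh.
  by rewrite expr2; apply: ler_pM; rewrite ?cabs_ge0 ?cx.
apply: (@le_trans _ _ (\sum_(f <- fs) \sum_(h <- fs) b f h)); last first.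
  rewrite dE !raddf_sum big_seq [leRHS]big_seq; apply: ler_sum => f ff.
  rewrite raddf_sum big_seq [leRHS]big_seq; apply: ler_sum => h hf.
  exact: bz.
have [uf _] := of_.
rewrite (eq_big_seq (fun f => csq (dot x f) * (lam es - eps) - (size fs)%:R * (eta * nrm x ^+ 2))).
  rewrite sumrB -mulr_suml -nrm_proj_sum // px big_const_seq count_predT iter_addr addr0.
  by rewrite -mulr_natl /=; rewrite le_eqVlt; apply/orP; left; apply/eqP; ring.
move=> f ff; rewrite /b sumrB big_const_seq count_predT iter_addr addr0.
congr (_ - _); last by rewrite mulr_natl.
rewrite (bigD1_seq f) //= eqxx big1 ?addr0 // => h.
by rewrite eq_sym => /negbTE ->.
Qed.

(** Both [smu k] and the last diagonal entry are close to [lam es]: the first by the upper and lower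
    bounds on [T], the second because it lies between [lam es - eps] and [lam es]. *)
Lemma greedy_smu e es : greedy (e :: es) ->
  let k := size es in
  lam es <= smu k (mkop T) + eps + k.+1%:R ^+ 2 * eta /\
  `|complex.Re (dot (T e) e) - smu k (mkop T)| <= (k.+1%:R ^+ 2 + 1) * eta.
Proof.
move=> g k; have [ges n1 pe le] := g; have oe := greedy_onf ges.
have bT : blin T by case: pT.
have up : smu k (mkop T) <= lam es + k%:R * eta.
  apply: (smu_le_perp bT oe (leqnn _)); last by move=> y; exact: greedy_upper.
  by rewrite addr_ge0 ?lam_ge0 // mulr_ge0 // ltW.
have lo : lam es - eps - k.+1%:R ^+ 2 * eta <= smu k (mkop T).
  apply: (smu_ge bT (greedy_onf g)) => //.
  by move=> x; exact: greedy_lower.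
have le1 : complex.Re (dot (T e) e) <= lam es.
  by have := quad_le_lam pe; rewrite n1 expr1n mulr1.
have kk : k%:R * eta <= k.+1%:R ^+ 2 * eta.
  rewrite ler_pM2r // -natrX ler_nat.
  by apply: leq_trans (leqnSn k) _; rewrite expnS leq_pmulr.
rewrite mulrDl mul1r ler_norml; move: up lo le le1 kk eps_le.
move: (k.+1%:R ^+ 2 * eta) (k%:R * eta) (smu k (mkop T)) (lam es) => X Y m l *.
by split; last (apply/andP; split); lra.
Qed.

End Greedy.

Lemma greedy_tr T (M eta eps : R) es (N : nat) : hpos T ->
  (forall x, nrm (T x) <= M * nrm x) -> 0 < eta -> eps <= eta ->
  eps * M <= eta ^+ 2 -> greedy T eps es -> (size es <= N)%N ->
  cabs (tr T es - (\sum_(k < size es) smu k (mkop T))%:C%C)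
    <= (size es)%:R * ((N.+1%:R ^+ 2 + 1) * eta).
Proof.
move=> pT TM eta0 le_e eM; elim: es => [|e es IH] g sN.
  by rewrite /tr big_nil big_ord0 subrr cabs0 mul0r.
rewrite /tr big_cons -/(tr T es) /= big_ord_recr /= rmorphD /= hpos_real //.
have [ges _ _ _] := g.
set a := complex.Re _; set s := \sum_(_ < _) _; set m := smu _ _.
have -> : a%:C%C + tr T es - (s%:C%C + m%:C%C) = (tr T es - s%:C%C) + (a - m)%:C%C.
  by rewrite rmorphB; ring.
apply: le_trans (cabsD _ _) _; rewrite -natr1 mulrDl mul1r; apply: lerD.
  by apply: IH => //; exact: ltnW.
rewrite cabs_real; have [_ h] := greedy_smu pT TM eta0 le_e eM g.
apply: le_trans h _; rewrite ler_pM2r // lerD2r lerXn2r ?nnegrE //.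
by rewrite ler_nat ltnS ltnW.
Qed.

(** With [N = 2 ^ n - 1] greedy vectors, [T] off the family is governed by [smu N], and
    [N.+1 = 2 ^ n] turns the ideal bound into [smu N <= B / 2 ^ n]. *)
Lemma partial_trace_pos T : hpos T -> L1inf (mkop T) ->
  partial_trace T (fun n => (\sum_(k < (2 ^ n).-1) smu k (mkop T))%:C%C).
Proof.
move=> pT [_ _ [B TB]]; have [bT _] := pT.
have [M [M0 TM]] := blin_bound bT.
have B0 : 0 <= B by apply: le_trans (TB 0%N); rewrite mulr_ge0 ?smu_ge0.
(* [B] bounds [2 ^ n * smu N]; the remaining room absorbs the greedy errors, each at most one unit
   of [2 ^ - n]. *)
pose K := (Num.truncn (B + 3)).+1.
have BK : B + 3 <= K%:R by exact/ltW/truncnS_gt.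
exists K => n; set N := (2 ^ n).-1.
have NE : N.+1 = (2 ^ n)%N by rewrite prednK ?expn_gt0.
have NR : N.+1%:R = 2 ^+ n :> R by rewrite NE natrX.
(* Cubic, since each of the [N] diagonal entries carries an error of [N.+1 ^ 2 + 1] times [eta] and
   the total must stay bounded. *)
pose eta : R := (N.+2%:R ^+ 3)^-1.
have eta0 : 0 < eta by rewrite invr_gt0 exprn_gt0.
pose eps := Num.min eta (eta ^+ 2 / (M + 1)).
have M1 : 0 < M + 1 by rewrite ltr_wpDl.
have eps0 : 0 < eps by rewrite lt_min eta0 divr_gt0 ?exprn_gt0.
have le_e : eps <= eta by rewrite ge_min lexx.
have eM : eps * M <= eta ^+ 2.
  apply: (@le_trans _ _ (eta ^+ 2 / (M + 1) * (M + 1))); last by rewrite divfK ?gt_eqF.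
  by apply: ler_pM; rewrite ?(ltW eps0) ?lerDl // ge_min lexx orbT.
(* One vector more than the family uses: [greedy_smu] bounds [lam es] through the extension
   [e :: es]. *)
have [es' g' s'] := greedy_exists TM eps0 N.+1.
case: es' g' s' => // e es g [sN]; have [ges _ _ _] := g; have oe := greedy_onf ges.
pose E := (N.+1%:R ^+ 2 + 1) * eta.
have EN : E <= N.+2%:R^-1.
  have b0 : 0 < N.+2%:R :> R by [].
  apply: (@le_trans _ _ (N.+2%:R ^+ 2 * eta)); last first.
    by rewrite /eta le_eqVlt; apply/orP; left; apply/eqP; field; rewrite gt_eqF.
  rewrite ler_pM2r // -(natr1 N.+1); have : 0 <= N.+1%:R :> R by [].
  by move: (N.+1%:R) => a a0; rewrite sqrrD mulr1 expr1n; lra.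
have E2 : E <= (2 ^+ n)^-1.
  apply: le_trans EN _; rewrite -NR lef_pV2 ?posrE ?ltr0n // ler_nat; lia.
exists es; split; last first.
  have := greedy_tr pT TM eta0 le_e eM ges (eq_leq sN); rewrite sN => h.
  apply: le_trans (_ : cabs (tr T es - (\sum_(k < N) smu k (mkop T))%:C%C) <= _).
    by rewrite -cabsN opprB.
  apply: le_trans h _; rewrite -/E.
  apply: (@le_trans _ _ (N.+2%:R * N.+2%:R^-1)).
    apply: ler_pM; rewrite ?ler_nat //; first by rewrite mulr_ge0 ?addr_ge0 ?sqr_ge0 // ltW.
    lia.
  rewrite mulfV ?pnatr_eq0 //; move: BK; lra.
split=> //.
  by rewrite sN -NE /K; nia.
have [lamE _] := greedy_smu pT TM eta0 le_e eM g.
rewrite sN in lamE.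
have muN : smu N (mkop T) <= B / 2 ^+ n.
  by rewrite ler_pdivlMr ?exprn_gt0 // mulrC -NR.
have N2 : N%:R * eta <= E.
  rewrite ler_pM2r // -natrX natr1 ler_nat; nia.
have sm y : perp es y -> nrm (T y) <= K%:R / 2 ^+ n * nrm y.
  move=> py; have := greedy_upper pT TM eta0 eM ges py; rewrite sN => h.
  apply: le_trans h _; rewrite ler_wpM2r ?nrm_ge0 //.
  apply: (@le_trans _ _ ((B + 3) / 2 ^+ n)); last by rewrite ler_pM2r ?invr_gt0 ?exprn_gt0.
  have z0 : 0 <= (2 ^+ n)^-1 :> R by rewrite invr_ge0 exprn_ge0.
  move: lamE muN N2 E2 le_e z0; rewrite /E [(B + 3) / _]mulrDl [(_ + 1) * eta]mulrDl mul1r.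
  move: (2 ^+ n)^-1 (B / _) (_ ^+ 2 * eta) (N%:R * eta) (smu _ _) (lam _ _).
  by move=> z u v w m l *; lra.
move=> x px; split; first exact: sm.
move=> y; rewrite hpos_sym // cabs_conj; apply: le_trans (dot_CS _ _) _.
by rewrite mulrAC ler_wpM2r ?nrm_ge0 // sm.
Qed.

End PositiveOperators.

(** * Extended limits of sequences and window averages *)

Section ExtendedLimit.
Variable R : realType.
Implicit Types u v f g : nat -> R.

Definition bdd u := exists M, forall n, `|u n| <= M.

(** The image ultrafilter has a cluster point in the compact segment [[- M, M]], and an ultrafilter
    converges to its cluster points. *)
Lemma ultra_cvg (G : set_system nat) u : UltraFilter G -> bdd u -> cvg (u @ G).
Proof.
move=> uG [M uM].
have GM : (u @ G) `[- M, M]%classic.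
  apply: (@filterS _ G _ setT); last exact: filterT.
  by move=> n _ /=; rewrite in_itv /= -ler_norml.
have [p [_ cp]] := segment_compact (fmap_proper_filter u ultra_proper) GM.
suff up : u @ G --> p by apply/cvg_ex; exists p.
move=> V Vp; have [//|GC] := in_ultra_setVsetC (u @^-1` V) uG.
have [x [Vx nVx]] := cp (~` V) V GC Vp.
by case: (Vx nVx).
Qed.

Definition seq_ext_lim (L : (nat -> R) -> R) :=
  [/\ forall a u v, bdd u -> bdd v -> L (fun n => a * u n + v n) = a * L u + L v,
      forall u, bdd u -> (forall n, 0 <= u n) -> 0 <= L u &
      forall u l, u @ \oo --> l -> L u = l].

Lemma exists_seq_ext_lim : exists L, seq_ext_lim L.
Proof.
have [G [uG oG]] := @ultraFilterLemma nat \oo _.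
exists (fun u => lim (u @ G)); split.
- move=> a u v /(ultra_cvg uG) cu /(ultra_cvg uG) cv.
  rewrite (_ : (fun n => _) = (a *: u) + v) // limD //; last exact: is_cvgZl_tmp.
  congr (_ + _); rewrite (_ : a *: u = cst a \* u) // limM //; last exact: is_cvg_cst.
  by rewrite lim_cst.
- move=> u /(ultra_cvg uG) cu u0; apply: limr_ge => //.
  exact: nearW.
- move=> u l ul; apply: cvg_lim => //.
  by move=> V Vl; apply: oG; exact: ul.
Qed.

(* The window [a m, a m + m] is a range of dyadic levels, hence its logarithmic length
   is [m * ln 2]; the division by zero at [m = 0] is irrelevant. *)
Definition win (a : nat -> nat) f m : R := (f (a m + m)%N - f (a m)) / (m%:R * ln 2).

Definition slow f := exists M, forall n, `|f n.+1 - f n| <= M.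

Lemma slow_le f M n m : (forall n, `|f n.+1 - f n| <= M) -> `|f (n + m)%N - f n| <= M * m%:R.
Proof.
move=> fM; elim: m => [|m IH]; first by rewrite addn0 subrr normr0 mulr0.
rewrite addnS -natr1 mulrDr mulr1 -(subrK (f (n + m)%N) (f _)) -addrA addrC.
by apply: le_trans (ler_normD _ _) _; rewrite lerD.
Qed.

Lemma ln2_gt0 : 0 < ln 2 :> R.
Proof. by rewrite ln_gt0 // ltr1n. Qed.

Lemma bdd_win a f : slow f -> bdd (win a f).
Proof.
move=> [M fM]; have M0 : 0 <= M by apply: le_trans (fM 0%N).
exists (M / ln 2) => m; rewrite /win; have l2 := ln2_gt0.
have [->|mp] := posnP m; first by rewrite mul0r invr0 mulr0 normr0 divr_ge0 // ltW.
have m0 : 0 < m%:R :> R by rewrite ltr0n.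
rewrite normrM normfV [X in _ / X]ger0_norm ?mulr_ge0 ?(ltW l2) //.
rewrite ler_pdivrMr ?mulr_gt0 //.
rewrite (_ : M / _ * _ = M * m%:R); last by field; rewrite gt_eqF.
exact: slow_le.
Qed.

Lemma cvg_inv_nat (c : R) : (fun m => c / m%:R) @ \oo --> 0.
Proof.
have h : cst c \* harmonic @ \oo --> c * 0.
  by apply: cvgM; [exact: cvg_cst|exact: cvg_harmonic].
by rewrite -(cvg_shiftS (fun m => c / m%:R)); rewrite mulr0 in h.
Qed.

(** The errors at the two ends of a window add up to at most [2 * M], against a denominator
    [m * ln 2]. *)
Lemma win_bounded_diff a f g M : (forall n, `|f n - g n| <= M) ->
  (fun m => win a f m - win a g m) @ \oo --> 0.
Proof.
move=> fgM; have M0 : 0 <= M by apply: le_trans (fgM 0%N).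
apply/norm_cvg0P; have l2 := ln2_gt0.
apply: (squeeze_cvgr _ (cvg_cst 0) (@cvg_inv_nat (2 * M / ln 2))).
apply: nearW => m; rewrite normr_ge0 /=.
have [->|mp] := posnP m; first by rewrite /win mul0r !invr0 !mulr0 subrr normr0.
have m0 : 0 < m%:R :> R by rewrite ltr0n.
rewrite /win -mulrBl normrM normfV [X in _ / X]ger0_norm ?mulr_ge0 ?(ltW l2) //.
rewrite ler_pdivrMr ?mulr_gt0 //.
rewrite (_ : 2 * M / _ / _ * _ = M + M); last by field; rewrite !gt_eqF.
rewrite (_ : _ - _ = (f (a m + m)%N - g (a m + m)%N) - (f (a m) - g (a m))); last by ring.
by apply: le_trans (ler_normB _ _) _; rewrite lerD.
Qed.

Lemma slow_comb c f g : slow f -> slow g -> slow (fun n => c * f n + g n).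
Proof.
move=> [M fM] [N gN]; exists (`|c| * M + N) => n.
rewrite (_ : _ - _ = c * (f n.+1 - f n) + (g n.+1 - g n)); last by ring.
apply: le_trans (ler_normD _ _) _; rewrite normrM lerD //.
by rewrite ler_wpM2l.
Qed.

Section Windows.
Variables (L : (nat -> R) -> R) (hL : seq_ext_lim L) (a : nat -> nat).

Definition Lw f := L (win a f).

Lemma Lw_comb c f g : slow f -> slow g -> Lw (fun n => c * f n + g n) = c * Lw f + Lw g.
Proof.
move=> /(bdd_win a) bf /(bdd_win a) bg; have [lin _ _] := hL.
rewrite /Lw -lin //; congr L; apply/funext => m; rewrite /win.
by rewrite mulrA -mulrDl; congr (_ / _); ring.
Qed.

Lemma Lw_bounded_diff f g M : slow f -> slow g -> (forall n, `|f n - g n| <= M) -> Lw f = Lw g.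
Proof.
move=> sf sg fgM; have [lin _ lim0] := hL.
have := lim0 _ _ (win_bounded_diff a fgM).
have bg : bdd (win a g) by exact: bdd_win.
have bf : bdd (win a f) by exact: bdd_win.
rewrite (_ : (fun m => _) = (fun m => (-1) * win a g m + win a f m)).
  by rewrite lin // => h; rewrite /Lw; lra.
by apply/funext => m; rewrite mulN1r addrC.
Qed.

Lemma Lw_ge0 f : slow f -> {homo f : n m / (n <= m)%N >-> n <= m} -> 0 <= Lw f.
Proof.
move=> sf hf; have [_ pos _] := hL; apply: pos; first exact: bdd_win.
move=> m; apply: divr_ge0; last by rewrite mulr_ge0 // ltW ?ln2_gt0.
by rewrite subr_ge0 hf ?leq_addr.
Qed.

Lemma Lw_cvg f l : win a f @ \oo --> l -> Lw f = l.
Proof. by have [_ _ h] := hL; exact: h. Qed.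

Lemma Lw0 : Lw (fun=> 0) = 0.
Proof.
apply: Lw_cvg; rewrite (_ : win _ _ = cst 0); first exact: cvg_cst.
by apply/funext => m; rewrite /win subrr mul0r.
Qed.

End Windows.

Lemma harmonic_sum_ge n : ln n.+1%:R <= \sum_(k < n) k.+1%:R^-1 :> R.
Proof.
elim: n => [|n IH]; first by rewrite big_ord0 ln1.
rewrite big_ord_recr /=; have n0 : 0 < n.+1%:R :> R by [].
(* The step is [ln (1 + x) <= x] at [x = n.+1^-1]; the upper bound below uses it at
   [x = - n.+2^-1]. *)
have -> : n.+2%:R = n.+1%:R * (1 + n.+1%:R^-1) :> R.
  by rewrite mulrDr mulr1 mulfV ?gt_eqF // natr1.
rewrite lnM ?posrE ?addr_gt0 ?invr_gt0 // lerD // le_ln1Dx //.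
by rewrite (@lt_trans _ _ 0) ?invr_gt0 // ltrN10.
Qed.

Lemma harmonic_sum_le n : \sum_(k < n.+1) k.+1%:R^-1 <= 1 + ln n.+1%:R :> R.
Proof.
elim: n => [|n IH]; first by rewrite big_ord1 ln1 addr0 invr1.
rewrite big_ord_recr /= -lerBrDr; apply: le_trans IH _.
have n0 : 0 < n.+1%:R :> R by []; have n2 : 0 < n.+2%:R :> R by [].
have -> : n.+1%:R = n.+2%:R * (1 - n.+2%:R^-1) :> R.
  by rewrite mulrBr mulr1 mulfV ?gt_eqF // -[n.+2%:R]natr1 addrK.
have n1 : n.+2%:R^-1 < 1 :> R by rewrite invf_lt1 // ltr1n.
rewrite lnM ?posrE ?subr_gt0 // -addrA lerD2l lerD2l.
by apply: le_ln1Dx; rewrite ltrN2.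
Qed.

Lemma harmonic_dyadic n :
  `|\sum_(k < (2 ^ n).-1) k.+1%:R^-1 - n%:R * ln 2| <= 1 :> R.
Proof.
have e : n%:R * ln 2 = ln (2 ^ n).-1.+1%:R :> R.
  by rewrite prednK ?expn_gt0 // natrX lnXn // mulr_natl.
rewrite e; case: (2 ^ n).-1 => [|m].
  by rewrite big_ord0 ln1 subrr normr0.
have h1 := harmonic_sum_ge m.+1; have h2 := harmonic_sum_le m.
have h3 : ln m.+1%:R <= ln m.+2%:R :> R by rewrite ler_ln ?posrE // ler_nat.
by rewrite ger0_norm ?subr_ge0 //; lra.
Qed.

End ExtendedLimit.

(** * Window averages are positive normalised traces *)

Section WindowTrace.
Variable R : realType.
Local Notation C := R[i].
Local Notation H := (hil R).
Implicit Types (T : H -> H) (t : nat -> C).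
Variables (L : (nat -> R) -> R) (hL : seq_ext_lim L) (a : nat -> nat).

Definition window_value t : C :=
  Complex (Lw L a (fun n => complex.Re (t n))) (Lw L a (fun n => complex.Im (t n))).

(** The choice of [t] is immaterial by [window_traceE]; the default sequence [0] is met only outside
    the ideal. *)
Definition window_trace (A : op R) : C :=
  window_value (xget (fun=> 0)
    [set t | exists T, [/\ A = mkop T, blin T & partial_trace T t]]).

Lemma normRe_le_cabs (z : C) : `|complex.Re z| <= cabs z.
Proof.
by rewrite ler_norml Re_le_cabs lerNl ReN_le_cabs.
Qed.

Lemma normIm_le_cabs (z : C) : `|complex.Im z| <= cabs z.
Proof.
have := normRe_le_cabs ('i%C * z); rewrite cabsM.
rewrite cabs_i.
by case: z => x y; rewrite /= mul0r !mul1r sub0r normrN.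
Qed.

Lemma partial_trace_slow T t : lin T -> partial_trace T t ->
  slow (fun n => complex.Re (t n)) /\ slow (fun n => complex.Im (t n)).
Proof.
move=> lT /(partial_trace_step lT) [M tM]; split; exists M => n;
  apply: le_trans (tM n); rewrite -raddfB.
- exact: normRe_le_cabs.
- exact: normIm_le_cabs.
Qed.

Lemma window_traceE T t : blin T -> partial_trace T t ->
  window_trace (mkop T) = window_value t.
Proof.
move=> bT ht; have [lT _] := bT; rewrite /window_trace.
case: xgetP => [s _ [S [/mkop_inj <- _ hs]]|/(_ t) []]; last by exists T.
have [M tM] := partial_trace_unique lT hs ht.
have [sR sI] := partial_trace_slow lT hs; have [tR tI] := partial_trace_slow lT ht.
rewrite /window_value; congr Complex; apply: (Lw_bounded_diff hL) => // n;
  apply: le_trans (tM n); rewrite -raddfB.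
- exact: normRe_le_cabs.
- exact: normIm_le_cabs.
Qed.

Lemma window_value_comb (c : C) T S t s : lin T -> lin S ->
  partial_trace T t -> partial_trace S s ->
  window_value (fun n => c * t n + s n) = c * window_value t + window_value s.
Proof.
move=> lT lS /(partial_trace_slow lT) [tR tI] /(partial_trace_slow lS) [sR sI].
case: c => x y; rewrite /window_value; apply/eqP; rewrite eq_complex /=.
have e1 : (fun n => complex.Re ((x +i* y)%C * t n + s n)) =
    (fun n => x * complex.Re (t n) + (- y * complex.Im (t n) + complex.Re (s n))).
  by apply/funext => n; case: (t n) (s n) => p q [p' q'] /=; ring.
have e2 : (fun n => complex.Im ((x +i* y)%C * t n + s n)) =
    (fun n => x * complex.Im (t n) + (y * complex.Re (t n) + complex.Im (s n))).
  by apply/funext => n; case: (t n) (s n) => p q [p' q'] /=; ring.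
rewrite e1 e2 !(Lw_comb hL) //; try exact: slow_comb.
by apply/andP; split; apply/eqP; ring.
Qed.

Lemma window_trace_pos T : hpos T -> L1inf (mkop T) -> window_trace (mkop T) =
  (Lw L a (fun n => \sum_(k < (2 ^ n).-1) smu k (mkop T)))%:C%C.
Proof.
move=> pT LT; have [bT _] := pT.
rewrite (window_traceE bT (partial_trace_pos pT LT)) /window_value /=.
by rewrite (Lw0 hL).
Qed.

Lemma slow_smu T : hpos T -> L1inf (mkop T) ->
  slow (fun n => \sum_(k < (2 ^ n).-1) smu k (mkop T)).
Proof.
move=> pT LT; have [[lT _] _] := pT.
by have [] := partial_trace_slow lT (partial_trace_pos pT LT).
Qed.

Lemma window_trace_PT : PT window_trace.
Proof.
split.
- split.
    move=> c A B /L1inf_dyadic[T [bT -> [K dT]]] /L1inf_dyadic[S [bS -> [K' dS]]].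
    have [t ht] := partial_trace_exists dT; have [s hs] := partial_trace_exists dS.
    have [lT _] := bT; have [lS _] := bS.
    rewrite opcomb_mkop (window_traceE (blin_comb c bT bS) (partial_trace_comb c lT lS ht hs)).
    by rewrite (window_traceE bT ht) (window_traceE bS hs) (window_value_comb c lT lS ht hs).
  move=> _ _ A /unitary_pairP[u [v [-> -> bu bv hu]]] /L1inf_dyadic[T [bT -> [K dT]]].
  have [t ht] := partial_trace_exists dT; have [lT _] := bT; have [lu _] := bu.
  have bUT := blin_comp bu bT.
  rewrite comp_mkop // comp_mkop; last by case: bUT.
  rewrite (window_traceE bT ht) (window_traceE (blin_comp bUT bv)
    (partial_trace_unitary hu lT ht)) //.
- move=> A LA /pos_opP[T pT AT]; rewrite AT in LA *.
  rewrite window_trace_pos // ler0c; apply: (Lw_ge0 hL); first exact: slow_smu.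
  move=> n m nm; have le : ((2 ^ n).-1 <= (2 ^ m).-1)%N.
    by rewrite -ltnS !prednK ?expn_gt0 // leq_exp2l.
  rewrite (big_ord_widen _ (fun k => smu k (mkop T)) le) big_mkcond.
  by apply: ler_sum => k _; case: ifP => // _; apply: smu_ge0; case: pT.
- move=> A LA /pos_opP[T pT AT] mu; rewrite AT in LA mu *.
  rewrite window_trace_pos //; congr (_%:C%C).
  under eq_fun do under eq_bigr do rewrite mu.
  have sl : slow (fun n => n%:R * ln 2 : R).
    by exists `|ln 2| => n; rewrite -mulrBl -natr1 addrC addKr mul1r.
  have sh : slow (fun n => \sum_(k < (2 ^ n).-1) k.+1%:R^-1 : R).
    have := slow_smu pT LA; under eq_fun do under eq_bigr do rewrite mu.
    by [].
  (* The harmonic sums are replaced by [n * ln 2], whose window averages equal [1] as soon as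
     [m >= 1]. *)
  rewrite (Lw_bounded_diff hL a sh sl (@harmonic_dyadic R)).
  apply: (Lw_cvg hL); apply: (@cvg_near_cst _ R).
  exists 1%N => // m /= m1; rewrite /win natrD -mulrBl addrAC subrr add0r divff //.
  by rewrite mulf_neq0 ?gt_eqF ?ln2_gt0 // ltr0n.
Qed.

End WindowTrace.

(** * Completeness and limits of operators *)

Section Completeness.
Variable R : realType.
Local Notation C := R[i].
Local Notation H := (hil R).

Lemma pow2_small (c e : R) (m : nat) : 0 < e -> exists2 n, (m <= n)%N & c / 2 ^+ n <= e.
Proof.
move=> e0; pose n := (Num.truncn `|c / e|).+1; exists (m + n)%N; first exact: leq_addr.
rewrite ler_pdivrMr ?exprn_gt0 // mulrC -ler_pdivrMr //.
apply: le_trans (ler_norm _) _; apply: ltW; apply: lt_le_trans (truncnS_gt _) _.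
by rewrite -natrX ler_nat (leq_trans (ltnW (ltn_expl n (isT : (1 < 2)%N)))) // leq_exp2l // leq_addl.
Qed.

(** The limit is the supremum of the lower bounds [r m - e m], for which each [r k + e k] is an
    upper bound; the rate [e] is kept without loss. *)
Lemma real_limit (r e : nat -> R) :
  (forall m n, (m <= n)%N -> `|r n - r m| <= e m) ->
  exists l, forall m, `|l - r m| <= e m.
Proof.
move=> re; pose A := range (fun m => r m - e m).
have ub k : ubound A (r k + e k).
  move=> _ [m _ <-]; have [mk|km] := leqP m k.
    have /ler_normlP[] := re _ _ mk; have := re k k (leqnn k); rewrite subrr normr0; lra.
  have /ler_normlP[] := re _ _ (ltnW km); have := re m m (leqnn m); rewrite subrr normr0; lra.
exists (sup A) => m; rewrite ler_norml; apply/andP; split.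
  rewrite lerBrDr addrC; apply: ub_le_sup; first by exists (r 0%N + e 0%N); exact: ub.
  by exists m.
by rewrite lerBlDr addrC; apply: ge_sup (ub m); exists (r m - e m), m.
Qed.

Lemma hil_limit (x : nat -> H) (c : R) :
  (forall m n, (m <= n)%N -> nrm (x n - x m) <= c / 2 ^+ m) ->
  exists y, forall m, nrm (y - x m) <= c / 2 ^+ m.
Proof.
move=> xc; pose e m := c / 2 ^+ m.
have e0 m : 0 <= e m by apply: le_trans (nrm_ge0 _) (xc m m (leqnn m)).
have xk m n k : (m <= n)%N -> cabs (x n k - x m k) <= e m.
  move=> mn; have -> : x n k - x m k = dot (x n - x m) (delta R k) by rewrite dot_delta.
  apply: le_trans (dot_CS _ _) _; by rewrite nrm_delta mulr1 xc.
have lim_re k : exists l, forall m, `|l - complex.Re (x m k)| <= e m.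
  apply: real_limit => m n mn; rewrite -raddfB.
  by apply: le_trans (xk _ _ k mn); exact: normRe_le_cabs.
have lim_im k : exists l, forall m, `|l - complex.Im (x m k)| <= e m.
  apply: real_limit => m n mn; rewrite -raddfB.
  by apply: le_trans (xk _ _ k mn); exact: normIm_le_cabs.
have /choice [p hp] := lim_re; have /choice [q hq] := lim_im.
pose y k : C := Complex (p k) (q k).
have yk m k : cabs (y k - x m k) <= 2 * e m.
  have -> : y k - x m k = (p k - complex.Re (x m k))%:C%C + 'i%C * (q k - complex.Im (x m k))%:C%C.
    by case: (x m k) => u v; apply/eqP; rewrite eq_complex /=; apply/andP; split; apply/eqP; ring.
  apply: le_trans (cabsD _ _) _; rewrite cabsM !cabs_real.
  rewrite cabs_i.
  by rewrite mul1r mulrDl mul1r lerD.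
(* Passage from coordinates to the norm: a truncation to [N] coordinates is compared with [x n] for
   [n] so large that the coordinatewise errors, [N] times [2 * e n], stay below [d]. *)
have fin m N : \sum_(k < N) csq (y k - x m k) <= e m ^+ 2.
  rewrite -(nrm_comb_delta N (fun k => y k - x m k)) lerXn2r ?nnegrE ?nrm_ge0 //.
  apply/ler_addgt0Pr => d d0.
  have [n mn hn] := @pow2_small ((2 * N%:R) * c) d m d0.
  have -> : \sum_(k < N) (y k - x m k) *: delta R k =
      \sum_(k < N) (y k - x n k) *: delta R k + proj (deltas R N) (x n - x m).
    rewrite proj_deltas -big_split /=; apply: eq_bigr => k _.
    rewrite -scalerDl; congr (_ *: _).
    by rewrite -[RHS]/(y k - x n k + (x n k - x m k)) addrA subrK.
  apply: le_trans (nrmD _ _) _; rewrite addrC; apply: lerD.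
    exact: le_trans (nrm_proj _ (onf_deltas R N)) (xc _ _ mn).
  apply: le_trans (nrm_sum _ _ _) _.
  apply: (@le_trans _ _ (\sum_(k < N) 2 * e n)).
    by apply: ler_sum => k _; rewrite nrmZ nrm_delta mulr1.
  rewrite sumr_const card_ord -mulr_natl /e; apply: le_trans hn.
  by rewrite le_eqVlt; apply/orP; left; apply/eqP; ring.
have lm m : l2 (fun k => y k - x m k) by exists (e m ^+ 2) => N; exact: fin.
(* The limit is recovered as an element of [hil] from the square summable [y - x 0]. *)
exists (mkhil (lm 0%N) + x 0%N) => m.
have E : mkhil (lm 0%N) + x 0%N - x m = mkhil (lm m).
  by apply: hilP => k; rewrite !hilDE hilNE /= subrK.
rewrite E -(@ler_pXn2r _ 2) ?nnegrE ?nrm_ge0 ?e0 // sqr_nrm; apply: rsum_le; last exact: fin.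
exact/l2_summable/hil_l2.
Qed.

Lemma blin_limit (S : nat -> H -> H) (c : R) : (forall m, blin (S m)) ->
  (forall m x, nrm (S m.+1 x - S m x) <= c / 2 ^+ m * nrm x) ->
  exists2 B, blin B & forall m x, nrm (B x - S m x) <= 2 * c / 2 ^+ m * nrm x.
Proof.
move=> bS Sc.
(* A partial geometric sum; keeping the factor [1 - 2 ^ - j] is what closes the induction. *)
have tel x m j : nrm (S (m + j)%N x - S m x) <= 2 * c * nrm x / 2 ^+ m * (1 - (2 ^+ j)^-1).
  elim: j => [|j IH]; first by rewrite addn0 subrr nrm0 expr0 invr1 subrr mulr0.
  rewrite addnS -(subrK (S (m + j)%N x) (S _ x)) -addrA.
  apply: le_trans (nrmD _ _) _; apply: le_trans (lerD (Sc _ _) IH) _.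
  rewrite exprD exprS le_eqVlt; apply/orP; left; apply/eqP.
  by field; rewrite !expf_neq0.
have c0 x : 0 <= c * nrm x.
  by have := Sc 0%N x; rewrite expr0 divr1; apply: le_trans; exact: nrm_ge0.
have lim x : exists y, forall m, nrm (y - S m x) <= 2 * c * nrm x / 2 ^+ m.
  apply: hil_limit => m n /subnKC <-; apply: le_trans (tel x m _) _.
  apply: ler_piMr; last by rewrite gerBl invr_ge0 exprn_ge0.
  by rewrite divr_ge0 ?exprn_ge0 // -mulrA mulr_ge0.
have /choice [B hB] := lim; exists B; last first.
  by move=> m x; apply: le_trans (hB x m) _; rewrite mulrAC.
split.
  move=> a x y; apply/eqP; rewrite -subr_eq0 -nrm_eq0 eq_le nrm_ge0 andbT.
  apply/ler_addgt0Pr => d d0; rewrite add0r.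
  pose K := 2 * c * nrm (a *: x + y) + cabs a * (2 * c * nrm x) + 2 * c * nrm y.
  have [m _ hm] := @pow2_small K d 0 d0; apply: le_trans hm.
  have [lS _] := bS m.
  have -> : B (a *: x + y) - (a *: B x + B y) =
      (B (a *: x + y) - S m (a *: x + y)) - a *: (B x - S m x) - (B y - S m y).
    by rewrite lS scalerBr; apply: hilP => k; rewrite !(hilDE, hilNE, hilZE); ring.
  apply: le_trans (nrmB _ _) _; rewrite /K mulrDl; apply: lerD; last exact: hB.
  rewrite mulrDl; apply: le_trans (nrmB _ _) _; apply: lerD; first exact: hB.
  by rewrite nrmZ -mulrA ler_wpM2l ?cabs_ge0.
have [N [_ SN]] := blin_bound (bS 0%N).
exists (2 * c + N) => x; rewrite -(subrK (S 0%N x) (B x)) mulrDl.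
apply: le_trans (nrmD _ _) _; apply: lerD => //.
by have := hB x 0%N; rewrite expr0 divr1.
Qed.

End Completeness.

(** * The ideal is spanned by its positive operators *)

Section PositiveSpan.
Variable R : realType.
Local Notation C := R[i].
Local Notation H := (hil R).
Implicit Types (x y : H) (T S B : H -> H).

Lemma dyadic_comb a T S K L : lin T -> lin S -> dyadic K T -> dyadic L S ->
  exists N, dyadic N (fun x => a *: T x + S x).
Proof.
move=> lT lS /partial_trace_exists[t ht] /partial_trace_exists[s hs].
exact: partial_trace_dyadic (partial_trace_comb a lT lS ht hs).
Qed.

Lemma dot_adjC T x y : blin T -> dot (adj T y) x = (dot (T x) y)^*.
Proof. by move=> bT; rewrite dotC -dot_adj. Qed.

Lemma dyadic_adj K T : blin T -> dyadic K T -> dyadic K (adj T).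
Proof.
move=> bT dT n; have [es [oe se sm]] := dT n; exists es; split=> // x /sm [h1 h2].
split; last first.
  move=> y; rewrite dot_adjC // cabs_conj; apply: le_trans (dot_CS _ _) _.
  by rewrite mulrAC ler_wpM2r ?nrm_ge0.
apply: nrm_le_dot; first by rewrite mulr_ge0 ?nrm_ge0 // divr_ge0 ?exprn_ge0.
by move=> y; rewrite dot_adjC // cabs_conj mulrAC.
Qed.

(** In effect [small2] with bound [0]: the range and the range of the adjoint lie in the span of
    [es]. *)
Definition supported (es : seq H) T :=
  forall x, perp es x -> T x = 0 /\ forall y, dot (T y) x = 0.

Lemma supported_sub es fs T : (forall x, perp fs x -> perp es x) ->
  supported es T -> supported fs T.
Proof. by move=> sub sT x /sub /sT. Qed.

Lemma supported_comb es a T S : supported es T -> supported es S ->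
  supported es (fun x => a *: T x + S x).
Proof.
move=> sT sS x px; have [T1 T2] := sT x px; have [S1 S2] := sS x px; split.
  by rewrite T1 S1 scaler0 addr0.
by move=> y; rewrite dotPl T2 S2 mulr0 addr0.
Qed.

Lemma supported_proj es : supported es (@proj R es).
Proof. by move=> x px; split; [exact: proj_perp|move=> y; exact: dot_proj_perp]. Qed.

Lemma supported_compress es T : lin T -> supported es (fun x => proj es (T (proj es x))).
Proof.
move=> lT x px; split; last by move=> y; exact: dot_proj_perp.
by rewrite (proj_perp px) lin0 // proj_perp // => e _; rewrite dot0l.
Qed.

(** The form of [T] is that of its compression to [es], so it sees only [proj es x]. *)
Lemma supported_dot_le es T (d : R) x : onf es -> lin T -> supported es T ->
  (forall y, nrm (T y) <= d * nrm y) ->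
  cabs (dot (T x) x) <= d * nrm (proj es x) ^+ 2.
Proof.
move=> oe lT sT Td; have pp := perp_subproj x oe; have [T1 T2] := sT _ pp.
have -> : dot (T x) x = dot (T (proj es x)) (proj es x).
  rewrite -{1}(subrK (proj es x) x) linD // T1 add0r.
  by rewrite -{2}(subrK (proj es x) x) dotDr T2 add0r.
by apply: le_trans (dot_CS _ _) _; rewrite expr2 mulrA ler_wpM2r ?nrm_ge0.
Qed.

(* Telescoping the compressions [P_n T P_n] of [T] to the dyadic families, the [n]-th
   difference is supported on [O(2 ^ n)] dimensions and of norm [O(2 ^ - n)], hence
   dominated by a multiple of a projection; [B] is the sum of these multiples. *)
Lemma dyadic_dominated K T : blin T -> dyadic K T -> exists B L,
  [/\ blin B, dyadic L B &
      forall x, complex.Im (dot (B x) x) = 0 /\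
                cabs (dot (T x) x) <= complex.Re (dot (B x) x)].
Proof.
move=> bT /choice [es hes]; have [lT _] := bT.
have [M [M0 TM]] := blin_bound bT.
pose d n : R := K%:R / 2 ^+ n.
have d0 n : 0 <= d n by rewrite divr_ge0 ?exprn_ge0.
have dS n : d n.+1 <= d n.
  by rewrite ler_wpM2l // lef_pV2 ?posrE ?exprn_gt0 // ler_eXn2l ?ltr1n.
have oe n : onf (es n) by have [] := hes n.
pose F n x := proj (es n) (T (proj (es n) x)).
have lF n : lin (F n) by move=> a x y; rewrite /F !(projP, lT).
(* [T - P T P = T (1 - P) + (1 - P) T P], and the two halves of [small2] bound the two terms by
   [d n] each. *)
have FT n x : nrm (T x - F n x) <= 2 * d n * nrm x.
  have [_ _ sm] := hes n.
  rewrite -(subrK (T (proj (es n) x)) (T x)) -addrA mulrDl mulrDl mul1r.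
  apply: le_trans (nrmD _ _) _; apply: lerD.
    rewrite -linB //; have [h _] := sm _ (perp_subproj x (oe n)).
    by apply: le_trans h _; rewrite ler_wpM2l ?d0 ?nrm_subproj.
  apply: le_trans (nrm_subproj_small _ (d0 n) (oe n) sm) _.
  by rewrite ler_wpM2l ?nrm_proj.
(* [fs n] dominates both neighbouring families, of [K * 2 ^ n] and [K * 2 ^ n.+1] vectors at
   most. *)
have /choice [fs hfs] : forall n, exists fs, [/\ onf fs, (size fs <= 3 * K * 2 ^ n)%N &
    forall x, perp fs x -> perp (es n) x /\ perp (es n.+1) x].
  move=> n; have [fs [of_ sf pf]] := gram_schmidt (es n ++ es n.+1).
  exists fs; split=> //; last by move=> x /pf /perp_cat.
  apply: leq_trans sf _; rewrite size_cat.
  have [_ s1 _] := hes n; have [_ s2 _] := hes n.+1.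
  apply: leq_trans (leq_add s1 s2) _; rewrite expnS; nia.
pose G n x := F n.+1 x - F n x.
have lG n : lin (G n).
  by move=> a x y; rewrite /G !lF scalerBr opprD addrACA.
have sG n : supported (fs n) (G n).
  have [_ _ pf] := hfs n => x /pf [p1 p2].
  have [F1 F2] := supported_compress lT p1; have [G1 G2] := supported_compress lT p2.
  rewrite /G /F G1 F1 subrr; split=> // y.
  by rewrite dotBl G2 F2 subrr.
have nG n x : nrm (G n x) <= 4 * d n * nrm x.
  rewrite (_ : G n x = (T x - F n x) - (T x - F n.+1 x)); last first.
    by rewrite opprB [RHS]addrC addrA subrK.
  apply: le_trans (nrmB _ _) _; apply: le_trans (lerD (FT n x) (FT n.+1 x)) _.
  rewrite -mulrDl ler_wpM2r ?nrm_ge0 //; have := dS n; lra.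
(* The term with [M] dominates the first compression, each [4 * d n] times a projection the [n]-th
   difference. *)
pose S m x : H := M%:C%C *: proj (es 0%N) x + \sum_(n < m) (4 * d n)%:C%C *: proj (fs n) x.
have SS m x : S m.+1 x = (4 * d m)%:C%C *: proj (fs m) x + S m x.
  by rewrite /S big_ord_recr /= addrA addrC.
have of_ n : onf (fs n) by have [] := hfs n.
have bS m : blin (S m).
  elim: m => [|m IH].
    rewrite (_ : S 0%N = fun x => M%:C%C *: proj (es 0%N) x + 0).
      by apply: blin_comb; [exact: blin_proj|exact: blin0].
    by apply/funext => x; rewrite /S big_ord0.
  rewrite (_ : S m.+1 = fun x => (4 * d m)%:C%C *: proj (fs m) x + S m x).
    by apply: blin_comb => //; exact: blin_proj.
  by apply/funext => x; exact: SS.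
have [|B bB hB] := @blin_limit R S (4 * K%:R) bS.
  move=> m x; rewrite SS addrK nrmZ cabs_real ger0_norm ?mulr_ge0 //.
  by rewrite mulrA ler_wpM2l ?nrm_proj // -mulrA mulr_ge0.
have pS m x : complex.Im (dot (S m x) x) = 0 /\
    cabs (dot (F m x) x) <= complex.Re (dot (S m x) x).
  elim: m => [|m [IH1 IH2]].
    rewrite /S big_ord0 addr0 dotZl dot_proj_self // -rmorphM /=; split=> //.
    apply: supported_dot_le => //; first exact: supported_compress.
    move=> y; apply: le_trans (nrm_proj _ (oe _)) _; apply: le_trans (TM _) _.
    by rewrite ler_wpM2l ?nrm_proj.
  rewrite SS dotPl dot_proj_self // -rmorphM /=; move: IH1 IH2.
  have -> : dot (F m.+1 x) x = dot (G m x) x + dot (F m x) x by rewrite /G dotBl subrK.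
  have := supported_dot_le x (of_ m) (lG m) (sG m) (nG m).
  have := cabsD (dot (G m x) x) (dot (F m x) x).
  case: (dot (S m x) x) => u v /= h1 h2 -> h3; split; first by rewrite add0r.
  by apply: le_trans h1 _; exact: lerD.
(* The sizes form a geometric sum: the old support and the new projection contribute at most
   [3 * K * 2 ^ m] each. *)
have suppS m : exists gs, [/\ onf gs, (size gs <= 3 * K * 2 ^ m)%N & supported gs (S m)].
  elim: m => [|m [gs [og sg hg]]].
    exists (es 0%N); split=> //; first by have [_ h _] := hes 0%N; apply: leq_trans h _; lia.
    rewrite (_ : S 0%N = fun x => M%:C%C *: proj (es 0%N) x + 0).
      apply: supported_comb; first exact: supported_proj.
      by move=> x _; split=> // y; rewrite dot0l.
    by apply/funext => x; rewrite /S big_ord0.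
  have [hs [oh sh ph]] := gram_schmidt (gs ++ fs m); exists hs; split=> //.
    apply: leq_trans sh _; rewrite size_cat; have [_ s1 _] := hfs m.
    apply: leq_trans (leq_add sg s1) _; rewrite expnS; nia.
  rewrite (_ : S m.+1 = fun x => (4 * d m)%:C%C *: proj (fs m) x + S m x).
    apply: supported_comb.
      by apply: supported_sub (@supported_proj _) => x /ph /perp_cat [].
    by apply: supported_sub hg => x /ph /perp_cat [].
  by apply/funext => x; exact: SS.
(* [8 * K] is the rate [2 * (4 * K)] supplied by [blin_limit], and it also covers the size constant
   [3 * K]. *)
exists B, (8 * K)%N; split=> //.
  move=> n; have [gs [og sg hg]] := suppS n; exists gs; split=> //.
    by apply: leq_trans sg _; rewrite -!mulnA leq_mul.
  have E : 2 * (4 * K%:R) / 2 ^+ n = (8 * K)%:R / 2 ^+ n :> R.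
    by rewrite natrM mulrA -natrM.
  move=> x /hg [S1 S2]; split; first by have := hB n x; rewrite S1 subr0 E.
  move=> y; have -> : dot (B y) x = dot (B y - S n y) x by rewrite dotBl S2 subr0.
  apply: le_trans (dot_CS _ _) _; rewrite ler_wpM2r ?nrm_ge0 // -E; exact: hB.
move=> x.
have close m : cabs (dot (B x) x - dot (S m x) x) <= 2 * (4 * K%:R) * nrm x ^+ 2 / 2 ^+ m.
  rewrite -dotBl; apply: le_trans (dot_CS _ _) _.
  apply: (@le_trans _ _ (2 * (4 * K%:R) / 2 ^+ m * nrm x * nrm x)).
    by rewrite ler_wpM2r ?nrm_ge0.
  by rewrite le_eqVlt; apply/orP; left; apply/eqP; ring.
split.
  apply/eqP; rewrite -normr_eq0 eq_le normr_ge0 andbT; apply/ler_addgt0Pr => e e0.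
  rewrite add0r; have [m _ hm] := pow2_small (2 * (4 * K%:R) * nrm x ^+ 2) 0 e0.
  apply: le_trans (le_trans (close m) hm); apply: le_trans (normIm_le_cabs _).
  by rewrite raddfB /= (pS m x).1 subr0.
apply/ler_addgt0Pr => e e0.
have [m _ hm] := pow2_small ((2 * (4 * K%:R) + 2 * K%:R) * nrm x ^+ 2) 0 e0.
have [_ h] := pS m x; have c := close m.
have f : cabs (dot (T x) x - dot (F m x) x) <= 2 * K%:R * nrm x ^+ 2 / 2 ^+ m.
  rewrite -dotBl; apply: le_trans (dot_CS _ _) _.
  apply: (@le_trans _ _ (2 * d m * nrm x * nrm x)).
    by rewrite ler_wpM2r ?nrm_ge0.
  by rewrite /d le_eqVlt; apply/orP; left; apply/eqP; ring.
have ReB (z w : C) : complex.Re (z - w) = complex.Re z - complex.Re w by case: z; case: w.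
have g := le_trans (ReN_le_cabs _) c; rewrite ReB in g.
have k := cabsD (dot (T x) x - dot (F m x) x) (dot (F m x) x); rewrite subrK in k.
have {}hm : 2 * (4 * K%:R) * nrm x ^+ 2 / 2 ^+ m + 2 * K%:R * nrm x ^+ 2 / 2 ^+ m <= e.
  by rewrite -!mulrDl.
set u := 2 * (4 * K%:R) * _ / _ in g hm; set v := 2 * K%:R * _ / _ in f hm.
clearbody u v; lra.
Qed.

(** With [B] dominating [T], the operators are [2 (Re T + B)], [2 (Im T + B)] and [B]; the surplus
    [(1 + 'i) B] has to be removed. As [opcomb] gives coefficient [1] to its last argument, this
    takes the coefficient [- (2 + 'i)]. *)
Lemma L1inf_span (A : op R) : L1inf A -> exists A1 A2 A3 : op R,
  [/\ [/\ L1inf A1, L1inf A2 & L1inf A3], [/\ pos_op A1, pos_op A2 & pos_op A3] &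
      A = opcomb 2^-1 A1 (opcomb ('i%C / 2) A2 (opcomb (- (2 + 'i%C)) A3 A3))].
Proof.
move=> /L1inf_dyadic[T [bT -> [K dT]]].
have [B [L [bB dB TB]]] := dyadic_dominated bT dT.
have bT' := blin_adj bT; have dT' := dyadic_adj bT dT.
have [lT _] := bT; have [lB _] := bB; have [lT' _] := bT'.
have [N1 d1] := dyadic_comb 2 lB lT' dB dT'.
have b1 := blin_comb 2 bB bT'; have [l1 _] := b1.
have [N2 d2] := dyadic_comb 1 lT l1 dT d1.
have b2 := blin_comb 1 bT b1.
have [N3 d3] := dyadic_comb 'i%C lT' lB dT' dB.
have b3 := blin_comb 'i%C bT' bB; have [l3 _] := b3.
have [N4 d4] := dyadic_comb 1 lB l3 dB d3.
have b4 := blin_comb 1 bB b3; have [l4 _] := b4.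
have [N5 d5] := dyadic_comb (- 'i%C) lT l4 dT d4.
have b5 := blin_comb (- 'i%C) bT b4.
exists (mkop (fun x => 1 *: T x + (2 *: B x + adj T x))),
  (mkop (fun x => (- 'i%C) *: T x + (1 *: B x + ('i%C *: adj T x + B x)))), (mkop B).
have TB' x : [/\ complex.Im (dot (B x) x) = 0,
    `|complex.Re (dot (T x) x)| <= complex.Re (dot (B x) x) &
    `|complex.Im (dot (T x) x)| <= complex.Re (dot (B x) x)].
  have [h1 h2] := TB x; split=> //; apply: le_trans h2.
  - exact: normRe_le_cabs.
  - exact: normIm_le_cabs.
split.
- by split; [exact: dyadic_L1inf b2 d2|exact: dyadic_L1inf b5 d5|exact: dyadic_L1inf bB dB].
- split; apply: pos_mkop; split=> // x; have [h1 h2 h3] := TB' x.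
  + rewrite !dotPl dot_adjC // lecE /=.
    case: (dot (T x) x) (dot (B x) x) h1 h2 h3 => [p q] [r s] /= -> h2 h3.
    move: h2 h3; rewrite !ler_norml => /andP[? ?] /andP[? ?].
    apply/andP; split; [apply/eqP; ring|lra].
  + rewrite !dotPl dot_adjC // lecE /=.
    case: (dot (T x) x) (dot (B x) x) h1 h2 h3 => [p q] [r s] /= -> h2 h3.
    move: h2 h3; rewrite !ler_norml => /andP[? ?] /andP[? ?].
    apply/andP; split; [apply/eqP; ring|lra].
  + rewrite lecE /= h1 eqxx; apply: le_trans h2; exact: normr_ge0.
- rewrite !opcomb_mkop; congr mkop; apply/funext => x; apply: hilP => k.
  rewrite !(hilDE, hilZE); move: (T x k) (B x k) (adj T x k) => t b t'.
  have i2 : 'i%C * 'i%C = -1 :> C by rewrite -expr2 sqr_i.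
  have e2 : (2 : C)^-1 * 2 = 1 by rewrite mulVf ?pnatr_eq0.
  have e : ('i%C / 2) * ((- 'i%C) * t + (1 * b + ('i%C * t' + b))) =
      2^-1 * (t + 2 * 'i%C * b - t').
    transitivity (2^-1 * (- ('i%C * 'i%C) * t + 2 * 'i%C * b + ('i%C * 'i%C) * t')); first ring.
    by rewrite i2; ring.
  rewrite e; transitivity ((2^-1 * 2) * (t + b + 'i%C * b) + (- (2 + 'i%C) * b + b)); last ring.
  by rewrite e2; ring.
Qed.

End PositiveSpan.

(** * Integrals of nonincreasing step functions *)

Section StepIntegral.
Variable R : realType.
Local Notation mu := (@lebesgue_measure R).
Variables (m : nat -> R) (m0 : forall k, 0 <= m k).
Hypothesis m_anti : forall k, m k.+1 <= m k.

Let g (s : R) : R := m (Num.truncn s).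

Lemma step_anti i j : (i <= j)%N -> m j <= m i.
Proof. by move=> /subnKC <-; elim: (j - i)%N => [|k IH]; rewrite ?addn0 // addnS (le_trans _ IH). Qed.

Lemma step_measurable (D : set R) : measurable D -> measurable_fun D g.
Proof.
move=> mD; apply: nonincreasing_measurable => // s t st.
exact/step_anti/le_truncn.
Qed.

Lemma step_integrable (a b : itv_bound R) (x y : R) :
  [set` Interval a b] `<=` `[x, y]%classic ->
  mu.-integrable [set` Interval a b] (EFin \o g).
Proof.
move=> sub; have itf : mu.-integrable `[x, y]%classic (EFin \o g).
  apply: measurable_bounded_integrable => //.
  - rewrite /= lebesgue_measure_itv; case: ifP => // _; exact: ltry.
  - exact: step_measurable.
  exists (m 0%N); split; first exact: num_real.
  move=> M mM s _ /=; rewrite ger0_norm; last exact: m0.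
  by apply: le_trans (ltW mM); exact: step_anti.
by apply: integrableS itf.
Qed.

Definition step_int (t : R) : R := \int[mu]_(s in `[0, t]%classic) g s.

Lemma step_int_ge0 t : 0 <= step_int t.
Proof. by apply: Rintegral_ge0 => s _; exact: m0. Qed.

Lemma step_intB (s t : R) : 0 <= s -> s <= t ->
  step_int t - step_int s = \int[mu]_(x in `]s, t]%classic) g x.
Proof.
move=> s0 st; apply: Rintegral_itvB; rewrite ?bnd_simp //.
exact: (@step_integrable _ _ 0 t).
Qed.

Lemma step_int_le s t : 0 <= s -> s <= t -> step_int s <= step_int t.
Proof.
move=> s0 st; rewrite -subr_ge0 step_intB //.
by apply: Rintegral_ge0 => x _; exact: m0.
Qed.

Lemma step_int0 : step_int 0 = 0.
Proof. by rewrite /step_int set_itv1 Rintegral_set1. Qed.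

Lemma step_int_nat n : step_int n%:R = \sum_(k < n) m k.
Proof.
elim: n => [|n IH]; first by rewrite big_ord0 step_int0.
rewrite big_ord_recr /= -IH; apply/eqP; rewrite addrC -subr_eq; apply/eqP.
(* Dropping the endpoint [n.+1], where [truncn] jumps, leaves a constant integrand. *)
rewrite step_intB ?ler_nat //; rewrite -Rintegral_itv_bndo_bndc; last first.
  apply: (@step_integrable _ _ n%:R n.+1%:R); apply: subset_itv; rewrite bnd_simp //.
rewrite (@eq_Rintegral _ _ _ _ _ (fun=> m n)).
  rewrite Rintegral_cst //= lebesgue_measure_itv /= lte_fin ltr_nat ltnSn.
  by rewrite -EFinB /= -natr1 addrC addKr mulr1.
move=> x; rewrite inE /= in_itv /= => /andP[nx xn]; rewrite /g; congr m.
by apply/truncn_def; rewrite (ltW nx).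
Qed.

Lemma step_int_le_lin t : 0 <= t -> step_int t <= m 0%N * t.
Proof.
move=> t0; apply: (@le_trans _ _ (\int[mu]_(s in `[0, t]%classic) (m 0%N))).
  apply: le_Rintegral => //; first exact: (@step_integrable _ _ 0 t).
    apply: measurable_bounded_integrable => //.
      by rewrite /= lebesgue_measure_itv; case: ifP => // _; exact: ltry.
    exists (m 0%N); split; first exact: num_real.
    by move=> M mM s _ /=; rewrite ger0_norm // ltW.
  by move=> s _; exact: step_anti.
rewrite Rintegral_cst //= lebesgue_measure_itv /= lte_fin.
by case: ltP => h /=; rewrite ?subr0 // mulr0 mulr_ge0.
Qed.

Lemma step_int_bounds t : 0 <= t ->
  \sum_(k < Num.truncn t) m k <= step_int t <= \sum_(k < (Num.truncn t).+1) m k.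
Proof.
move=> t0; have /andP[h1 h2] := truncn_itv t0.
by rewrite -!step_int_nat !step_int_le // ltW.
Qed.

End StepIntegral.

(** * Extended limits of functions on the half-line *)

Section ExtLim.
Variable R : realType.
Local Notation mu := (@lebesgue_measure R).
Implicit Types f g : R -> R.

Lemma Linf_comb (a : R) f g : Linf f -> Linf g -> Linf (fun t => a * f t + g t).
Proof.
move=> [mf [M fM]] [mg [N gN]]; split.
  by apply: measurable_funD => //; apply: measurable_funM => //; exact: measurable_cst.
exists (`|a| * M + N); apply: (@filterS2 _ _ (ae_filter_ringOfSetsType mu) _ _ _ _ fM gN) => t h1 h2 D.
apply: le_trans (ler_normD _ _) _; rewrite normrM lerD ?h2 //.
by rewrite ler_wpM2l ?h1.
Qed.

Lemma Linf_cst (c : R) : Linf (fun=> c).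
Proof. by split; [exact: measurable_cst|exists `|c|; apply: aeW]. Qed.

Lemma ext_lim_ge0 om f : ext_lim om -> Linf f -> (forall t, 0 < t -> 0 <= f t) -> 0 <= om f.
Proof.
move=> [_ pos _ _] Lf f0; apply: pos => //; apply: aeW => t /=.
by rewrite in_itv /= andbT; exact: f0.
Qed.

(** Positivity needs [c + e - f >= 0] almost everywhere, but this is known only beyond [T]. A
    multiple [p] of the indicator of []-oo, T]], to which [om] gives the value [0], repairs the
    rest; its height covers the bounds of [f] and of the constant. *)
Lemma ext_lim_upper om f (c : R) : ext_lim om -> Linf f ->
  (forall e, 0 < e -> exists T, forall t, T < t -> f t <= c + e) -> om f <= c.
Proof.
move=> eom Lf fc; have [lin pos one van] := eom; apply/ler_addgt0Pr => e e0.
have [T hT] := fc e e0; have [mf [M fM]] := Lf.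
pose K := `|M| + `|c + e|.
pose p t : R := K * \1_(`]-oo, T]%classic) t.
have Lp : Linf p.
  split; first by apply: measurable_funM; [exact: measurable_cst|exact: measurable_indic].
  exists K; apply: aeW => t _; rewrite /p normrM indicE.
  have K0 : 0 <= K by rewrite addr_ge0.
  by rewrite (ger0_norm K0) ler_piMr //; case: (_ \in _); rewrite ?normr1 ?normr0.
have op : om p = 0.
  apply: (van p T Lp); apply: aeW => t /=; rewrite in_itv /= andbT => tT.
  rewrite /p indicE memNset ?mulr0 //= in_itv /=.
  by apply/negP; rewrite -ltNge.
have Lc := Linf_cst (1 : R).
have L1 := Linf_comb (-1) Lf Lp.
have L2 := Linf_comb (c + e) Lc L1.
have : 0 <= om (fun t => (c + e) * 1 + ((-1) * f t + p t)).
  apply: pos => //; apply: (@filterS _ _ (ae_filter_ringOfSetsType mu) _ _ _ fM) => t h D; rewrite mulr1 mulN1r /p indicE.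
  have [tT|Tt] := leP t T.
    rewrite mem_set /= ?in_itv //= mulr1; have := h D.
    rewrite ler_norml /K => /andP[_ h2]; have := ler_norm M; have := ler_norm (- (c + e)).
    rewrite normrN; lra.
  rewrite memNset /= ?in_itv /=; last by apply/negP; rewrite -ltNge.
  by rewrite mulr0 addr0 subr_ge0 hT.
rewrite lin // lin // one op; lra.
Qed.

Lemma ext_lim_cvg om f (c : R) : ext_lim om -> Linf f ->
  (forall e, 0 < e -> exists T, forall t, T < t -> `|f t - c| <= e) -> om f = c.
Proof.
move=> eom Lf fc; apply/eqP; rewrite eq_le; apply/andP; split.
  apply: ext_lim_upper => // e /fc[T hT]; exists T => t /hT.
  by rewrite ler_norml; lra.
have LN : Linf (fun t => (-1) * f t + 0) by apply: Linf_comb => //; exact: Linf_cst.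
have : om (fun t => (-1) * f t + 0) <= - c.
  apply: ext_lim_upper => // e /fc[T hT]; exists T => t /hT.
  by rewrite ler_norml; lra.
have L0 := Linf_cst (0 : R).
have [lin _ _ van] := eom; rewrite (lin (-1) f (fun=> 0)) //.
rewrite (van (fun=> 0) 0) //; last exact: aeW.
lra.
Qed.

End ExtLim.

(** * Dixmier traces are positive normalised traces *)

Section DixmierFunction.
Variable R : realType.
Local Notation C := R[i].
Local Notation H := (hil R).
Implicit Types (T : H -> H) (A : op R).

(** Replaces the spanning vectors of [rank_le], which may lie outside [l2], by vectors of [hil] that
    an operator can transport. *)
Lemma rank_le_range (S : H -> H) n : lin S -> rank_le (mkop S) n -> exists es,
  (size es <= n)%N /\ forall x, proj es (S x) = S x.
Proof.
move=> lS rS; have [es [oe sn pe]] := rank_le_onf lS rS; exists es; split=> // x.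
apply/eqP; rewrite eq_sym -subr_eq0 -nrm_eq0 -sqrf_eq0 -(inj_eq (@complexI R)) -dotxx.
have p := perp_subproj (S x) oe.
by rewrite {1}dotBl pe // dot_proj_perp // subrr.
Qed.

Lemma rank_le_proj_comp (U S : H -> H) es n : lin U -> (size es <= n)%N ->
  rank_le (mkop (fun x => U (proj es (S x)))) n.
Proof.
move=> lU sn; exists (fun i => U (nth 0 es i) : H) => _ /l2_hil[x ->].
exists (fun i => dot (S x) (nth 0 es i)); rewrite mkop_hil /=.
have -> : U (proj es (S x)) = \sum_(i < n) dot (S x) (nth 0 es i) *: U (nth 0 es i).
  rewrite /proj lin_sum // (big_nth 0) big_mkord (big_ord_widen n
    (fun i => U (dot (S x) (nth 0 es i) *: nth 0 es i))) //.
  rewrite big_mkcond; apply: eq_bigr => i _; case: ltnP => h; first by rewrite linZ.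
  by rewrite nth_default // dot0r scale0r.
by apply/funext => k; elim/big_rec2: _ => // i y z _ <-.
Qed.

Lemma smu_anti A k : bounded_op A -> smu k.+1 A <= smu k A.
Proof.
move=> /bounded_opP[T bT ->]; apply/ler_addgt0Pr => e e0.
have lt : smu k (mkop T) < smu k (mkop T) + e by rewrite ltrDl.
have [S [bS rS TS]] := smu_lt bT lt; have [lS _] := bS.
have [es [sn SE]] := rank_le_range lS rS.
apply: (@smu_le _ _ T S) => //; last by rewrite addr_ge0 ?smu_ge0 // ltW.
rewrite (_ : S = fun x => id (proj es (S x))); last by apply/funext => x; rewrite SE.
by apply: (@rank_le_proj_comp id S es) => //; exact: leqW.
Qed.

(** [U S V] approximates [U T V] as well as [S] approximates [T]. *)
Lemma smu_unitary_le (U V T : H -> H) k : blin U -> blin V -> hunitary U V -> blin T ->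
  smu k (mkop (U \o T \o V)) <= smu k (mkop T).
Proof.
move=> bU bV hU bT; apply/ler_addgt0Pr => e e0.
have [lU lV [UK VK] dU] := hU.
have lt : smu k (mkop T) < smu k (mkop T) + e by rewrite ltrDl.
have [S [bS rS TS]] := smu_lt bT lt; have [lS _] := bS.
have [es [sn SE]] := rank_le_range lS rS.
apply: (@smu_le _ _ _ (U \o S \o V)).
- by do 2 apply: blin_comp => //.
- by do 2 apply: blin_comp => //.
- rewrite (_ : _ \o _ = fun x => U (proj es ((S \o V) x))); last first.
    by apply/funext => x /=; rewrite SE.
  exact: rank_le_proj_comp.
- by rewrite addr_ge0 ?smu_ge0 // ltW.
- move=> x /=; rewrite -linB // (unitary_nrm _ hU).
  by rewrite -[nrm x](congr1 _ (VK x)) (unitary_nrm _ hU).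
Qed.

Lemma smu_unitary (U V T : H -> H) k : blin U -> blin V -> hunitary U V -> blin T ->
  smu k (mkop (U \o T \o V)) = smu k (mkop T).
Proof.
move=> bU bV hU bT; apply: le_anti; apply/andP; split; first exact: smu_unitary_le.
have [lU lV [UK VK] dU] := hU.
have hV : hunitary V U by split=> // x y; rewrite -dU !VK.
rewrite {1}(_ : T = V \o (U \o T \o V) \o U).
  by apply: smu_unitary_le => //; do 2 apply: blin_comp => //.
by apply/funext => x /=; rewrite !UK.
Qed.

Lemma L1inf_smu A : L1inf A -> (forall k, 0 <= smu k A) /\ (forall k, smu k.+1 A <= smu k A).
Proof.
move=> [bA _ _]; split=> k; last exact: smu_anti.
by move: bA => /bounded_opP[T bT ->]; exact: smu_ge0.
Qed.

Lemma dix_funE A t : dix_fun A t = (ln (1 + t))^-1 * step_int (fun k => smu k A) t.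
Proof. by []. Qed.

Lemma ln1D_gt0 (t : R) : 0 < t -> 0 < ln (1 + t).
Proof. by move=> t0; rewrite ln_gt0 // ltrDl. Qed.

Lemma dix_fun_ge0 A t : L1inf A -> 0 < t -> 0 <= dix_fun A t.
Proof.
move=> /L1inf_smu[m0 _] t0; rewrite dix_funE mulr_ge0 ?step_int_ge0 //.
by rewrite invr_ge0 ltW // ln1D_gt0.
Qed.

Lemma dix_fun_bounded A : L1inf A -> exists M, forall t, 0 < t -> `|dix_fun A t| <= M.
Proof.
move=> LA; have [m0 ma] := L1inf_smu LA; have [_ _ [B AB]] := LA.
have B0 : 0 <= B by apply: le_trans (AB 0%N); rewrite mulr_ge0.
have l2 := ln2_gt0 R.
(* For [t <= 1] the quotient is at most [2 * smu 0 A], as [t <= 2 * ln (1 + t)]; for [t > 1]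
   harmonic sums give [B * (1 + ln (1 + t))], and [ln 2 <= ln (1 + t)] absorbs the [1]. *)
exists (2 * smu 0 A + B * ((ln 2)^-1 + 1)) => t t0; have l0 := ln1D_gt0 t0.
have K0 : 0 <= B * ((ln 2)^-1 + 1) by rewrite mulr_ge0 // addr_ge0 // invr_ge0 ltW.
rewrite ger0_norm ?dix_fun_ge0 // dix_funE mulrC ler_pdivrMr //.
have [t1|t1] := leP t 1.
  apply: le_trans (step_int_le_lin m0 ma (ltW t0)) _.
  apply: (@le_trans _ _ (2 * smu 0 A * ln (1 + t))); last first.
    by rewrite ler_wpM2r ?(ltW l0) // lerDl.
  rewrite [2 * _]mulrC -mulrA ler_wpM2l //.
  have t2 : 0 < 1 + t by rewrite addr_gt0.
  (* [ln (1 + x) <= x] at [x = - t / (1 + t)] gives [t / (1 + t) <= ln (1 + t)]. *)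
  have := @le_ln1Dx R (- (t / (1 + t))) _.
  rewrite (_ : 1 + - (t / (1 + t)) = (1 + t)^-1); last by field; rewrite gt_eqF.
  rewrite lnV ?posrE // lerN2 ltrN2 ltr_pdivrMr // mul1r ltrDr ltr01 => /(_ isT) h.
  have : t / 2 <= t / (1 + t) by rewrite ler_pM2l // lef_pV2 ?posrE //; lra.
  lra.
have /andP[_ h] := step_int_bounds m0 ma (ltW t0); apply: le_trans h _.
set N := Num.truncn t.
have mk k : smu k A <= B * k.+1%:R^-1.
  by rewrite ler_pdivlMr // mulrC AB.
apply: (@le_trans _ _ (\sum_(k < N.+1) B * k.+1%:R^-1)); first exact: ler_sum.
rewrite -mulr_sumr; apply: (@le_trans _ _ (B * (1 + ln (1 + t)))).
  rewrite ler_wpM2l //; apply: le_trans (harmonic_sum_le R N) _; rewrite lerD2l.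
  rewrite ler_ln ?posrE ?addr_gt0 // -natr1 addrC lerD2l.
  by have /andP[] := truncn_itv (ltW t0).
have l12 : ln 2 <= ln (1 + t) by rewrite ler_ln ?posrE ?addr_gt0 //; lra.
have : 1 <= (ln 2)^-1 * ln (1 + t) by rewrite mulrC ler_pdivlMr // mul1r.
move=> h1; apply: (@le_trans _ _ (B * ((ln 2)^-1 + 1) * ln (1 + t))).
  by rewrite -mulrA ler_wpM2l // mulrDl mul1r lerD2r.
by rewrite ler_wpM2r ?(ltW l0) // lerDr mulr_ge0.
Qed.

Lemma dix_fun_Linf A : L1inf A -> Linf (dix_fun A).
Proof.
move=> LA; have [m0 ma] := L1inf_smu LA; split.
  (* Extended by [0] to negative [t], the integral is monotone on the whole line, hence
     measurable. *)
  pose I t := if t < 0 then 0 else step_int (fun k => smu k A) t.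
  suff : measurable_fun `](0 : R), +oo[%classic (fun t => (ln (1 + t))^-1 * I t).
    apply: eq_measurable_fun => t; rewrite inE /= in_itv /= andbT => t0.
    by rewrite dix_funE /I ltNge (ltW t0).
  apply: measurable_funM; last first.
    apply: nondecreasing_measurable => // s t st; rewrite /I.
    case: ltP => s0; case: ltP => t0 //; first exact: step_int_ge0.
      by move: (lt_le_trans t0 s0); rewrite ltNge st.
    exact: step_int_le.
  (* The reciprocal is written as an exponential, so that measurability follows by composition. *)
  suff : measurable_fun `](0 : R), +oo[%classic (fun t : R => expR (- ln (ln (1 + t)))).
    apply: eq_measurable_fun => t; rewrite inE /= in_itv /= andbT => t0.
    by rewrite expRN lnK // posrE ln1D_gt0.
  apply: measurableT_comp => //; apply: measurableT_comp => //.
  apply: measurableT_comp; first exact: measurable_ln.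
  apply: measurableT_comp; first exact: measurable_ln.
  by apply: measurable_funD => //; exact: measurable_cst.
have [M hM] := dix_fun_bounded LA; exists M; apply: aeW => t /=.
by rewrite in_itv /= andbT; exact: hM.
Qed.

(** For [2 ^ n <= 1 + t < 2 ^ n.+1] the integral lies between the sums at levels [n] and [n.+1], and
    [ln (1 + t) / ln 2] between [n] and [n.+1]; the mismatch, at most [|c|], is negligible against
    [n]. *)
Lemma dix_fun_cvg A (c : R) : L1inf A ->
  (forall e, 0 < e -> exists N, forall n, (N <= n)%N ->
     `|\sum_(k < (2 ^ n).-1) smu k A - c * n%:R| <= e * n%:R) ->
  forall e, 0 < e -> exists t0, forall t, t0 < t -> `|dix_fun A t - c / ln 2| <= e.
Proof.
move=> LA hc e e0; have [m0 ma] := L1inf_smu LA; have l2 := ln2_gt0 R.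
(* A quarter, because the hypothesis at level [n.+1] costs a factor [n.+1 <= 2 * n]; the other half
   of the budget pays for [|c|], through the choice of [N1]. *)
have [|N hN] := hc (e * ln 2 / 4); first by rewrite divr_gt0 ?mulr_gt0.
pose N1 := (N + (Num.truncn (2 * `|c| / (e * ln 2))).+1)%N.
exists (2 ^+ N1) => t tN.
have t0 : 0 < t by apply: le_lt_trans tN; rewrite exprn_ge0.
pose n := trunc_log 2 (Num.truncn (1 + t)).
have t1 : 0 <= 1 + t by rewrite addr_ge0 // ltW.
have /andP[u1 u2] := truncn_itv t1.
have up : (0 < Num.truncn (1 + t))%N by rewrite truncn_gt0 lerDl ltW.
have /andP[n1 n2] := trunc_log_bounds (isT : (1 < 2)%N) up.
rewrite -/n in n1 n2.
have v1 : 2 ^+ n <= 1 + t by apply: le_trans u1; rewrite -natrX ler_nat.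
have v2 : 1 + t < 2 ^+ n.+1 by apply: lt_le_trans u2 _; rewrite -natrX ler_nat.
have nN : (N1 <= n)%N.
  have : 2 ^+ N1 < 2 ^+ n.+1 :> R by apply: lt_trans v2; apply: lt_trans tN _; rewrite ltrDr.
  by rewrite ltr_eXn2l ?ltr1n.
set x := ln (1 + t) / ln 2.
have lE : ln (1 + t) = x * ln 2 by rewrite divfK ?gt_eqF.
have x1 : n%:R <= x.
  rewrite ler_pdivlMr // mulr_natl -lnXn // ler_ln ?posrE ?exprn_gt0 //.
  by rewrite addr_gt0.
have x2 : x <= n.+1%:R.
  rewrite ler_pdivrMr // mulr_natl -lnXn // ler_ln ?posrE ?exprn_gt0 ?addr_gt0 //.
  exact: ltW.
have np : (0 < n)%N by apply: leq_trans nN; rewrite /N1 addnS.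
have n0 : 1 <= n%:R :> R by rewrite ler1n.
have x0 : 0 < x by exact: lt_le_trans ltr01 (le_trans n0 x1).
clearbody x.
set I := step_int (fun k => smu k A) t.
have pw k : (2 ^ k).-1%:R = 2 ^+ k - 1 :> R.
  by rewrite -[X in X - 1]natrX -[(2 ^ k)%N in RHS]prednK ?expn_gt0 // -natr1 addrK.
have I1 : \sum_(k < (2 ^ n).-1) smu k A <= I.
  rewrite -(step_int_nat m0 ma) step_int_le // pw; clear - v1; lra.
have I2 : I <= \sum_(k < (2 ^ n.+1).-1) smu k A.
  rewrite -(step_int_nat m0 ma) step_int_le ?(ltW t0) // pw; clear - v2; lra.
have h1 := hN n (leq_trans (leq_addr _ _) nN).
have h2 := hN n.+1 (leq_trans (leq_addr _ _) (leqW nN)).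
have cn : 2 * `|c| <= e * ln 2 * n%:R.
  rewrite -ler_pdivrMl ?mulr_gt0 // mulrC.
  apply: le_trans (ltW (truncnS_gt _)) _; rewrite ler_nat.
  by apply: leq_trans nN; rewrite leq_addl.
rewrite dix_funE -/I lE (_ : _ - _ = (I - c * x) / (x * ln 2)); last by field; rewrite !gt_eqF.
rewrite normrM normfV [X in _ / X]ger0_norm ?mulr_ge0 ?(ltW l2) ?(ltW x0) //.
rewrite ler_pdivrMr ?mulr_gt0 //.
apply: (@le_trans _ _ (e * ln 2 * n%:R)); last first.
  by rewrite [x * _]mulrC mulrA ler_wpM2l // mulr_ge0 ?(ltW l2) ?(ltW e0).
have cx1 : `|c * (n%:R - x)| <= `|c|.
  rewrite normrM ler_piMr // ler_norml; move: x1 x2; rewrite -natr1; clear.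
  by move: (n%:R) => u *; apply/andP; split; lra.
have cx2 : `|c * (n.+1%:R - x)| <= `|c|.
  rewrite normrM ler_piMr // ler_norml; move: x1 x2; rewrite -natr1; clear.
  by move: (n%:R) => u *; apply/andP; split; lra.
move: h1 h2 cx1 cx2; rewrite !ler_norml => /andP[a1 a2] /andP[b1 b2] /andP[c1 c2] /andP[d1 d2].
rewrite -natr1 in b1 b2 c1 c2 d1 d2.
set w := e * ln 2 in cn a1 a2 b1 b2 *.
have w0 : 0 < w by rewrite mulr_gt0.
have wn : w <= w * n%:R by rewrite ler_peMr // ltW.
clearbody w I; clear - a1 a2 b1 b2 c1 c2 d1 d2 wn cn I1 I2.
apply/andP; split; lra.
Qed.

Lemma L1inf_comb a A B : L1inf A -> L1inf B -> L1inf (opcomb a A B).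
Proof.
move=> /L1inf_dyadic[T [bT -> [K dT]]] /L1inf_dyadic[S [bS -> [K' dS]]].
have [lT _] := bT; have [lS _] := bS.
have [N dN] := dyadic_comb a lT lS dT dS.
by rewrite opcomb_mkop; apply: dyadic_L1inf dN; exact: blin_comb.
Qed.

Lemma unitary_conj_pos U V A : unitary_pair U V -> L1inf A -> pos_op A ->
  [/\ L1inf (U \o A \o V), pos_op (U \o A \o V) &
      forall k, smu k (U \o A \o V) = smu k A].
Proof.
move=> /unitary_pairP[u [v [-> -> bu bv hu]]] /L1inf_dyadic[T [bT -> [K dT]]] pA.
have pT := hpos_mkop pA; have [lu _] := bu; have [lT _] := bT.
have bUT := blin_comp bu bT; have [lUT _] := bUT; have bUTV := blin_comp bUT bv.
rewrite (comp_mkop _ lu) (comp_mkop _ lUT); split.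
- have [t ht] := partial_trace_exists dT.
  have [N dN] := partial_trace_dyadic (partial_trace_unitary hu lT ht).
  exact: dyadic_L1inf dN.
- apply: pos_mkop; split=> // x /=; rewrite (unitary_adj _ _ hu).
  by have [_] := pT.
- by move=> k; exact: smu_unitary.
Qed.

Lemma unitary_conj_comb U V a A B : unitary_pair U V -> L1inf A -> L1inf B ->
  U \o opcomb a A B \o V = opcomb a (U \o A \o V) (U \o B \o V).
Proof.
move=> /unitary_pairP[u [v [-> -> bu bv hu]]] /L1inf_dyadic[T [bT -> _]].
move=> /L1inf_dyadic[S [bS -> _]].
have [lu _] := bu; have [lT _] := bT; have [lS _] := bS.
have [lUT _] := blin_comp bu bT; have [lUS _] := blin_comp bu bS.
have [lUC _] := blin_comp bu (blin_comb a bT bS).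
rewrite opcomb_mkop !(comp_mkop _ lu) (comp_mkop _ lUT) (comp_mkop _ lUS) (comp_mkop _ lUC).
rewrite opcomb_mkop; congr mkop.
by apply/funext => x /=; rewrite lu.
Qed.

Lemma Dixmier_PT (tau : op R -> C) : Dixmier tau -> PT tau.
Proof.
move=> [om [eom _ lin dix]].
have upos U V A : unitary_pair U V -> L1inf A -> pos_op A -> tau (U \o A \o V) = tau A.
  move=> hU LA pA; have [LU pU smuU] := unitary_conj_pos hU LA pA.
  have e1 : (fun k => smu k (U \o A \o V)) = smu^~ A by apply/funext => k; exact: smuU.
  have e2 : dix_fun (U \o A \o V) = dix_fun A by apply/funext => t; rewrite !dix_funE e1.
  by rewrite (dix _ LU pU) (dix _ LA pA) e2.
have Lconj U V A : unitary_pair U V -> L1inf A -> pos_op A -> L1inf (U \o A \o V).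
  by move=> hU LA pA; have [] := unitary_conj_pos hU LA pA.
split.
- split=> // U V A hU /L1inf_span[A1 [A2 [A3 [[L1 L2 L3] [p1 p2 p3] ->]]]].
  have L33 := L1inf_comb (- (2 + 'i%C)) L3 L3.
  have L233 := L1inf_comb ('i%C / 2) L2 L33.
  have M1 := Lconj _ _ _ hU L1 p1; have M2 := Lconj _ _ _ hU L2 p2.
  have M3 := Lconj _ _ _ hU L3 p3.
  have M33 := L1inf_comb (- (2 + 'i%C)) M3 M3.
  have M233 := L1inf_comb ('i%C / 2) M2 M33.
  rewrite (unitary_conj_comb _ hU L1 L233) (unitary_conj_comb _ hU L2 L33).
  rewrite (unitary_conj_comb _ hU L3 L3).
  rewrite (lin _ _ _ M1 M233) (lin _ _ _ M2 M33) (lin _ _ _ M3 M3).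
  rewrite (lin _ _ _ L1 L233) (lin _ _ _ L2 L33) (lin _ _ _ L3 L3).
  by rewrite (upos _ _ _ hU L1 p1) (upos _ _ _ hU L2 p2) (upos _ _ _ hU L3 p3).
- move=> A LA pA; rewrite (dix _ LA pA) ler0c; apply: ext_lim_ge0 => //; first exact: dix_fun_Linf.
  by move=> t t0; exact: dix_fun_ge0.
- move=> A LA pA muA; rewrite (dix _ LA pA); congr (_%:C%C).
  (* The limit has the form [c / ln 2] with [c = ln 2], the growth of the harmonic sums per
     level. *)
  rewrite -[RHS](@divff _ (ln 2)) ?gt_eqF ?ln2_gt0 //.
  apply: ext_lim_cvg => //; first exact: dix_fun_Linf.
  apply: dix_fun_cvg => // e e0; exists (Num.truncn e^-1).+1 => n hn.
  under eq_bigr do rewrite muA.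
  rewrite [ln 2 * _]mulrC; apply: le_trans (harmonic_dyadic R n) _.
  rewrite -ler_pdivrMl // mulr1; apply: le_trans (ltW (truncnS_gt _)) _.
  by rewrite ler_nat.
Qed.

End DixmierFunction.

(** * Diagonal operators *)

Section DiagonalOperators.
Variable R : realType.
Local Notation C := R[i].
Local Notation H := (hil R).
Variables (d : nat -> R) (d0 : forall k, 0 <= d k).
Hypothesis d_anti : forall i j, (i <= j)%N -> d j <= d i.

Lemma l2_le (x y : vec R) (c : R) : 0 <= c -> l2 y ->
  (forall k, csq (x k) <= c ^+ 2 * csq (y k)) -> l2 x.
Proof.
move=> c0 [M yM] xy; exists (c ^+ 2 * M) => n.
apply: (@le_trans _ _ (\sum_(k < n) c ^+ 2 * csq (y k))); first exact: ler_sum.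
by rewrite -mulr_sumr ler_wpM2l ?sqr_ge0.
Qed.

Lemma nrm_le_coord (x y : H) (c : R) : 0 <= c ->
  (forall k, csq (x k) <= c ^+ 2 * csq (y k)) -> nrm x <= c * nrm y.
Proof.
move=> c0 xy; rewrite -(@ler_pXn2r _ 2) ?nnegrE ?mulr_ge0 ?nrm_ge0 //.
rewrite exprMn (sqr_nrm x); apply: rsum_le; first exact/l2_summable/hil_l2.
move=> n; apply: (@le_trans _ _ (\sum_(k < n) c ^+ 2 * csq (y k))); first exact: ler_sum.
by rewrite -mulr_sumr ler_wpM2l ?sqr_ge0 // csq_le_nrm.
Qed.

Lemma csq_scale (a : R) (z : C) : csq (a%:C%C * z) = a ^+ 2 * csq z.
Proof. by rewrite csqM {1}/csq /= expr0n addr0. Qed.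

Lemma diag_l2 (x : H) : l2 (fun k => (d k)%:C%C * x k).
Proof.
apply: (l2_le (d0 0%N) (hil_l2 x)) => k.
by rewrite csq_scale ler_wpM2r ?csq_ge0 // lerXn2r ?nnegrE // d_anti.
Qed.

Definition diag (x : H) : H := mkhil (diag_l2 x).

Lemma diagE x k : diag x k = (d k)%:C%C * x k.
Proof. by []. Qed.

Lemma blin_diag : blin diag.
Proof.
split; first by move=> a x y; apply: hilP => k; rewrite !(hilDE, hilZE, diagE); ring.
exists (d 0%N) => x; apply: nrm_le_coord => // k.
by rewrite diagE csq_scale ler_wpM2r ?csq_ge0 // lerXn2r ?nnegrE // d_anti.
Qed.

Lemma hpos_diag : hpos diag.
Proof.
split; first exact: blin_diag.
move=> x; have [sR sI] := dot_summable (diag x) x.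
have e k : diag x k * (x k)^* = (d k * csq (x k))%:C%C.
  by rewrite diagE -mulrA mul_conj -rmorphM.
rewrite -dotE /cinner lecE /=; apply/andP; split.
  rewrite /rsum (_ : (fun n => _) = (fun=> 0)) ?lim_cst //.
  by apply/funext => n; rewrite big1 // => k _; rewrite e.
apply: limr_ge => //; apply: nearW => n.
by apply: sumr_ge0 => k _; rewrite e /= mulr_ge0 ?csq_ge0.
Qed.

Lemma diag_perp n (x : H) : perp (deltas R n) x -> nrm (diag x) <= d n * nrm x.
Proof.
move=> px; apply: nrm_le_coord => // k; rewrite diagE csq_scale.
have [kn|nk] := ltnP k n.
  rewrite (_ : x k = 0) ?csq0 ?mulr0 // -dot_delta; apply: px.
  by apply/mapP; exists k => //; rewrite mem_iota.
by rewrite ler_wpM2r ?csq_ge0 // lerXn2r ?nnegrE // d_anti.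
Qed.

(** The upper bound comes from the complement of the first [n] basis vectors, the lower one from the
    span of the first [n.+1], on which [diag] is at least [d n]. *)
Lemma smu_diag n : smu n (mkop diag) = d n.
Proof.
apply: le_anti; apply/andP; split.
  apply: (smu_le_perp blin_diag (onf_deltas R n)) => //; first by rewrite size_deltas.
  by move=> x; exact: diag_perp.
apply: (smu_ge blin_diag (onf_deltas R n.+1)); first by rewrite size_deltas.
move=> x px.
have -> : d n * nrm x = nrm ((d n)%:C%C *: x) by rewrite nrmZ cabs_real ger0_norm.
rewrite -[leRHS]mul1r; apply: nrm_le_coord => // k; rewrite expr1n mul1r.
rewrite hilZE diagE !csq_scale.
have [kn|nk] := ltnP k n.+1; first by rewrite ler_wpM2r ?csq_ge0 // lerXn2r ?nnegrE // d_anti.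
suff -> : x k = 0 by rewrite csq0 !mulr0.
rewrite -dot_delta -{1}px dot_proj_perp // => _ /mapP[j jn ->].
move: jn; rewrite mem_iota add0n => /andP[_ jn].
by rewrite dot_delta deltaE ltn_eqF // (leq_trans jn).
Qed.

Lemma L1inf_diag K : (forall n, d (2 ^ n)%N <= K%:R / 2 ^+ n) -> L1inf (mkop diag).
Proof.
(* [K.+1] is positive, so [2 ^ n] vectors always meet the size bound. *)
move=> dK; apply: (@dyadic_L1inf _ K.+1); first exact: blin_diag.
move=> n; exists (deltas R (2 ^ n)); split; first exact: onf_deltas.
  by rewrite size_deltas leq_pmull.
have dK1 : d (2 ^ n)%N <= K.+1%:R / 2 ^+ n.
  by apply: le_trans (dK n) _; rewrite ler_pM2r ?invr_gt0 ?exprn_gt0 // ler_nat.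
have sm x : perp (deltas R (2 ^ n)) x -> nrm (diag x) <= K.+1%:R / 2 ^+ n * nrm x.
  by move=> /diag_perp h; apply: le_trans h _; rewrite ler_wpM2r ?nrm_ge0.
move=> x px; split; first exact: sm.
move=> y; rewrite (hpos_sym x y hpos_diag) cabs_conj; apply: le_trans (dot_CS _ _) _.
by rewrite mulrAC ler_wpM2r ?nrm_ge0 // sm.
Qed.

End DiagonalOperators.

(** * Counting the sparse blocks *)

Section Blocks.

Lemma trunc_log_block m i : (i < 2 ^ m)%N -> trunc_log 2 (2 ^ m + i) = m.
Proof.
move=> im; apply: trunc_log_eq => //.
by rewrite leq_addr /= expnS mul2n -addnn ltn_add2l.
Qed.

(* Indicator of the union of the blocks [2 ^ m, 2 ^ m + m). *)
Definition bump_ind (j : nat) : nat := (j - 2 ^ trunc_log 2 j < trunc_log 2 j)%N.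

Definition bump_count n := (\sum_(j < n) bump_ind j)%N.

Lemma bump_ind_block m i : (i < 2 ^ m)%N -> bump_ind (2 ^ m + i) = (i < m)%N.
Proof. by move=> im; rewrite /bump_ind trunc_log_block // addKn. Qed.

Lemma sum_lt_le K m : (\sum_(i < K) (i < m) <= m)%N.
Proof.
suff -> : (\sum_(i < K) (i < m) = minn K m)%N by rewrite geq_minr.
elim: K => [|K IH]; first by rewrite big_ord0 min0n.
by rewrite big_ord_recr /= IH; lia.
Qed.

Lemma bump_count_add n k : bump_count (n + k) = (bump_count n + \sum_(i < k) bump_ind (n + i))%N.
Proof. by rewrite /bump_count big_split_ord. Qed.

(** The block at [2 ^ m] contributes at most [m], and [0 + ... + (m - 1) <= m ^ 2]. *)
Lemma bump_count_pow m : (bump_count (2 ^ m) <= m ^ 2)%N.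
Proof.
elim: m => [|m IH]; first by rewrite /bump_count big_ord1.
rewrite expnS mul2n -addnn bump_count_add.
have h : (\sum_(i < 2 ^ m) bump_ind (2 ^ m + i) <= m)%N.
  apply: leq_trans (sum_lt_le (2 ^ m) m); apply: leq_sum => i _.
  by rewrite bump_ind_block.
by apply: leq_trans (leq_add IH h) _; nia.
Qed.

Lemma bump_count_mono i j : (i <= j)%N -> (bump_count i <= bump_count j)%N.
Proof. by move=> /subnKC <-; rewrite bump_count_add leq_addr. Qed.

(** From [l = 3] on, the cube grows by a factor at most [(5 / 4) ^ 3 < 2] per step while the power
    doubles; smaller [l] are checked directly. *)
Lemma cube_le_pow l : (l.+1 ^ 3 <= 64 * 2 ^ l)%N.
Proof.
suff h k : ((k + 3).+1 ^ 3 <= 64 * 2 ^ (k + 3))%N.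
  by case: (leqP 3 l) => [/subnK <-|] //; case: l => [|[|[|]]].
elim: k => [//|k IH]; rewrite addSn (expnS 2).
apply: (@leq_trans (2 * (k + 3).+1 ^ 3)); first by rewrite !expnS !expn0; nia.
by rewrite mulnCA leq_mul2l.
Qed.

(** At most [l.+1 ^ 2] bumps lie below [n], and [l.+1 ^ 3 <= 64 * 2 ^ l <= 64 * n]: the density is
    at most [64 / l.+1]. *)
Lemma bump_count_small n : (0 < n)%N -> (bump_count n * (trunc_log 2 n).+1 <= 64 * n)%N.
Proof.
move=> n0; set l := trunc_log 2 n.
have /andP[l1 l2] := trunc_log_bounds (isT : (1 < 2)%N) n0.
have h1 := leq_trans (bump_count_mono (ltnW l2)) (bump_count_pow l.+1).
have h2 := cube_le_pow l.
apply: leq_trans (_ : (l.+1 ^ 2 * l.+1 <= _)%N); first by rewrite leq_mul2r h1 orbT.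
by rewrite -expnSr; apply: leq_trans h2 _; rewrite leq_mul2l.
Qed.

Lemma bump_count_window m : bump_count (2 ^ m + m) = (bump_count (2 ^ m) + m)%N.
Proof.
rewrite bump_count_add; congr (_ + _)%N.
rewrite (eq_bigr (fun=> 1%N)) ?sum1_card ?card_ord // => i _.
rewrite bump_ind_block ?ltn_ord //; apply: leq_trans (ltn_ord i) _.
exact/ltnW/ltn_expl.
Qed.

End Blocks.

(** * The separating operator *)

Section Example.
Variable R : realType.
Local Notation C := R[i].

Definition ex_seq (k : nat) : R :=
  (bump_ind (trunc_log 2 k.+1)).+1%:R / 2 ^+ trunc_log 2 k.+1.

Lemma ex_seq_ge0 k : 0 <= ex_seq k.
Proof. by rewrite divr_ge0 ?exprn_ge0. Qed.

(** Passing to a higher dyadic level at least halves the denominator's inverse, which makes up for a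
    numerator rising from [1] to [2]. *)
Lemma ex_seq_anti i j : (i <= j)%N -> ex_seq j <= ex_seq i.
Proof.
move=> ij; rewrite /ex_seq; set l := trunc_log 2 i.+1; set l' := trunc_log 2 j.+1.
have : (l <= l')%N by apply: leq_trunc_log.
rewrite leq_eqVlt => /orP[/eqP-> //|ll].
have b k : (bump_ind k).+1%:R <= 2 :> R by rewrite ler_nat ltnS leq_b1.
apply: (@le_trans _ _ (2 / 2 ^+ l')).
  by rewrite ler_pM2r ?invr_gt0 ?exprn_gt0 // b.
apply: (@le_trans _ _ (2 / 2 ^+ l.+1)).
  by rewrite ler_pM2l // lef_pV2 ?posrE ?exprn_gt0 // ler_eXn2l ?ltr1n.
rewrite exprS invfM mulrA divff ?pnatr_eq0 // mul1r -[leLHS]mul1r.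
by rewrite ler_pM2r ?invr_gt0 ?exprn_gt0 // ler1n.
Qed.

(** Level [n] consists of [2 ^ n] equal terms, which add up to [1] or [2]. *)
Lemma ex_seq_sum n : \sum_(k < (2 ^ n).-1) ex_seq k = n%:R + (bump_count n)%:R.
Proof.
elim: n => [|n IH]; first by rewrite /bump_count !big_ord0 addr0.
have e : (2 ^ n.+1).-1 = ((2 ^ n).-1 + 2 ^ n)%N.
  by rewrite expnS mul2n -addnn; have := expn_gt0 2 n; lia.
rewrite e big_split_ord /= IH (eq_bigr (fun=> (bump_ind n).+1%:R / 2 ^+ n)).
  rewrite sumr_const card_ord -[X in _ + X]mulr_natr natrX divfK ?expf_neq0 ?pnatr_eq0 //.
  by rewrite /bump_count big_ord_recr /= natrD -natr1 -natr1; ring.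
move=> i _; rewrite /ex_seq -addSn prednK ?expn_gt0 // trunc_log_block //.
Qed.

Lemma ex_seq_dyadic n : ex_seq (2 ^ n) <= 2%:R / 2 ^+ n.
Proof.
(* The shift by one in [ex_seq] matters only here: [2 ^ 0 + 1 = 2] belongs to level [1], whereas
   [2 ^ n + 1] stays at level [n] for [n > 0]. *)
have [n0|n0] := posnP n.
  have -> : ex_seq (2 ^ n) = (bump_ind (trunc_log 2 2)).+1%:R / 2 ^+ trunc_log 2 2.
    by rewrite n0.
  by rewrite n0 trunc_lognn // expr0 expr1 divr1 ler_pdivrMr // -natrM ler_nat (leq_trans (_ : _ <= 2)%N) // ltnS leq_b1.
have l : trunc_log 2 (2 ^ n).+1 = n.
  by rewrite -(addn1 (2 ^ n)) trunc_log_block // -[1%N](expn0 2) ltn_exp2l.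
rewrite /ex_seq l ler_pM2r ?invr_gt0 ?exprn_gt0 // ler_nat.
by rewrite ltnS leq_b1.
Qed.

Lemma bump_count_little (e : R) : 0 < e -> exists N, forall n, (N <= n)%N ->
  (bump_count n)%:R <= e * n%:R.
Proof.
move=> e0; pose L := (Num.truncn (64 / e)).+1; exists (2 ^ L)%N => n nL.
have n0 : (0 < n)%N by apply: leq_trans nL; rewrite expn_gt0.
have lL : (L <= trunc_log 2 n)%N.
  by apply: leq_trans (leq_trunc_log 2 nL); rewrite trunc_expnK.
have := bump_count_small n0; rewrite -(ler_nat R) !natrM => h.
have h2 : 64 / e <= (trunc_log 2 n).+1%:R.
  by apply: le_trans (ltW (truncnS_gt _)) _; rewrite ler_nat leqW.
rewrite ler_pdivrMr // in h2.
rewrite -(@ler_pM2r _ (trunc_log 2 n).+1%:R) //; apply: le_trans h _.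
by rewrite mulrAC ler_wpM2r // mulrC.
Qed.

Definition ex_op : op R := mkop (diag ex_seq_ge0 ex_seq_anti).

Lemma ex_op_L1inf : L1inf ex_op.
Proof. apply: L1inf_diag; exact: ex_seq_dyadic. Qed.

Lemma ex_op_pos : pos_op ex_op.
Proof. exact/pos_mkop/hpos_diag. Qed.

Lemma ex_op_sum n : \sum_(k < (2 ^ n).-1) smu k ex_op = n%:R + (bump_count n)%:R.
Proof. by rewrite -ex_seq_sum; apply: eq_bigr => k _; rewrite smu_diag. Qed.

Lemma ex_op_Dixmier : measurable_wrt Dixmier ex_op.
Proof.
have LA := ex_op_L1inf; have pA := ex_op_pos.
suff h tau : Dixmier tau -> tau ex_op = (1 / ln 2)%:C%C by move=> s t /h -> /h ->.
move=> [om [eom _ _ dix]]; rewrite (dix _ LA pA); congr (_%:C%C).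
apply: ext_lim_cvg => //; first exact: dix_fun_Linf.
apply: dix_fun_cvg => // e /bump_count_little[N hN]; exists N => n /hN.
by rewrite ex_op_sum mul1r addrAC subrr add0r ger0_norm.
Qed.

Lemma ex_op_PT : ~ measurable_wrt PT ex_op.
Proof.
have [L hL] := exists_seq_ext_lim R; have l2 := ln2_gt0 R.
move=> /(_ _ _ (window_trace_PT hL (fun=> 0%N)) (window_trace_PT hL (expn 2))).
have pT : hpos (diag ex_seq_ge0 ex_seq_anti) by exact: hpos_diag.
have E : (fun n => \sum_(k < (2 ^ n).-1) smu k (mkop (diag ex_seq_ge0 ex_seq_anti))) =
    (fun n => n%:R + (bump_count n)%:R) by apply/funext => n; exact: ex_op_sum.
rewrite !(window_trace_pos hL _ pT ex_op_L1inf) E => -[].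
(* On [[0, m]] the bumps number [o(m)], so only the constant part survives. *)
rewrite (_ : Lw L (fun=> 0%N) _ = 1 / ln 2); last first.
  apply: (Lw_cvg hL); apply/cvgrPdist_le => e e0.
  have [N hN] := bump_count_little (mulr_gt0 e0 l2).
  exists (maxn N 1) => // m; rewrite /= geq_max => /andP[Nm m1].
  have m0 : 0 < m%:R :> R by rewrite ltr0n.
  rewrite /win add0n /bump_count big_ord0 addr0 subr0 -/(bump_count m).
  rewrite (_ : _ - _ = - ((bump_count m)%:R / (m%:R * ln 2))); last by field; rewrite !gt_eqF.
  rewrite normrN ger0_norm; last by rewrite divr_ge0 // mulr_ge0 // ltW.
  by rewrite ler_pdivrMr ?mulr_gt0 // mulrA mulrAC hN.
(* On [[2 ^ m, 2 ^ m + m]] every level carries a bump, so the increment is exactly [2 * m] and the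
   average is constant for [m >= 1]. *)
rewrite (_ : Lw L (expn 2) _ = 2 / ln 2); last first.
  apply: (Lw_cvg hL); apply: (@cvg_near_cst _ R); exists 1%N => // m /= m1.
  have m0 : 0 < m%:R :> R by rewrite ltr0n.
  by rewrite /win bump_count_window !natrD; field; rewrite !gt_eqF.
by move=> /(mulIf (_ : (ln 2)^-1 != 0)); rewrite invr_eq0 gt_eqF // => /(_ isT)/eqP;
  rewrite (eqr_nat R 1 2).
Qed.

End Example.

Theorem theorem7p4 (R : realType) :
  (forall A : op R, L1inf A -> measurable_wrt PT A -> measurable_wrt Dixmier A) /\
  (exists A : op R, [/\ L1inf A, pos_op A, measurable_wrt Dixmier A &
                        ~ measurable_wrt PT A]).
Proof.
split.
  move=> A _ mA tau1 tau2 /Dixmier_PT h1 /Dixmier_PT h2; exact: mA.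
exists (@ex_op R); split; [exact: ex_op_L1inf|exact: ex_op_pos|exact: ex_op_Dixmier|].
exact: ex_op_PT.
Qed.
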